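(* Let $F$ be a random variable with density $f:\mathbb R\to[0,\infty)$, satisfying $E[F]=0$ and $E[F^2]=1$, and admitting a Stein factor $\tau_F$. Let $Z\sim\mathscr N(0,1)$ be a standard Gaussian random variable independent of $F$. If, for some $\alpha,\kappa,\eta>0$, one has $$E\big[|\tau_F(F)|^{2+\eta}\big]<\infty$$ and $$\mathbf{TV}\big(\sqrt t\,F+\sqrt{1-t}\,x,\,F\big)\le\kappa(1+|x|)\,t^{-1}(1-t)^{\alpha},\qquad x\in\mathbb R,\ t\in(0,1],$$ then, provided $\Delta:=E[(1-\tau_F(F))^2]\le1$, $$D(F\|Z)\le\frac{\eta+1}{(1\wedge2\alpha)\eta}\,\Delta\,|\log\Delta|+\frac{C_\eta(\eta+1)}{(1\wedge2\alpha)\eta}\,\Delta,$$ where $$C_\eta=2(4\kappa+4)^{\frac{\eta}{\eta+1}}\,E\big[|Z|^{\eta+2}\big]^{\frac1{\eta+1}}\big(1+E\big[|\tau_F(F)|^{\eta+2}\big]\big)^{\frac1{\eta+1}}.$$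
   Context: A Stein factor of $F$ is a mapping $\tau_F:\mathbb R\to\mathbb R$ with $\tau_F(F)\in L^1$ and $E[Fg(F)]=E[\tau_F(F)g'(F)]$ for every smooth test function $g:\mathbb R\to\mathbb R$ for which both expectations are well defined (in particular for $g$ continuously differentiable with compact support, and for $g(x)=x$). The relative entropy is $D(F\|Z)=\int_{\mathbb R}f(x)\log(f(x)/\phi_1(x))\,dx$ with $\phi_1(x)=(2\pi)^{-1/2}e^{-x^2/2}$. The total variation distance between (the laws of) random variables $X,Y$ is $\mathbf{TV}(X,Y)=\sup_{A\in\mathscr B(\mathbb R)}|P[X\in A]-P[Y\in A]|$. Logarithms have base $e$, $0\log0:=0$, and $a\wedge b=\min(a,b)$. *)

(* Defs.v *)
From HB Require Import structures.
From mathcomp Require Import all_boot all_order all_algebra.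
From mathcomp Require Import all_classical all_reals all_analysis.

Set Implicit Arguments.
Unset Strict Implicit.
Unset Printing Implicit Defensive.

Import Order.TTheory GRing.Theory Num.Theory.
Import numFieldNormedType.Exports.

Local Open Scope classical_set_scope.
Local Open Scope ring_scope.

Section Definitions.
Context {d : measure_display} {T : measurableType d} {R : realType}.
Variable P : probability T R.

Definition independent_rvs (X Y : {RV P >-> R}) : Prop :=
  forall A B : set R, measurable A -> measurable B ->
    P (X @^-1` A `&` Y @^-1` B) = (P (X @^-1` A) * P (Y @^-1` B))%E.

(* Laws are compared on Borel sets only: a measure is a total function on
   [set R], whose values outside the sigma-algebra are irrelevant. *)
Definition has_density (X : {RV P >-> R}) (f : R -> R) : Prop :=
  [/\ measurable_fun [set: R] f,
      forall x, 0 <= f x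
    & forall A : set R, measurable A ->
        distribution P X A = (\int[lebesgue_measure]_(x in A) (f x)%:E)%E].

Definition standard_gaussian (X : {RV P >-> R}) : Prop :=
  forall A : set R, measurable A ->
    distribution P X A = normal_prob (0 : R) (1 : R) A.

(* Test functions are the continuously differentiable g for which both
   F g(F) and tau(F) g'(F) are integrable. *)
Definition stein_factor (F : {RV P >-> R}) (tau : R -> R) : Prop :=
  [/\ measurable_fun [set: R] tau,
      P.-integrable [set: T] (fun w => (tau (F w))%:E)
    & forall g : R -> R,
        (forall x, derivable g x 1) -> continuous (derive1 g) ->
        P.-integrable [set: T] (fun w => (F w * g (F w))%:E) ->
        P.-integrable [set: T] (fun w => (tau (F w) * derive1 g (F w))%:E) ->
        ('E_P[fun w => (F w * g (F w))%R] =
         'E_P[fun w => (tau (F w) * derive1 g (F w))%R])%E].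

Definition tv_dist (X Y : T -> R) : \bar R :=
  ereal_sup [set `|P (X @^-1` A) - P (Y @^-1` A)|%E
            | A in [set A : set R | measurable A]].

End Definitions.

(* D(F || Z) for F of density f and Z standard Gaussian; [ln 0 = 0], so the
   integrand vanishes where f does. The value may be +oo. *)
Definition relative_entropy {R : realType} (f : R -> R) : \bar R :=
  (\int[lebesgue_measure]_x (f x * ln (f x / normal_pdf 0 1 x))%:E)%E.

(* Main.v *)
Require Import Defs.
From HB Require Import structures.
From mathcomp Require Import all_boot all_order all_algebra.
From mathcomp Require Import all_classical all_reals all_analysis.
From mathcomp Require Import measurable_realfun.
From mathcomp Require Import ring lra.

Set Implicit Arguments.
Unset Strict Implicit.
Unset Printing Implicit Defensive.

Import Order.TTheory GRing.Theory Num.Theory.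
Import numFieldNormedType.Exports.

Local Open Scope classical_set_scope.
Local Open Scope ring_scope.

(** Let F_t = sqrt t F + sqrt (1 - t) Z, with density q_t and score
    s_t = (ln q_t)' + y relative to the Gaussian density, and let
    D(t) = D(F_t || Z). Then D(0) = 0 and D'(t) = E[s_t(F_t)^2] / (2 t) (de
    Bruijn). Applying the Stein factor to the smoothing of s_t by the Gaussian
    noise gives
      E[s_t(F_t)^2] = - t (1 - t)^(-1/2) E[(1 - tau(F)) Z s_t(F_t)].
    Cauchy-Schwarz bounds this energy by t^2 Delta / (1 - t). Hoelder's
    inequality with exponents 2 + eta for (1 - tau(F)) Z, interpolating s_t
    between L^1 and L^2, bounds it instead in terms of
    E|s_t(F_t)| <= 1 + (1 - t)^(-1/2) sup_{|g| <= 1} |E[Z g(F_t)]|, which the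
    total variation hypothesis controls; the result is integrable up to t = 1.
    The first bound is used while 1 - t >= Delta^(1/beta), the second one
    afterwards.

    Two shortcuts avoid regularity in time. By Gibbs' inequality
    D(t) - D(t') <= E[u_t(F_t) - u_t(F_t')] for u_t = ln (q_t / phi), which
    suffices to bound the left Dini derivative of D; and D(F || Z) is bounded by
    the limit of D(t) through the variational formula
    E[g(F)] <= D + E[exp g(Z)] - 1 for bounded g, whose left-hand side is
    continuous in total variation. *)

(** * Integration against a density; affine images of the Gaussian law *)

(** The constants come from one exponent. For the energy S = E[s_t(F_t)^2], Hoelder's inequality
    reads S <= c w^(1/(2+eta)) m^(eta/(2+eta)) S^(1/(2+eta)), with c = t (1-t)^(-1/2), w a bound on
    the moment of order 2+eta and m a bound on E|s_t(F_t)|. Since S reappears on the right, it can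
    be solved for, with power 1/(1+eta). The total variation bound gives m of order (1-t)^(a-1/2)
    with a = min(1/2, alpha); the cap 1/2 is due to the bounded term in m. Hence S is of order
    (1-t)^(beta-1) with beta = a eta/(1+eta), and 1/(2 beta) = (eta+1)/((1 /\ 2 alpha) eta) is the
    prefactor of both terms of the result: it comes from ln Delta^(1/beta) in the first and from
    integrating (1-t)^(beta-1) in the second. The recurring obstacle is integrability: the score is
    unbounded and [tau] has only moments. It rests on a linear growth bound for the score at each t
    < 1, valid for every law with second moment at most one. *)

Section integral_density.
Local Open Scope ereal_scope.
Context d (T : measurableType d) (R : realType).
Variables (lam : {sigma_finite_measure set T -> \bar R})
  (m : {finite_measure set T -> \bar R}) (f : T -> R).
Hypothesis mf : measurable_fun [set: T] f.
Hypothesis mE : forall A, measurable A -> m A = \int[lam]_(x in A) (f x)%:E.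

(** [m] is dominated by [lam], so the change of variables for its Radon-Nikodym derivative applies;
    that derivative agrees with [f] almost everywhere, both having the same integral over every
    measurable set. *)
Lemma ge0_integral_density (g : T -> \bar R) :
  measurable_fun [set: T] g -> (forall x, 0 <= g x) ->
  \int[m]_x g x = \int[lam]_x (g x * (f x)%:E).
Proof.
move=> mg g0.
have dom : m `<< lam.
  apply/null_content_dominatesP => A mA A0; rewrite mE//.
  by apply: null_set_integral => //; apply: measurable_funTS; exact/measurable_EFinP.
rewrite -(Radon_Nikodym_SigmaFinite.change_of_variables dom)//.
apply: ae_eq_integral => //.
- apply: emeasurable_funM => //; apply: (measurable_int lam).
  exact: Radon_Nikodym_SigmaFinite.f_integrable.
- by apply: emeasurable_funM => //; exact/measurable_EFinP.
- apply: ae_eqe_mul2l; apply: integral_ae_eq => //.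
  + exact: Radon_Nikodym_SigmaFinite.f_integrable.
  + exact/measurable_EFinP.
  + by move=> A _ mA; rewrite -Radon_Nikodym_SigmaFinite.f_integral// mE.
Qed.

End integral_density.

Section affine_change_of_variable.
Context (R : realType).
Local Notation leb := (@lebesgue_measure R).
Implicit Types (m s : R).

Lemma measurable_affine m s :
  measurable_fun [set: measurableTypeR R] (fun z => m + s * z : measurableTypeR R).
Proof. by apply: measurable_funD => //; exact: measurable_funM. Qed.

(** Both sides are measures in [A], so by uniqueness of Lebesgue measure it is enough to compare
    them on half-open intervals. *)
Lemma lebesgue_measure_affine m s (A : set R) : 0 < s -> measurable A ->
  leb A = (s%:E * leb ((fun z : R => (m + s * z)%R) @^-1` A))%E.
Proof.
move=> s0 mA.
pose psi := (fun z => m + s * z) : measurableTypeR R -> measurableTypeR R.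
have mpsi : measurable_fun setT psi := measurable_affine m s.
pose psi' := HB.pack_for {mfun measurableTypeR R >-> measurableTypeR R} psi
  (@isMeasurableFun.Build _ _ _ _ psi mpsi).
pose s' := NngNum (ltW s0).
rewrite (@lebesgue_measure_unique _ (mscale s' (pushforward leb psi')))//.
move=> _ [[a b] _ <-] /=; rewrite /mscale /= /pushforward /=.
have -> : psi @^-1` `]a, b] = `](a - m) / s, (b - m) / s]%classic.
  apply/seteqP; split => z /=; rewrite !in_itv/= /psi ltr_pdivrMr// ler_pdivlMr//;
  by rewrite ltrBlDl lerBrDl (mulrC z).
rewrite !lebesgue_measure_itv/= !lte_fin ltr_pM2r ?invr_gt0// ltrD2r.
case: ifPn => ab; last by rewrite mule0.
by rewrite -EFinM -mulrBl opprB addrA subrK mulrC divfK// gt_eqF.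
Qed.

Lemma ge0_integral_affine m s (g : R -> \bar R) : 0 < s ->
  measurable_fun [set: measurableTypeR R] g -> (forall x, 0 <= g x)%E ->
  (\int[leb]_y g y = \int[leb]_z (s%:E * g (m + s * z)%R))%E.
Proof.
move=> s0 mg g0.
pose psi := (fun z => m + s * z) : measurableTypeR R -> measurableTypeR R.
have mpsi : measurable_fun setT psi := measurable_affine m s.
pose psi' := HB.pack_for {mfun measurableTypeR R >-> measurableTypeR R} psi
  (@isMeasurableFun.Build _ _ _ _ psi mpsi).
pose s' := NngNum (ltW s0).
pose pf := measure_function_pushforward__canonical__measure_function_Measure
  leb mpsi.
transitivity (\int[mscale s' pf]_y g y)%E.
  by apply: eq_measure_integral => A mA _; exact: lebesgue_measure_affine.
rewrite ge0_integral_mscale// ge0_integral_pushforward//=.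
rewrite ge0_integralZl//; last by rewrite lee_fin ltW.
exact: measurableT_comp.
Qed.

Lemma normal_pdf_affine m s z : 0 < s ->
  s * normal_pdf m s (m + s * z) = normal_pdf 0 1 z.
Proof.
move=> s0; rewrite !normal_pdfE ?gt_eqF//= /normal_peak /normal_fun.
rewrite addrAC subrr add0r subr0 expr1n mul1r.
rewrite -mulrnAr sqrtrM ?sqr_ge0// sqrtr_sqr gtr0_norm// invfM mulrA mulrA.
rewrite divff ?gt_eqF// mul1r; congr (_ * expR _).
by rewrite exprMn -mulNr -[in LHS]mulr_natr invfM; field; rewrite gt_eqF.
Qed.

Variables (ga : probability (measurableTypeR R) R).
Hypothesis gaE : forall A, measurable A ->
  ga A = (\int[leb]_(x in A) (normal_pdf 0 1 x)%:E)%E.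

Lemma ge0_integral_normal_affine m s (h : R -> \bar R) : 0 < s ->
  measurable_fun [set: measurableTypeR R] h -> (forall x, 0 <= h x)%E ->
  (\int[ga]_z h (m + s * z)%R =
   \int[leb]_y (h y * (normal_pdf m s y)%:E))%E.
Proof.
move=> s0 mh h0.
have mh' : measurable_fun [set: measurableTypeR R] (fun z => h (m + s * z)).
  by apply: measurableT_comp => //; exact: measurable_affine.
rewrite (@ge0_integral_density _ (measurableTypeR R) _ _ _ _ (measurable_normal_pdf 0 1) gaE _ mh' (fun z => h0 _)).
rewrite [RHS](ge0_integral_affine m s0).
- apply: eq_integral => z _; rewrite muleCA -EFinM.
  by rewrite normal_pdf_affine.
- apply: emeasurable_funM => //; apply/measurable_EFinP.
  exact: measurable_normal_pdf.
- by move=> x; rewrite mule_ge0// lee_fin normal_pdf_ge0.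
Qed.

(** Positive and negative parts are transported separately, so the equality holds for every
    measurable [h], integrable or not. *)
Lemma integral_normal_affine m s (h : R -> R) : 0 < s ->
  measurable_fun [set: measurableTypeR R] h ->
  (\int[ga]_z (h (m + s * z)%R)%:E =
   \int[leb]_y (h y * normal_pdf m s y)%:E)%E.
Proof.
move=> s0 mh; rewrite [LHS]integralE [RHS]integralE.
have mh' : measurable_fun [set: measurableTypeR R] (EFin \o h).
  exact/measurable_EFinP.
congr (_ - _)%E.
- transitivity (\int[ga]_z ((EFin \o h)^\+ (m + s * z)%R))%E.
    by apply: eq_integral => z _; rewrite !funeposE.
  rewrite ge0_integral_normal_affine//; last exact: measurable_funepos.
  apply: eq_integral => y _; rewrite !funeposE/= muleC maxe_pMr ?lee_fin ?normal_pdf_ge0//.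
  by rewrite mule0 -EFinM mulrC.
- transitivity (\int[ga]_z ((EFin \o h)^\- (m + s * z)%R))%E.
    by apply: eq_integral => z _; rewrite !funenegE.
  rewrite ge0_integral_normal_affine//; last exact: measurable_funeneg.
  apply: eq_integral => y _; rewrite !funenegE/= muleC maxe_pMr ?lee_fin ?normal_pdf_ge0//.
  by rewrite mule0 -EFinM mulrN mulrC.
Qed.

End affine_change_of_variable.

(** * Integrable functions; smoothness of Gaussian convolutions *)

Section L1_toolkit.
Context d (T : measurableType d) (R : realType).
Variable m : {measure set T -> \bar R}.
Implicit Types f g : T -> R.

Definition L1 f := m.-integrable [set: T] (EFin \o f).

Lemma L1_measurable f : L1 f -> measurable_fun [set: T] f.
Proof. by move=> /integrableP[/measurable_EFinP]. Qed.

Lemma L1_dom f g : measurable_fun [set: T] f -> (forall x, `|f x| <= g x) ->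
  L1 g -> L1 f.
Proof.
move=> mf fg; apply: le_integrable => //; first exact/measurable_EFinP.
by move=> x _ /=; rewrite lee_fin (le_trans (fg x))// ler_norm.
Qed.

Lemma L1D f g : L1 f -> L1 g -> L1 (fun x => f x + g x).
Proof. by move=> lf lg; apply: eq_integrable (integrableD measurableT lf lg). Qed.

Lemma L1B f g : L1 f -> L1 g -> L1 (fun x => f x - g x).
Proof. by move=> lf lg; apply: eq_integrable (integrableB measurableT lf lg). Qed.

Lemma L1Zl (k : R) f : L1 f -> L1 (fun x => k * f x).
Proof. by move=> lf; apply: eq_integrable (integrableZl measurableT k lf). Qed.

Lemma L1Zr (k : R) f : L1 f -> L1 (fun x => f x * k).
Proof. by move=> lf; under eq_fun do rewrite mulrC; exact: L1Zl. Qed.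

Lemma L1_norm f : L1 f -> L1 (fun x => `|f x|).
Proof. exact: integrable_norm. Qed.

Lemma L1_lt_pinfty f : (forall x, 0 <= f x) -> measurable_fun [set: T] f ->
  (\int[m]_x (f x)%:E < +oo)%E -> L1 f.
Proof.
move=> f0 mf lf; apply/integrableP; split; first exact/measurable_EFinP.
by under eq_integral do rewrite /= ger0_norm//.
Qed.

Lemma fin_Rintegral f : L1 f -> (\int[m]_x (f x)%:E = (\int[m]_x f x)%:E)%E.
Proof. by move=> lf; rewrite fineK// integrable_fin_num. Qed.

Lemma RintZl (k : R) f : L1 f -> \int[m]_x (k * f x) = k * \int[m]_x f x.
Proof. exact: RintegralZl. Qed.

Lemma RintD f g : L1 f -> L1 g ->
  \int[m]_x (f x + g x) = \int[m]_x f x + \int[m]_x g x.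
Proof. exact: RintegralD. Qed.

Lemma RintB f g : L1 f -> L1 g ->
  \int[m]_x (f x - g x) = \int[m]_x f x - \int[m]_x g x.
Proof. exact: RintegralB. Qed.

Lemma le_Rint f g : L1 f -> L1 g -> (forall x, f x <= g x) ->
  \int[m]_x f x <= \int[m]_x g x.
Proof. by move=> lf lg fg; apply: le_Rintegral. Qed.

Lemma ge0_Rint f : (forall x, 0 <= f x) -> 0 <= \int[m]_x f x.
Proof. by move=> f0; apply: Rintegral_ge0. Qed.

Lemma norm_Rint f g : L1 f -> L1 g -> (forall x, `|f x| <= g x) ->
  `|\int[m]_x f x| <= \int[m]_x g x.
Proof.
move=> lf lg fg; apply: le_trans (le_normr_Rintegral _ lf) _ => //.
by apply: le_Rint => //; exact: L1_norm.
Qed.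

Lemma Rint_dominated_cvg (f_ : nat -> T -> R) f g :
  (forall n, measurable_fun [set: T] (f_ n)) -> measurable_fun [set: T] f ->
  (forall x, f_ n x @[n --> \oo] --> f x) -> L1 g ->
  (forall n x, `|f_ n x| <= g x) ->
  \int[m]_x f_ n x @[n --> \oo] --> \int[m]_x f x.
Proof.
move=> mf_ mf cf lg fg.
have hc x : ((f_ n x)%:E @[n --> \oo] --> (f x)%:E)%E.
  by apply: cvg_EFin; [exact: nearW|exact: cf].
have [lf _ h] := @dominated_convergence _ _ _ m setT measurableT
  (fun n x => (f_ n x)%:E) (EFin \o f) (EFin \o g)
  (fun n => (iffRL (measurable_EFinP _ _)) (mf_ n))
  ((iffRL (measurable_EFinP _ _)) mf)
  (aeW _ (fun x _ => hc x)) lg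
  (aeW _ (fun x n _ => fg n x)).
apply/fine_cvg; rewrite -(fin_Rintegral lf); exact: h.
Qed.

End L1_toolkit.

Section L1_probability.
Context d (T : measurableType d) (R : realType) (P : probability T R).

Lemma L1_cst (k : R) : L1 P (fun=> k).
Proof. exact: finite_measure_integrable_cst. Qed.

Lemma Rint_cst (k : R) : \int[P]_x k = k.
Proof. by rewrite Rintegral_cst//= probability_setT/= mulr1. Qed.

End L1_probability.

Section gaussian_convolution.
Context d (T : measurableType d) (R : realType).
Variables (m : {measure set T -> \bar R}) (a b : T -> R) (s : R).
Hypotheses (s0 : 0 < s) (ma : measurable_fun [set: T] a)
  (mb : measurable_fun [set: T] b).
Hypothesis dom : forall c, L1 m
  (fun w => `|a w| * (1 + `|b w - c|) * expR (- (b w - c) ^+ 2 / (4 * s ^+ 2))).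

Let g c w := normal_pdf c s (b w).
Let g' c w := (b w - c) / s ^+ 2 * normal_pdf c s (b w).

Lemma is_derive_normal_pdf_mean (y c : R) :
  is_derive c 1 (fun c => normal_pdf c s y) ((y - c) / s ^+ 2 * normal_pdf c s y).
Proof.
have sn0 : s != 0 by rewrite gt_eqF.
have -> : (fun c => normal_pdf c s y) =
    (fun c => normal_peak s * expR (- (y - c) ^+ 2 / (s ^+ 2 *+ 2))).
  by apply/funext => c'; rewrite normal_pdfE.
rewrite normal_pdfE// /normal_fun.
have h : is_derive c 1 (fun c => - (y - c) ^+ 2 / (s ^+ 2 *+ 2)) ((y - c) / s ^+ 2).
  by apply: is_derive_eq; rewrite /GRing.scale /=; field.
have h2 := @is_derive1_comp _ expR (fun c => - (y - c) ^+ 2 / (s ^+ 2 *+ 2)) c _ _ (is_derive_expR _) h.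
apply: is_derive_eq; rewrite /GRing.scale/= /normal_fun; ring.
Qed.

Lemma continuous_normal_pdf_mean (y : R) : continuous (fun c => normal_pdf c s y).
Proof.
move=> c; apply/differentiable_continuous/derivable1_diffP.
by have [] := is_derive_normal_pdf_mean y c.
Qed.

(** Doubling the variance absorbs a shift of the mean by less than 1, since (y - c0)^2 <= 2 (y -
    c)^2 + 2 (c - c0)^2. The bound is uniform in [c] near [c0], as differentiation under the
    integral requires; hence the factor 4 in [dom]. *)
Lemma normal_pdf_mean_dom (y c c0 : R) : `|c - c0| < 1 ->
  normal_pdf c s y <= normal_peak s * expR (2 * s ^+ 2)^-1 *
    expR (- (y - c0) ^+ 2 / (4 * s ^+ 2)).
Proof.
move=> cc0; have sn0 : s != 0 by rewrite gt_eqF.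
have s20 : 0 < s ^+ 2 by rewrite exprn_gt0.
rewrite normal_pdfE//= /normal_fun -mulrA -expRD ler_wpM2l ?normal_peak_ge0//.
rewrite ler_expR -(ler_pM2r (_ : 0 < 4 * s ^+ 2)) ?mulr_gt0//.
have -> : - (y - c) ^+ 2 / (s ^+ 2 *+ 2) * (4 * s ^+ 2) = - 2 * (y - c) ^+ 2.
  by field.
have -> : ((2 * s ^+ 2)^-1 + - (y - c0) ^+ 2 / (4 * s ^+ 2)) * (4 * s ^+ 2) =
  2 - (y - c0) ^+ 2 by field.
move: cc0; rewrite ltr_norml => /andP[h1 h2].
have h3 : (c - c0) ^+ 2 <= 1 by nra.
have := sqr_ge0 (y - c - (c - c0)); nra.
Qed.

Let C : R := normal_peak s * expR (2 * s ^+ 2)^-1.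

Let C0 : 0 <= C.
Proof. by rewrite mulr_ge0 ?normal_peak_ge0 ?expR_ge0. Qed.

Let mg c : measurable_fun [set: T] (g c).
Proof. by apply: measurableT_comp => //; exact: measurable_normal_pdf. Qed.

Let mg' c : measurable_fun [set: T] (g' c).
Proof.
apply: measurable_funM; last exact: mg.
by apply: measurable_funM => //; exact: measurable_funB.
Qed.

(** A single majorant: the summand 1 serves the kernel, the summand [2 / s ^+ 2] its derivative in
    the mean. *)
Let G c0 w := C * (1 + 2 / s ^+ 2) *
  (`|a w| * (1 + `|b w - c0|) * expR (- (b w - c0) ^+ 2 / (4 * s ^+ 2))).

Let lG c0 : L1 m (G c0). Proof. exact: L1Zl. Qed.

Let G0 c0 w : 0 <= G c0 w.
Proof.
apply: mulr_ge0; first by rewrite mulr_ge0// addr_ge0// divr_ge0// sqr_ge0.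
by rewrite mulr_ge0 ?expR_ge0// mulr_ge0// addr_ge0.
Qed.

Let gG c c0 w : `|c - c0| < 1 -> `|a w * g c w| <= G c0 w.
Proof.
move=> cc0; rewrite normrM (ger0_norm (normal_pdf_ge0 _ _ _)).
have h := normal_pdf_mean_dom (b w) cc0; rewrite -/(g c w) -/C in h.
set e := expR _ in h *; rewrite /G -/e.
have e0 : 0 <= e by exact: expR_ge0.
have k0 : 0 <= 2 / s ^+ 2 by rewrite divr_ge0// sqr_ge0.
apply: (@le_trans _ _ (`|a w| * (C * e))); first exact: ler_wpM2l.
have -> : C * (1 + 2 / s ^+ 2) * (`|a w| * (1 + `|b w - c0|) * e) =
  `|a w| * (C * e) * ((1 + 2 / s ^+ 2) * (1 + `|b w - c0|)) by ring.
have Ce0 : 0 <= C * e by exact: mulr_ge0.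
rewrite ler_peMr//; first exact: mulr_ge0.
have := normr_ge0 (b w - c0); nra.
Qed.

Let g'G c c0 w : `|c - c0| < 1 -> `|a w * g' c w| <= G c0 w.
Proof.
move=> cc0; rewrite /g' normrM normrM (ger0_norm (normal_pdf_ge0 _ _ _)).
have h := normal_pdf_mean_dom (b w) cc0; rewrite -/(g c w) -/C in h.
rewrite -/(g c w).
set e := expR _ in h *; rewrite /G -/e.
have e0 : 0 <= e by exact: expR_ge0.
have s20 : 0 < s ^+ 2 by rewrite exprn_gt0.
have hb : `|b w - c| <= 2 * (1 + `|b w - c0|).
  have -> : b w - c = (b w - c0) - (c - c0) by ring.
  apply: le_trans (ler_normB _ _) _.
  by have := normr_ge0 (b w - c0); nra.
have k0 : 0 <= (s ^+ 2)^-1 by rewrite invr_ge0 ltW.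
rewrite normrM (ger0_norm k0).
have g0 : 0 <= g c w by exact: normal_pdf_ge0.
apply: (@le_trans _ _ (`|a w| * (2 * (1 + `|b w - c0|) * (s ^+ 2)^-1 * (C * e)))).
  apply: ler_wpM2l => //; apply: ler_pM => //; first by rewrite mulr_ge0.
  exact: ler_wpM2r.
have -> : C * (1 + 2 / s ^+ 2) * (`|a w| * (1 + `|b w - c0|) * e) =
  `|a w| * (2 * (1 + `|b w - c0|) * (s ^+ 2)^-1 * (C * e)) +
  C * (`|a w| * (1 + `|b w - c0|) * e) by ring.
have b0 : 0 <= 1 + `|b w - c0| by rewrite addr_ge0.
by rewrite lerDl; apply: mulr_ge0 => //; rewrite !mulr_ge0.
Qed.

Lemma L1_gaussian_convolution c : L1 m (fun w => a w * normal_pdf c s (b w)).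
Proof.
apply: L1_dom (lG c); first by apply: measurable_funM => //; exact: mg.
by move=> w; apply: gG; rewrite subrr normr0.
Qed.

Lemma L1_gaussian_convolution_deriv c :
  L1 m (fun w => a w * ((b w - c) / s ^+ 2 * normal_pdf c s (b w))).
Proof.
apply: L1_dom (lG c); first by apply: measurable_funM => //; exact: mg'.
by move=> w; apply: g'G; rewrite subrr normr0.
Qed.

Let f c w := a w * normal_pdf c s (b w).

Let df (c : R) w : is_derive c 1 (fun c => f c w) (a w * g' c w).
Proof.
have h := is_derive_normal_pdf_mean (b w) c.
by apply: is_derive_eq; rewrite /GRing.scale/= /g'; ring.
Qed.

Let in_ball (c c0 : R) : `](c0 - 1), (c0 + 1)[%classic c -> `|c - c0| < 1.
Proof. by rewrite /= in_itv/= ltr_norml => /andP[? ?]; lra. Qed.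

Let ball_c (c : R) : `](c - 1), (c + 1)[%classic c.
Proof. by rewrite /= in_itv/=; lra. Qed.

(** Only the kernel depends on [c], so the weight [a] needs no regularity. The lemma is used with
    [a = 1] under the law of F, for the density of the interpolation, and with [a = g] under
    Lebesgue measure, for the smoothing in Stein's identity. *)
Lemma is_derive_gaussian_convolution (c : R) :
  is_derive c 1 (fun c => \int[m]_w (a w * normal_pdf c s (b w)))
    (\int[m]_w (a w * ((b w - c) / s ^+ 2 * normal_pdf c s (b w)))).
Proof.
have lf x : `](c - 1), (c + 1)[%classic x -> L1 m (f x).
  by move=> _; exact: L1_gaussian_convolution.
have hd x w : `](c - 1), (c + 1)[%classic x -> setT w -> derivable (f ^~ w) x 1.
  by move=> _ _; have [] := df x w.
have hG x w : `](c - 1), (c + 1)[%classic x -> setT w ->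
    `|partial1of2 f x w| <= G c w.
  move=> /in_ball cx _; rewrite partial1of2E.
  by rewrite (@derive_val _ _ _ _ _ _ _ (df x w)); exact: g'G.
have D := @derivable_under_integral _ _ _ m f setT measurableT c (c - 1) (c + 1)
  (ball_c c) lf hd (G c) (G0 c) (lG c) hG.
have E := @differentiation_under_integral _ _ _ m f setT measurableT c (c - 1) (c + 1)
  (ball_c c) lf hd (G c) (G0 c) (lG c) hG.
apply: DeriveDef => //.
rewrite -derive1E E; apply: eq_Rintegral => w _.
by rewrite partial1of2E (@derive_val _ _ _ _ _ _ _ (df c w)).
Qed.

Lemma continuous_gaussian_convolution_deriv :
  continuous (fun c =>
    \int[m]_w (a w * ((b w - c) / s ^+ 2 * normal_pdf c s (b w)))).
Proof.
move=> c.
have lf x : `](c - 1), (c + 1)[%classic x ->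
    L1 m (fun w => a w * ((b w - x) / s ^+ 2 * normal_pdf x s (b w))).
  by move=> _; exact: L1_gaussian_convolution_deriv.
have cf : {ae m, forall w, setT w -> {in `](c - 1), (c + 1)[%classic,
    continuous (fun x => a w * ((b w - x) / s ^+ 2 * normal_pdf x s (b w)))}}.
  apply: aeW => w _ x _.
  apply: cvgM; first exact: cvg_cst.
  apply: cvgM.
    apply: cvgM; last exact: cvg_cst.
    by apply: cvgB; [exact: cvg_cst|exact: cvg_id].
  exact: continuous_normal_pdf_mean.
have hG x : `](c - 1), (c + 1)[%classic x -> {ae m, forall w, setT w ->
    `|a w * ((b w - x) / s ^+ 2 * normal_pdf x s (b w))| <= G c w}.
  by move=> /in_ball cx; apply: aeW => w _; exact: g'G.
apply: (continuity_under_integral measurableT lf cf (lG c) hG).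
by rewrite inE; exact: ball_c.
Qed.

End gaussian_convolution.

Ltac msr :=
  first
  [ assumption
  | exact: measurable_cst
  | lazymatch goal with
    | |- measurable_fun _ (fun x => (@?f x + @?g x)%R) =>
        apply: (@measurable_funD _ _ _ _ f g); msr
    | |- measurable_fun _ (fun x => (- @?f x)%R) =>
        apply: (measurableT_comp (@oppr_measurable _ setT)); msr
    | |- measurable_fun _ (fun x => (@?f x * @?g x)%R) =>
        apply: (@measurable_funM _ _ _ _ f g); msr
    | |- measurable_fun _ (fun x => (@?f x ^+ ?n)%R) =>
        apply: (@measurable_funX _ _ _ _ f n); msr
    | |- measurable_fun _ (fun x => (`|@?f x|)%R) =>
        apply: (measurableT_comp (@normr_measurable _ setT)); msr
    | |- measurable_fun _ (fun x => expR (@?f x)) =>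
        apply: (measurableT_comp (@measurable_expR _)); msr
    | |- measurable_fun _ (fun x => ln (@?f x)) =>
        apply: (measurableT_comp (@measurable_ln _)); msr
    | |- measurable_fun _ (fun x => powR (@?f x) ?p) =>
        apply: (measurableT_comp (measurable_powR p)); msr
    | |- measurable_fun _ (fun x => normal_pdf ?m ?s (@?f x)) =>
        apply: (measurableT_comp (measurable_normal_pdf m s)); msr
    | |- measurable_fun _ (fun x => ?h (@?f x)) =>
        apply: (measurableT_comp (f := h)); [assumption|msr]
    end
  | exact: measurable_id
  | exact: measurable_fst
  | exact: measurable_snd
  | exact: mulrl_measurable
  | exact: normr_measurable
  | exact: oppr_measurable
  | exact: measurable_expR
  | exact: measurable_ln
  | exact: measurable_powR
  | exact: measurable_normal_pdf ].

(** * Integration over a product of two probability spaces *)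

Section product_L1.
Context d1 d2 (T1 : measurableType d1) (T2 : measurableType d2) (R : realType).
Variables (m1 : probability T1 R) (m2 : probability T2 R).
Local Notation nu := (m1 \x m2)%E.

Lemma L1_prod (f : T1 -> R) (g : T2 -> R) : L1 m1 f -> L1 m2 g ->
  L1 nu (fun p => f p.1 * g p.2).
Proof.
move=> lf lg; have mf := L1_measurable lf; have mg := L1_measurable lg.
have mfg : measurable_fun [set: T1 * T2] (fun p => f p.1 * g p.2).
  apply: measurable_funM.
    by apply: measurableT_comp => //; exact: measurable_fst.
  by apply: measurableT_comp => //; exact: measurable_snd.
apply: (proj2 (integrable12ltyP _ _ (iffRL (measurable_EFinP _ _) mfg))) => /=.
have -> : (fun x => \int[m2]_y `|(f x * g y)%:E|)%E =
    (fun x => `|f x|%:E * (\int[m2]_y `|g y|)%R%:E)%E.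
  apply/funext => x; rewrite -(fin_Rintegral (L1_norm lg)).
  rewrite -integralZl//; last exact: (L1_norm lg).
  by apply: eq_integral => y _; rewrite -EFinM -normrM.
rewrite integralZr//; last exact: (L1_norm lf).
by rewrite (fin_Rintegral (L1_norm lf)) -EFinM ltry.
Qed.

Lemma Rint_prod (f : T1 -> R) (g : T2 -> R) : L1 m1 f -> L1 m2 g ->
  \int[nu]_p (f p.1 * g p.2) = (\int[m1]_x f x) * (\int[m2]_y g y).
Proof.
move=> lf lg; rewrite /Rintegral -(integral12_prod_meas1 (L1_prod lf lg)).
rewrite /fubini_F/=.
have -> : (fun x => \int[m2]_y (f x * g y)%:E)%E =
    (fun x => (f x)%:E * (\int[m2]_y g y)%R%:E)%E.
  apply/funext => x; rewrite -(fin_Rintegral lg) -integralZl//.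
rewrite integralZr//.
by rewrite (fin_Rintegral lf) -EFinM.
Qed.

Lemma L1_fst (f : T1 -> R) : L1 m1 f -> L1 nu (fun p => f p.1).
Proof.
move=> lf; have := L1_prod lf (L1_cst m2 1).
by under eq_fun do rewrite mulr1.
Qed.

Lemma Rint_fst (f : T1 -> R) : L1 m1 f ->
  \int[nu]_p f p.1 = \int[m1]_x f x.
Proof.
move=> lf; have := Rint_prod lf (L1_cst m2 1).
by under eq_Rintegral do rewrite mulr1; rewrite Rint_cst mulr1.
Qed.

Lemma L1_snd (f : T2 -> R) : L1 m2 f -> L1 nu (fun p => f p.2).
Proof.
move=> lf; have := L1_prod (L1_cst m1 1) lf.
by under eq_fun do rewrite mul1r.
Qed.

Lemma Rint_snd (f : T2 -> R) : L1 m2 f ->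
  \int[nu]_p f p.2 = \int[m2]_x f x.
Proof.
move=> lf; have := Rint_prod (L1_cst m1 1) lf.
by under eq_Rintegral do rewrite mul1r; rewrite Rint_cst mul1r.
Qed.

(** Fubini's theorem makes almost every section integrable; assuming it of every section lets the
    inner integral be a real number throughout. *)
Lemma Rint_iter (h : T1 * T2 -> R) : L1 nu h ->
  (forall x, L1 m2 (fun y => h (x, y))) ->
  \int[nu]_p h p = \int[m1]_x \int[m2]_y h (x, y).
Proof.
move=> lh lh2; rewrite {1}/Rintegral -(integral12_prod_meas1 lh) /fubini_F/=.
congr fine; apply: eq_integral => x _.
by rewrite -(fin_Rintegral (lh2 x)).
Qed.

Lemma L1_iter (h : T1 * T2 -> R) : L1 nu h ->
  (forall x, L1 m2 (fun y => h (x, y))) ->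
  L1 m1 (fun x => \int[m2]_y h (x, y)).
Proof.
move=> lh lh2; apply: eq_integrable (integrable_fubini_F lh) => // x _.
by rewrite /fubini_F /= -(fin_Rintegral (lh2 x)).
Qed.

End product_L1.

(** * Integrability of Gaussian moments *)

Section gaussian_moments.
Context (R : realType).
Local Notation leb := (@lebesgue_measure R).
Variables (ga : probability (measurableTypeR R) R).
Hypothesis gaE : forall A, measurable A ->
  ga A = (\int[leb]_(x in A) (normal_pdf 0 1 x)%:E)%E.

Lemma normal_pdf_sym (m s x : R) : s != 0 -> normal_pdf m s x = normal_pdf x s m.
Proof.
by move=> s0; rewrite !normal_pdfE//= /normal_fun -(sqrrN (x - m)) opprB.
Qed.

(** The product of exp(z^2/4) with the standard Gaussian density is sqrt 2 times the normal density
    of variance 2. This exponential moment dominates all the other moments below. *)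
Lemma L1_gaussian_expR_sqr : L1 ga (fun z => expR (z ^+ 2 / 4)).
Proof.
apply: L1_lt_pinfty => [z||]; first exact: expR_ge0.
  by msr.
rewrite (@ge0_integral_density _ (measurableTypeR R) _ _ _ _
  (measurable_normal_pdf 0 1) gaE (fun z => (expR (z ^+ 2 / 4))%:E)); last 2 first.
- by apply/measurable_EFinP; msr.
- by move=> z; rewrite lee_fin expR_ge0.
set s := Num.sqrt 2 : R.
have s0 : 0 < s by rewrite sqrtr_gt0.
have s2 : s ^+ 2 = 2 by rewrite sqr_sqrtr.
have -> : (fun x => (expR (x ^+ 2 / 4))%:E * (normal_pdf 0 1 x)%:E)%E =
  (fun x => s%:E * (normal_pdf 0 s x)%:E)%E.
  apply/funext => x; rewrite -!EFinM; congr EFin.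
  have := normal_pdf_affine 0 (x / s) s0.
  rewrite add0r (mulrC s (x / s)) divfK ?gt_eqF// => ->.
  rewrite !normal_pdfE ?oner_neq0//= /normal_fun mulrCA -expRD.
  congr (_ * expR _); rewrite !subr0 exprMn exprVn s2; by field.
rewrite integralZl//; last exact: integrable_normal_pdf.
by rewrite integral_normal_pdf mule1 ltry.
Qed.

Lemma poly4_le_expR (z : R) : (1 + z ^+ 2) ^+ 2 <= 64 * expR (z ^+ 2 / 4).
Proof.
have h0 : 0 <= z ^+ 2 / 4 by rewrite divr_ge0// sqr_ge0.
have h1 := expR_ge1Dx (z ^+ 2 / 4).
have h2 := expR_ge1Dxn 1 h0.
have e : (2`!%:R : R) = 2 by [].
rewrite e in h2.
have -> : (1 + z ^+ 2) ^+ 2 = 1 + 8 * (z ^+ 2 / 4) + 16 * (z ^+ 2 / 4) ^+ 2 by field.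
by nra.
Qed.

Lemma L1_gaussian_poly4 : L1 ga (fun z => (1 + z ^+ 2) ^+ 2).
Proof.
apply: L1_dom (L1Zl 64 L1_gaussian_expR_sqr); first by msr.
by move=> z; rewrite ger0_norm ?sqr_ge0// poly4_le_expR.
Qed.

Lemma L1_gaussian_powR (p : R) : 0 < p -> L1 ga (fun z => `|z| `^ p).
Proof.
move=> p0; apply: L1_dom (L1Zl (expR (p ^+ 2)) L1_gaussian_expR_sqr).
  by msr.
move=> z; rewrite ger0_norm ?powR_ge0// -expRD.
have [->|z0] := eqVneq z 0.
  by rewrite normr0 powR0 ?gt_eqF// expR_ge0.
rewrite /powR normr_eq0 (negbTE z0) ler_expR.
have z1 : 0 < `|z| by rewrite normr_gt0.
(* p ln|z| <= p |z| <= p^2 + z^2/4, whence the factor [expR (p ^+ 2)]. *)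
have := ln_sublinear z1.
rewrite -(real_normK (num_real z)).
have := sqr_ge0 (p - `|z| / 2); nra.
Qed.

Lemma L1_gaussian_sqr : L1 ga (fun z => z ^+ 2).
Proof.
apply: L1_dom L1_gaussian_poly4; first by msr.
by move=> z; rewrite ger0_norm ?sqr_ge0//; have := sqr_ge0 z; nra.
Qed.

Lemma L1_gaussian_id : L1 ga (fun z => z).
Proof.
apply: L1_dom L1_gaussian_poly4; first by msr.
by move=> z; rewrite ler_norml; apply/andP; split; have := sqr_ge0 z; nra.
Qed.

End gaussian_moments.

(** * The density of the interpolation *)

Definition flow_density {R : realType} (mu : {measure set (measurableTypeR R) -> \bar R})
  (r s y : R) : R := \int[mu]_x normal_pdf (r * x) s y.

Definition flow_density_deriv {R : realType}
  (mu : {measure set (measurableTypeR R) -> \bar R}) (r s y : R) : R :=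
  \int[mu]_x ((r * x - y) / s ^+ 2 * normal_pdf (r * x) s y).

(** Up to a constant, a majorant for products of two functions of linear growth in
    [r * p.1 + s * p.2], the same for all times. *)
Definition flow_weight {R : realType} (p : R * R) : R := (1 + `|p.1| + `|p.2|) ^+ 2.

Section flow.
Context (R : realType).
Local Notation leb := (@lebesgue_measure R).
Variables (mu ga : probability (measurableTypeR R) R).
Hypothesis gaE : forall A, measurable A ->
  ga A = (\int[leb]_(x in A) (normal_pdf 0 1 x)%:E)%E.
Hypothesis mu2 : L1 mu (fun x => x ^+ 2).
Hypothesis mu2_le1 : \int[mu]_x (x ^+ 2) <= 1.
Local Notation nu := (mu \x ga)%E.

Lemma L1_flow_bound : L1 nu (fun p => (1 + p.1 ^+ 2) * (1 + p.2 ^+ 2) ^+ 2).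
Proof.
have l1 : L1 mu (fun x => 1 + x ^+ 2) by apply: L1D => //; exact: L1_cst.
exact: (L1_prod l1 (L1_gaussian_poly4 gaE)).
Qed.

Lemma flow_weight_bound (p : R * R) : (1 + p.2 ^+ 2) * flow_weight p <=
  3 * ((1 + p.1 ^+ 2) * (1 + p.2 ^+ 2) ^+ 2).
Proof.
case: p => x z /=; rewrite /flow_weight /=.
have h : (1 + `|x| + `|z|) ^+ 2 <= 3 * (1 + x ^+ 2) * (1 + z ^+ 2).
  rewrite -(real_normK (num_real x)) -(real_normK (num_real z)).
  move: `|x| `|z| => a b.
  have := sqr_ge0 (a - b); have := sqr_ge0 (1 - b); have := sqr_ge0 (a - 1).
  have := sqr_ge0 (a * b); nra.
have z0 : 0 <= 1 + z ^+ 2 by rewrite addr_ge0// sqr_ge0.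
by have := ler_wpM2l z0 h; lra.
Qed.

Lemma measurable_flow_weight :
  measurable_fun [set: measurableTypeR R * measurableTypeR R] flow_weight.
Proof. by rewrite /flow_weight; msr. Qed.

Lemma flow_weight_ge1 (p : R * R) : 1 <= flow_weight p.
Proof.
rewrite /flow_weight; have := normr_ge0 p.1; have := normr_ge0 p.2; nra.
Qed.

(** The extra factor [1 + p.2 ^+ 2] pays for the noise in products such as
    [tau p.1 * (p.2 * g (Y p))], which are split by the inequality of the means. *)
Lemma L1_sqr_flow_weight : L1 nu (fun p => (1 + p.2 ^+ 2) * flow_weight p).
Proof.
apply: L1_dom (L1Zl 3 L1_flow_bound).
  by have := measurable_flow_weight; move=> ?; msr.
move=> p; rewrite ger0_norm ?flow_weight_bound//.
by rewrite mulr_ge0 ?addr_ge0 ?sqr_ge0// (le_trans _ (flow_weight_ge1 p)).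
Qed.

Lemma L1_flow_weight : L1 nu flow_weight.
Proof.
apply: L1_dom L1_sqr_flow_weight; first exact: measurable_flow_weight.
move=> p; have := flow_weight_ge1 p; have := sqr_ge0 p.2.
by move=> h1 h2; rewrite ger0_norm; nra.
Qed.

Variables (r s : R).
Hypotheses (s0 : 0 < s).
Let sn0 : s != 0. Proof. by rewrite gt_eqF. Qed.
Local Notation K := (fun x y => normal_pdf (r * x) s y).
Local Notation q := (flow_density mu r s).
Local Notation dq := (flow_density_deriv mu r s).

Lemma measurable_normal_kernel :
  measurable_fun [set: measurableTypeR R * measurableTypeR R]
    (fun p => normal_pdf (r * p.1) s p.2).
Proof.
have -> : (fun p : R * R => normal_pdf (r * p.1) s p.2) =
    (fun p => normal_peak s * expR (- (p.2 - r * p.1) ^+ 2 / (s ^+ 2 *+ 2))).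
  by apply/funext => p; rewrite normal_pdfE.
by msr.
Qed.

(** For fixed [x], the variable [y = r x + s z] has density [normal_pdf (r * x) s]; Fubini's theorem
    then puts the integral over [x] inside. Functions of [y] leave the inner integral, which thereby
    produces the density of the interpolation or its derivative. *)
Lemma flow_disintegration (h : R * R -> R) :
  measurable_fun [set: measurableTypeR R * measurableTypeR R] h ->
  L1 nu (fun p => h (p.1, r * p.1 + s * p.2)) ->
  ((\int[nu]_p h (p.1, r * p.1 + s * p.2))%:E =
   \int[leb]_y \int[mu]_x (h (x, y) * normal_pdf (r * x) s y)%:E)%E.
Proof.
move=> mh lh; rewrite -(fin_Rintegral lh) -(integral12_prod_meas1 lh).
have mhK : measurable_fun [set: measurableTypeR R * measurableTypeR R]
    (fun p => h p * normal_pdf (r * p.1) s p.2).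
  by have := measurable_normal_kernel => ?; exact: measurable_funM.
have mhx x : measurable_fun [set: measurableTypeR R] (fun y => h (x, y)).
  exact: measurableT_comp.
have E x : (\int[ga]_z (h (x, r * x + s * z))%:E =
    \int[leb]_y (h (x, y) * normal_pdf (r * x) s y)%:E)%E.
  exact: (integral_normal_affine gaE (r * x) s0 (mhx x)).
have E' x : (\int[ga]_z (`|h (x, r * x + s * z)|)%:E =
    \int[leb]_y (`|h (x, y)| * normal_pdf (r * x) s y)%:E)%E.
  apply: (integral_normal_affine gaE (r * x) s0 (h := fun y => `|h (x, y)|)).
  exact: measurableT_comp.
(* The same change of variables applied to [|h|] turns the integrability of [lh] into integrability
   against Lebesgue measure. *)
have lhK : (mu \x leb)%E.-integrable setT
    (fun p => (h p * normal_pdf (r * p.1) s p.2)%:E).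
  apply: (proj2 (integrable12ltyP _ _ (iffRL (measurable_EFinP _ _) mhK))) => /=.
  have := proj1 (integrable12ltyP _ _ (measurable_int _ lh)) lh => /=.
  congr (_ < _)%E; apply: eq_integral => x _; rewrite E'.
  apply: eq_integral => y _.
  by rewrite normrM (ger0_norm (normal_pdf_ge0 _ _ _)).
transitivity (\int[mu]_x \int[leb]_y (h (x, y) * normal_pdf (r * x) s y)%:E)%E.
  by apply: eq_integral => x _; exact: E.
exact: (Fubini lhK).
Qed.

Lemma measurable_normal_kernel_fst (y : R) :
  measurable_fun [set: measurableTypeR R] (fun x => normal_pdf (r * x) s y).
Proof.
have -> : (fun x => normal_pdf (r * x) s y) =
    (fun x : measurableTypeR R =>
      normal_peak s * expR (- (y - r * x) ^+ 2 / (s ^+ 2 *+ 2))).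
  by apply/funext => x; rewrite normal_pdfE.
by msr.
Qed.

Lemma L1_normal_kernel (y : R) (g : R -> R) : L1 mu g ->
  L1 mu (fun x => g x * normal_pdf (r * x) s y).
Proof.
move=> lg; apply: L1_dom (L1Zl (normal_peak s) (L1_norm lg)).
  apply: measurable_funM; last exact: measurable_normal_kernel_fst.
  exact: L1_measurable lg.
move=> x; rewrite normrM mulrC ler_wpM2r//.
by rewrite ger0_norm ?normal_pdf_ge0// normal_pdf_ub.
Qed.

Let mu_poly (c : R) : L1 mu (fun x => 1 + `|c| + `|r| * (1 + x ^+ 2)).
Proof.
apply: L1D; first exact: L1_cst.
by apply: L1Zl; apply: L1D; [exact: L1_cst|].
Qed.

Let L1_affine (c : R) : L1 mu (fun x => r * x - c).
Proof.
apply: L1_dom (mu_poly c); first by msr.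
move=> x; rewrite (le_trans (ler_normB _ _))// normrM.
have hx : `|x| <= 1 + x ^+ 2.
  by rewrite -(real_normK (num_real x)); have := normr_ge0 x; nra.
have := ler_wpM2l (normr_ge0 r) hx; have := normr_ge0 c; lra.
Qed.

Let L1_sqr_affine (c : R) : L1 mu (fun x => (r * x - c) ^+ 2).
Proof.
have lx : L1 mu (fun x => 2 * r ^+ 2 * x ^+ 2 + 2 * c ^+ 2).
  by apply: L1D; [exact: L1Zl|exact: L1_cst].
apply: L1_dom lx; first by msr.
move=> x; rewrite ger0_norm ?sqr_ge0//.
have := sqr_ge0 (r * x + c); nra.
Qed.

Let kernel_dom (c : R) : L1 mu (fun x => `|1| * (1 + `|r * x - c|) *
  expR (- (r * x - c) ^+ 2 / (4 * s ^+ 2))).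
Proof.
have l1 : L1 mu (fun x => 1 + `|r * x - c|).
  by apply: L1D; [exact: L1_cst|exact: (L1_norm (L1_affine c))].
apply: L1_dom l1; first by msr.
move=> x; rewrite normr1 mul1r normrM ger0_norm ?addr_ge0// ger0_norm ?expR_ge0//.
rewrite ler_piMr ?addr_ge0// -[leRHS]expR0 ler_expR mulNr oppr_le0.
by apply: divr_ge0; [exact: sqr_ge0|apply: mulr_ge0; rewrite ?sqr_ge0].
Qed.

Let mrx : measurable_fun [set: measurableTypeR R] (fun x => r * x).
Proof. by msr. Qed.

Lemma is_derive_flow_density (y : R) : is_derive y 1 q (dq y).
Proof.
have := is_derive_gaussian_convolution s0 (@measurable_cst _ _ _ _ setT (1 : R))
  mrx kernel_dom y.
(* The kernel is symmetric in its mean and its argument, so a derivative in [y] is a derivative in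
   the mean. *)
rewrite [X in is_derive _ _ X _](_ : _ = q); last first.
  apply/funext => c; apply: eq_Rintegral => x _.
  by rewrite mul1r normal_pdf_sym.
rewrite [X in is_derive _ _ _ X](_ : _ = dq y)//.
by apply: eq_Rintegral => x _; rewrite mul1r normal_pdf_sym.
Qed.

Lemma continuous_flow_density_deriv : continuous dq.
Proof.
have := continuous_gaussian_convolution_deriv s0
  (@measurable_cst _ _ _ _ setT (1 : R)) mrx kernel_dom.
rewrite [X in continuous X](_ : _ = dq)//.
apply/funext => c; apply: eq_Rintegral => x _.
by rewrite mul1r normal_pdf_sym.
Qed.

Lemma continuous_flow_density : continuous q.
Proof.
move=> y; apply/differentiable_continuous/derivable1_diffP.
by have [] := is_derive_flow_density y.
Qed.

Let L1_K y : L1 mu (fun x => normal_pdf (r * x) s y).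
Proof.
by have := L1_normal_kernel y (L1_cst mu 1); under eq_fun do rewrite mul1r.
Qed.

Hypothesis r01 : r ^+ 2 <= 1.

Let second_moment c : \int[mu]_x ((r * x - c) ^+ 2) <= 2 * (1 + c ^+ 2).
Proof.
have lx : L1 mu (fun x => 2 * r ^+ 2 * x ^+ 2 + 2 * c ^+ 2).
  by apply: L1D; [exact: L1Zl|exact: L1_cst].
apply: (@le_trans _ _ (\int[mu]_x (2 * r ^+ 2 * x ^+ 2 + 2 * c ^+ 2))).
  apply: le_Rint => // x; have := sqr_ge0 (r * x + c); nra.
rewrite (RintD (L1Zl _ mu2) (L1_cst mu _)) (RintZl _ mu2) Rint_cst.
have : 0 <= \int[mu]_x (x ^+ 2) by apply: ge0_Rint => x; exact: sqr_ge0.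
by move=> I0; have := ler_pM (sqr_ge0 r) I0 r01 mu2_le1; lra.
Qed.

Let Kexp x y : normal_pdf (r * x) s y =
  normal_peak s * expR (- ((r * x - y) ^+ 2 / (2 * s ^+ 2))).
Proof.
by rewrite normal_pdfE//= /normal_fun -(sqrrN (y - _)) opprB mulNr mulr_natl.
Qed.

Let pk0 : 0 < normal_peak s. Proof. exact: normal_peak_gt0. Qed.

(** Jensen's inequality in tangent form: exp(-u) >= exp(-M) (1 + M - u), where u = (r x - y)^2 / (2
    s^2). The mean of the right-hand side is at least exp(-M), because [M] bounds the mean of u. *)
Lemma flow_density_gt0 y : 0 < q y.
Proof.
set M := 2 * (1 + y ^+ 2) / (2 * s ^+ 2).
have s2 : 0 < 2 * s ^+ 2 by rewrite mulr_gt0// exprn_gt0.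
have l1 : L1 mu (fun x => normal_peak s * expR (- M) *
    (1 + M - (2 * s ^+ 2)^-1 * (r * x - y) ^+ 2)).
  by apply: L1Zl; apply: L1B; [exact: L1_cst|exact: L1Zl].
apply: (@lt_le_trans _ _ (normal_peak s * expR (- M))).
  by rewrite mulr_gt0 ?expR_gt0.
apply: (@le_trans _ _ (\int[mu]_x (normal_peak s * expR (- M) *
    (1 + M - (2 * s ^+ 2)^-1 * (r * x - y) ^+ 2)))).
  rewrite (RintZl _ (L1B (L1_cst mu _) (L1Zl _ (L1_sqr_affine y)))).
  rewrite ler_peMr//; first by rewrite mulr_ge0 ?expR_ge0 ?(ltW pk0).
  rewrite (RintB (L1_cst mu _) (L1Zl _ (L1_sqr_affine y))) Rint_cst.
  rewrite (RintZl _ (L1_sqr_affine y)) -addrA lerDl subr_ge0 mulrC ler_pM2r ?invr_gt0//.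
apply: le_Rint => // x; rewrite Kexp -mulrA (ler_wpM2l (ltW pk0))//.
set u := (r * x - y) ^+ 2 / (2 * s ^+ 2).
have -> : expR (- u) = expR (- M) * expR (M - u).
  by rewrite -expRD; congr expR; ring.
rewrite ler_wpM2l ?expR_ge0// (le_trans _ (expR_ge1Dx _))//.
by rewrite /u (mulrC (_ ^+ 2)) addrA.
Qed.

(* Chebyshev's association inequality: the square of the deviation and the
   Gaussian kernel are oppositely ordered. *)
Let sqr_kernel y : \int[mu]_x ((r * x - y) ^+ 2 * normal_pdf (r * x) s y) <=
  2 * (1 + y ^+ 2) * q y.
Proof.
set M := 2 * (1 + y ^+ 2).
have s2 : 0 < 2 * s ^+ 2 by rewrite mulr_gt0// exprn_gt0.
set e := normal_peak s * expR (- (M / (2 * s ^+ 2))).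
have e0 : 0 <= e by rewrite mulr_ge0 ?expR_ge0 ?(ltW pk0).
have l0 : L1 mu (fun x => (r * x - y) ^+ 2 - M).
  by apply: L1B => //; exact: L1_cst.
have l1 : L1 mu (fun x => ((r * x - y) ^+ 2 - M) * normal_pdf (r * x) s y).
  exact: L1_normal_kernel.
have : \int[mu]_x (((r * x - y) ^+ 2 - M) * normal_pdf (r * x) s y) <= 0.
  apply: (@le_trans _ _ (\int[mu]_x (e * ((r * x - y) ^+ 2 - M)))).
    apply: le_Rint => //; first exact: L1Zl.
    move=> x; rewrite Kexp -subr_ge0.
    set u := (r * x - y) ^+ 2.
    have -> : e * (u - M) - (u - M) * (normal_peak s * expR (- (u / (2 * s ^+ 2)))) =
      normal_peak s * ((u - M) * (expR (- (M / (2 * s ^+ 2))) - expR (- (u / (2 * s ^+ 2))))).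
      by rewrite /e; ring.
    apply: mulr_ge0; first exact: ltW.
    have [uM|uM] := leP u M.
      apply: mulr_le0; first by rewrite subr_le0.
      by rewrite subr_le0 ler_expR lerN2 ler_pM2r ?invr_gt0.
    apply: mulr_ge0; first by rewrite subr_ge0 ltW.
    by rewrite subr_ge0 ler_expR lerN2 ler_pM2r ?invr_gt0// ltW.
  rewrite (RintZl _ l0); apply: mulr_ge0_le0 => //.
  by rewrite (RintB (L1_sqr_affine y) (L1_cst mu _)) Rint_cst subr_le0; exact: second_moment.
under eq_Rintegral do rewrite mulrBl.
rewrite (RintB (L1_normal_kernel y (L1_sqr_affine y)) (L1Zl _ (L1_K y))).
by rewrite (RintZl _ (L1_K y)) subr_le0.
Qed.

(** By [sqr_kernel] the kernel-weighted square of v = r x - y is at most [l ^+ 2 * q y], and |v| <=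
    (v^2 + l^2) / (2 l) turns this into a first moment. The resulting linear growth makes the score
    admissible as a test function. *)
Lemma flow_density_deriv_bound y : `|dq y| <= 2 / s ^+ 2 * (1 + `|y|) * q y.
Proof.
set l := 2 * (1 + `|y|).
have l0 : 0 < l by rewrite mulr_gt0// ltr_pwDl.
have lE : 2 * (1 + y ^+ 2) <= l ^+ 2.
  rewrite /l -(real_normK (num_real y)); have := normr_ge0 y; nra.
have s2 : 0 < s ^+ 2 by rewrite exprn_gt0.
have l1 : L1 mu (fun x => (s ^+ 2)^-1 * (2 * l)^-1 *
    ((r * x - y) ^+ 2 * normal_pdf (r * x) s y + l ^+ 2 * normal_pdf (r * x) s y)).
  by apply: L1Zl; apply: L1D; [exact: L1_normal_kernel|exact: L1Zl].
apply: (@le_trans _ _ (\int[mu]_x ((s ^+ 2)^-1 * (2 * l)^-1 *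
    ((r * x - y) ^+ 2 * normal_pdf (r * x) s y + l ^+ 2 * normal_pdf (r * x) s y)))).
  apply: norm_Rint => //.
    by apply: L1_normal_kernel; exact: L1Zr.
  move=> x; rewrite normrM (ger0_norm (normal_pdf_ge0 _ _ _)) -mulrDl mulrA.
  rewrite ler_wpM2r ?normal_pdf_ge0// normrM mulrC.
  rewrite (ger0_norm (_ : 0 <= (s ^+ 2)^-1)) ?invr_ge0 ?(ltW s2)//.
  rewrite -mulrA ler_wpM2l ?invr_ge0 ?(ltW s2)//.
  rewrite ler_pdivlMl ?mulr_gt0// -(real_normK (num_real (r * x - y))).
  by have := sqr_ge0 (`|r * x - y| - l); nra.
have lK := L1_normal_kernel y (L1_sqr_affine y).
rewrite (RintZl _ (L1D lK (L1Zl _ (L1_K y)))) (RintD lK (L1Zl _ (L1_K y))).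
rewrite (RintZl _ (L1_K y)).
have q0 := flow_density_gt0 y.
have h : \int[mu]_x ((r * x - y) ^+ 2 * normal_pdf (r * x) s y) +
    l ^+ 2 * q y <= 2 * l ^+ 2 * q y.
  by have := sqr_kernel y; nra.
have k0 : 0 <= (s ^+ 2)^-1 * (2 * l)^-1.
  by rewrite mulr_ge0// invr_ge0 ltW// mulr_gt0.
apply: le_trans (ler_wpM2l k0 h) _.
rewrite le_eqVlt; apply/orP; left; apply/eqP.
have -> : (s ^+ 2)^-1 * (2 * l)^-1 * (2 * l ^+ 2 * q y) = (s ^+ 2)^-1 * l * q y.
  by field; rewrite !gt_eqF.
by rewrite /l; field.
Qed.

End flow.

(** * The score of the interpolation *)

Definition flow_score {R : realType} (mu : {measure set (measurableTypeR R) -> \bar R})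
  (r s y : R) : R := flow_density_deriv mu r s y / flow_density mu r s y + y.

Definition flow_log {R : realType} (mu : {measure set (measurableTypeR R) -> \bar R})
  (r s y : R) : R := ln (flow_density mu r s y / normal_pdf 0 1 y).

Section flow_identities.
Context (R : realType).
Local Notation leb := (@lebesgue_measure R).
Variables (mu ga : probability (measurableTypeR R) R).
Hypothesis gaE : forall A, measurable A ->
  ga A = (\int[leb]_(x in A) (normal_pdf 0 1 x)%:E)%E.
Hypothesis mu2 : L1 mu (fun x => x ^+ 2).
Hypothesis mu2_le1 : \int[mu]_x (x ^+ 2) <= 1.
Local Notation nu := (mu \x ga)%E.

Lemma measurable_comp_snd (g : R -> R) : measurable_fun [set: measurableTypeR R] g ->
  measurable_fun [set: measurableTypeR R * measurableTypeR R] (fun p => g p.2).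
Proof. by move=> mg; exact: (measurableT_comp mg measurable_snd). Qed.

Lemma normal_pdf01_gt0 (y : R) : 0 < normal_pdf 0 1 y.
Proof.
by rewrite normal_pdfE ?oner_neq0//= mulr_gt0 ?expR_gt0// normal_peak_gt0 ?oner_neq0.
Qed.

Lemma ln_normal_pdf01 (y : R) : ln (normal_pdf 0 1 y) = ln (normal_peak 1) - y ^+ 2 / 2.
Proof.
have pk0 : 0 < normal_peak (1 : R) by rewrite normal_peak_gt0 ?oner_neq0.
rewrite normal_pdfE ?oner_neq0//= lnM ?posrE ?expR_gt0// /normal_fun expRK.
by rewrite subr0 expr1n mulNr.
Qed.

Section fixed_time.
Variables (r s : R).
Hypotheses (s0 : 0 < s) (s1 : s <= 1) (r1 : r ^+ 2 <= 1).
Local Notation q := (flow_density mu r s).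
Local Notation dq := (flow_density_deriv mu r s).
Local Notation u := (flow_log mu r s).
Local Notation sigma := (flow_score mu r s).
Local Notation Y := (fun p : R * R => r * p.1 + s * p.2).

Let q0 y : 0 < q y. Proof. exact: flow_density_gt0. Qed.

Lemma measurable_flow_density : measurable_fun [set: measurableTypeR R] q.
Proof.
apply: continuous_measurable_fun; exact: continuous_flow_density.
Qed.

Lemma measurable_flow_density_deriv : measurable_fun [set: measurableTypeR R] dq.
Proof.
apply: continuous_measurable_fun; exact: continuous_flow_density_deriv.
Qed.

Lemma flow_logE y : u y = ln (q y) + y ^+ 2 / 2 - ln (normal_peak 1).
Proof.
rewrite /flow_log ln_div ?posrE ?normal_pdf01_gt0 ?q0//.
by rewrite ln_normal_pdf01 opprB; ring.
Qed.

Lemma is_derive_flow_log (y : R) : is_derive y 1 u (sigma y).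
Proof.
have -> : u = (fun y => ln (q y) + y ^+ 2 / 2 - ln (normal_peak 1)).
  by apply/funext => z; rewrite flow_logE.
have h1 := is_derive_flow_density mu2 r s0 y.
have h2 := @is_derive1_comp _ (@ln R) q y _ _ (is_derive1_ln (q0 y)) h1.
apply: is_derive_eq; rewrite /GRing.scale/= /flow_score.
by field; rewrite gt_eqF.
Qed.

Lemma continuous_flow_score : continuous sigma.
Proof.
move=> y; apply: cvgD; last exact: cvg_id.
apply: cvgM; first exact: continuous_flow_density_deriv.
by apply: cvgV; [rewrite gt_eqF|exact: continuous_flow_density].
Qed.

Lemma measurable_flow_score : measurable_fun [set: measurableTypeR R] sigma.
Proof. apply: continuous_measurable_fun; exact: continuous_flow_score. Qed.

Lemma measurable_flow_log : measurable_fun [set: measurableTypeR R] u.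
Proof.
apply: continuous_measurable_fun => y.
apply/differentiable_continuous/derivable1_diffP.
by have [] := is_derive_flow_log y.
Qed.

Lemma flow_density_ratio_bound y : `|dq y / q y| <= 2 / s ^+ 2 * (1 + `|y|).
Proof.
rewrite normrM normfV (gtr0_norm (q0 y)) ler_pdivrMr//.
exact: flow_density_deriv_bound.
Qed.

Lemma flow_score_bound y : `|sigma y| <= (2 / s ^+ 2 + 1) * (1 + `|y|).
Proof.
apply: le_trans (ler_normD _ _) _; rewrite mulrDl lerD ?flow_density_ratio_bound//.
by rewrite mul1r lerDr.
Qed.

Let r1' : `|r| <= 1.
Proof.
rewrite leNgt; apply/negP => h; move: r1; rewrite leNgt => /negP; apply.
by rewrite -(real_normK (num_real r)); nra.
Qed.

Lemma flow_growth (p : R * R) : 1 + `|Y p| <= 1 + `|p.1| + `|p.2|.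
Proof.
rewrite -addrA lerD2l; apply: le_trans (ler_normD _ _) _; rewrite !normrM.
have := normr_ge0 p.1; have := normr_ge0 p.2; rewrite (gtr0_norm s0).
by move=> h1 h2; apply: lerD; [exact: ler_piMl|apply: ler_piMl].
Qed.

Lemma measurable_flow (g : R -> R) : measurable_fun [set: measurableTypeR R] g ->
  measurable_fun [set: measurableTypeR R * measurableTypeR R] (fun p => g (Y p)).
Proof.
move=> mg; apply: (measurableT_comp (f := g)) => //.
by apply: (@measurable_funD _ _ _ _ (fun p => r * p.1) (fun p => s * p.2)); msr.
Qed.

Lemma growth_const_ge0 (C : R) (g : R -> R) :
  (forall y, `|g y| <= C * (1 + `|y|)) -> 0 <= C.
Proof. by move=> /(_ 0); rewrite normr0 addr0 mulr1; exact: le_trans. Qed.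

Lemma flow_growth_weight (C : R) (g : R -> R) (p : R * R) :
  (forall y, `|g y| <= C * (1 + `|y|)) ->
  `|g (Y p)| <= C * (1 + `|p.1| + `|p.2|).
Proof.
move=> hg; apply: le_trans (hg _) _; rewrite ler_wpM2l ?flow_growth//.
exact: growth_const_ge0 hg.
Qed.

Lemma L1_flow2 (C1 C2 : R) (g1 g2 : R -> R) :
  measurable_fun [set: measurableTypeR R] g1 ->
  measurable_fun [set: measurableTypeR R] g2 ->
  (forall y, `|g1 y| <= C1 * (1 + `|y|)) ->
  (forall y, `|g2 y| <= C2 * (1 + `|y|)) ->
  L1 nu (fun p => g1 (Y p) * g2 (Y p)).
Proof.
move=> m1 m2 h1 h2; apply: L1_dom (L1Zl (C1 * C2) (L1_flow_weight gaE mu2)).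
  by apply: measurable_funM; exact: measurable_flow.
move=> p; rewrite normrM /flow_weight.
have e1 := flow_growth_weight p h1; have e2 := flow_growth_weight p h2.
have := ler_pM (normr_ge0 _) (normr_ge0 _) e1 e2.
by move=> h; apply: le_trans h _; rewrite le_eqVlt; apply/orP; left; apply/eqP; ring.
Qed.

Lemma L1_flow1 (C : R) (h g : R -> R) :
  measurable_fun [set: measurableTypeR R] g ->
  (forall y, `|g y| <= C * (1 + `|y|)) ->
  L1 nu (fun p => p.1 * g (Y p)) /\ L1 nu (fun p => p.2 * g (Y p)).
Proof.
move=> mg hg; have C0 := growth_const_ge0 hg.
split; (apply: L1_dom (L1Zl C (L1_flow_weight gaE mu2));
  first by (apply: measurable_funM; [msr|exact: measurable_flow])).
  move=> p; rewrite normrM /flow_weight.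
  have e1 := flow_growth_weight p hg.
  apply: le_trans (ler_wpM2l (normr_ge0 p.1) e1) _.
  rewrite mulrCA ler_wpM2l// expr2 ler_wpM2r//.
  by have := normr_ge0 p.2; lra.
move=> p; rewrite normrM /flow_weight.
have e1 := flow_growth_weight p hg.
apply: le_trans (ler_wpM2l (normr_ge0 p.2) e1) _.
rewrite mulrCA ler_wpM2l// expr2 ler_wpM2r//.
by have := normr_ge0 p.1; lra.
Qed.

Lemma L1_flow_norm (C : R) (g : R -> R) :
  measurable_fun [set: measurableTypeR R] g ->
  (forall y, `|g y| <= C * (1 + `|y|)) -> L1 nu (fun p => `|g (Y p)|).
Proof.
move=> mg hg.
have h1 (y : R) : `|1 : R| <= 1 * (1 + `|y|) by rewrite normr1 mul1r lerDl.
have m1 : measurable_fun [set: measurableTypeR R] (fun=> 1 : R) by msr.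
have := L1_norm (L1_flow2 mg m1 hg h1).
by under eq_fun do rewrite mulr1.
Qed.

(** Integration by parts without a derivative of [g]: the ratio [dq / q] is the conditional
    expectation of (r x - y) / s^2 = - z / s given Y = y. After disintegration both inner integrals
    equal [g y * dq y]. *)
Lemma Rint_score (C : R) (g : R -> R) :
  measurable_fun [set: measurableTypeR R] g ->
  (forall y, `|g y| <= C * (1 + `|y|)) ->
  \int[nu]_p (dq (Y p) / q (Y p) * g (Y p)) = - (s^-1 * \int[nu]_p (p.2 * g (Y p))).
Proof.
move=> mg hg.
have mq := measurable_flow_density; have mdq := measurable_flow_density_deriv.
have mr : measurable_fun [set: measurableTypeR R] (fun y => dq y / q y).
  apply: continuous_measurable_fun => y.
  apply: cvgM; first exact: continuous_flow_density_deriv.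
  by apply: cvgV; [rewrite gt_eqF|exact: continuous_flow_density].
have lL := L1_flow2 mr mg flow_density_ratio_bound hg.
have [_ lR] := L1_flow1 id mg hg.
have lR' := L1Zl (- s^-1) lR.
rewrite -mulNr -(RintZl _ lR).
have h1 := @flow_disintegration _ mu ga gaE r s s0
  (fun p => dq p.2 / q p.2 * g p.2) _ lL.
have h2 := @flow_disintegration _ mu ga gaE r s s0
  (fun p => (r * p.1 - p.2) / s ^+ 2 * g p.2).
have E2 p : (r * p.1 - Y p) / s ^+ 2 * g (Y p) = - s^-1 * (p.2 * g (Y p)).
  by field; rewrite gt_eqF.
apply: EFin_inj; rewrite h1; last first.
  by apply: measurable_funM; [exact: (measurable_comp_snd mr)|exact: measurable_comp_snd].
transitivity ((\int[nu]_p ((r * p.1 - Y p) / s ^+ 2 * g (Y p)))%:E); last first.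
  by congr EFin; apply: eq_Rintegral => p _; exact: E2.
rewrite h2; last 2 first.
- by apply: measurable_funM; [msr|exact: measurable_comp_snd].
- by apply: eq_integrable lR' => // p _ /=; rewrite E2.
apply: eq_integral => y _ /=.
have lK : L1 mu (fun x => normal_pdf (r * x) s y).
  have := L1_normal_kernel r s0 y (L1_cst mu 1).
  by under eq_fun do rewrite mul1r.
have lx : L1 mu (fun x => (r * x - y) / s ^+ 2).
  have l0 : L1 mu (fun x => x ^+ 2 + 1) by apply: L1D => //; exact: L1_cst.
  have l1 : L1 mu (fun x => x).
    apply: L1_dom l0; first by msr.
    move=> x; rewrite -(real_normK (num_real x)); have := normr_ge0 x; nra.
  by apply: L1Zr; apply: L1B; [exact: L1Zl|exact: L1_cst].
have ldK := L1_normal_kernel r s0 y lx.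
transitivity ((g y * dq y)%:E).
  rewrite (fin_Rintegral (L1Zl (dq y / q y * g y) lK)) (RintZl _ lK); congr EFin.
  by rewrite -/(q y); field; rewrite gt_eqF.
have lgdK := L1Zl (g y) ldK.
rewrite /flow_density_deriv -(RintZl _ ldK) -(fin_Rintegral lgdK).
by apply: eq_integral => x _; congr EFin; ring.
Qed.

Lemma ge0_integral_flow (w : R -> R) : measurable_fun [set: measurableTypeR R] w ->
  (forall y, 0 <= w y) ->
  (\int[nu]_p (w (Y p))%:E = \int[leb]_y (w y * q y)%:E)%E.
Proof.
move=> mw w0.
have mwY := measurable_flow mw.
have mwK : measurable_fun [set: measurableTypeR R * measurableTypeR R]
    (fun p => w p.2 * normal_pdf (r * p.1) s p.2).
  apply: measurable_funM; last exact: measurable_normal_kernel.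
  exact: measurable_comp_snd.
rewrite (fubini_tonelli1 (m1 := mu) (m2 := ga) (fun p => (w (Y p))%:E)); last 2 first.
- exact/measurable_EFinP.
- by move=> p; rewrite lee_fin.
transitivity (\int[mu]_x \int[leb]_y (w y * normal_pdf (r * x) s y)%:E)%E.
  apply: eq_integral => x _; rewrite /fubini_F/=.
  exact: (integral_normal_affine gaE (r * x) s0 mw).
transitivity (\int[leb]_y \int[mu]_x (w y * normal_pdf (r * x) s y)%:E)%E.
  apply: (fubini_tonelli (m1 := mu) (m2 := leb)
    (fun p => (w p.2 * normal_pdf (r * p.1) s p.2)%:E)).
  - exact/measurable_EFinP.
  - by move=> p; rewrite lee_fin mulr_ge0 ?normal_pdf_ge0.
apply: eq_integral => y _ /=.
have lK : L1 mu (fun x => normal_pdf (r * x) s y).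
  have := L1_normal_kernel r s0 y (L1_cst mu 1).
  by under eq_fun do rewrite mul1r.
by rewrite (fin_Rintegral (L1Zl (w y) lK)) (RintZl _ lK).
Qed.

(* Gibbs' inequality, from [ln x <= x - 1]. *)
Lemma Rint_ln_ratio_le (w : R -> R) (c : R) : measurable_fun [set: measurableTypeR R] w ->
  (forall y, 0 < w y) -> (\int[leb]_y (w y)%:E = c%:E)%E ->
  L1 nu (fun p => ln (w (Y p) / q (Y p))) ->
  \int[nu]_p ln (w (Y p) / q (Y p)) <= c - 1.
Proof.
move=> mw w0 wc lL.
have mq := measurable_flow_density.
have mwq : measurable_fun [set: measurableTypeR R] (fun y => w y / q y).
  apply: measurable_funM => //.
  apply: continuous_measurable_fun => y.
  by apply: cvgV; [rewrite gt_eqF|exact: continuous_flow_density].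
have wq0 y : 0 < w y / q y by rewrite divr_gt0.
have E : (\int[nu]_p (w (Y p) / q (Y p))%:E = c%:E)%E.
  rewrite (ge0_integral_flow mwq (fun y => ltW (wq0 y))) -wc.
  by apply: eq_integral => y _; rewrite divfK// gt_eqF.
have lwq : L1 nu (fun p => w (Y p) / q (Y p)).
  apply: L1_lt_pinfty => [p||]; first exact: ltW.
    exact: (measurable_flow mwq).
  by rewrite E ltry.
apply: (@le_trans _ _ (\int[nu]_p (w (Y p) / q (Y p) - 1))).
  apply: le_Rint => //; first by apply: L1B => //; exact: L1_cst.
  move=> p; have := wq0 (Y p); set x := _ / _ => x0.
  have -> : ln x = ln (1 + (x - 1)) by congr ln; ring.
  by apply: le_ln1Dx; lra.
rewrite (RintB lwq (L1_cst nu 1)) Rint_cst.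
by rewrite {1}/Rintegral E.
Qed.

End fixed_time.
End flow_identities.

(** * Stein's identity for the interpolation *)

Section stein_flow.
Context (R : realType).
Local Notation leb := (@lebesgue_measure R).
Variables (mu ga : probability (measurableTypeR R) R).
Hypothesis gaE : forall A, measurable A ->
  ga A = (\int[leb]_(x in A) (normal_pdf 0 1 x)%:E)%E.
Hypothesis mu2 : L1 mu (fun x => x ^+ 2).
Hypothesis mu2_le1 : \int[mu]_x (x ^+ 2) <= 1.
Local Notation nu := (mu \x ga)%E.

Lemma Rint_normal_affine (m s : R) (h : R -> R) : 0 < s ->
  measurable_fun [set: measurableTypeR R] h ->
  \int[ga]_z h (m + s * z) = \int[leb]_y (h y * normal_pdf m s y).
Proof. by move=> s0 mh; congr fine; exact: integral_normal_affine. Qed.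

Lemma L1_normal_growth2 (C m s : R) (g : R -> R) :
  measurable_fun [set: measurableTypeR R] g ->
  (forall y, `|g y| <= C * (1 + `|y|)) ->
  L1 ga (fun z => `|g (m + s * z)| * (1 + `|z|)).
Proof.
move=> mg hg; have C0 := growth_const_ge0 hg.
have k0 : 0 <= C * (1 + `|m| + `|s|) by rewrite mulr_ge0// !addr_ge0.
apply: L1_dom (L1Zl (C * (1 + `|m| + `|s|) * 2) (L1_gaussian_poly4 gaE)).
  apply: measurable_funM; last by msr.
  apply: measurableT_comp => //; apply: measurableT_comp => //.
  exact: measurable_affine.
move=> z; rewrite ger0_norm; last by rewrite mulr_ge0// addr_ge0.
have h1 : `|g (m + s * z)| <= C * (1 + `|m| + `|s|) * (1 + `|z|).
  apply: le_trans (hg _) _; rewrite -mulrA ler_wpM2l//.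
  apply: (@le_trans _ _ (1 + (`|m| + `|s| * `|z|))).
    by rewrite lerD2l (le_trans (ler_normD _ _))// normrM.
  have := normr_ge0 m; have := normr_ge0 s; have := normr_ge0 z; nra.
apply: (@le_trans _ _ (C * (1 + `|m| + `|s|) * (1 + `|z|) * (1 + `|z|))).
  by rewrite ler_wpM2r// addr_ge0.
rewrite -2!(mulrA (C * _)); apply: ler_wpM2l => //.
have := normr_ge0 z; rewrite -(real_normK (num_real z)).
move: `|z| => b b0; have := sqr_ge0 (b - 1); have := sqr_ge0 (b ^+ 2); nra.
Qed.

(** Up to a constant the exponential is the normal density of standard deviation [Num.sqrt 2 * s],
    so the claim reduces to a Gaussian moment of a function of quadratic growth. *)
Lemma smoothing_dom (s C : R) (g : R -> R) : 0 < s ->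
  measurable_fun [set: measurableTypeR R] g ->
  (forall y, `|g y| <= C * (1 + `|y|)) ->
  forall c, L1 leb (fun y => `|g y| * (1 + `|y - c|) *
    expR (- (y - c) ^+ 2 / (4 * s ^+ 2))).
Proof.
move=> s0 mg hg c.
set k := Num.sqrt 2 : R.
have k0 : 0 < k by rewrite sqrtr_gt0.
have k2 : k ^+ 2 = 2 by rewrite sqr_sqrtr.
have ks0 : 0 < k * s by rewrite mulr_gt0.
have pk0 : 0 < normal_peak (k * s) by rewrite normal_peak_gt0// gt_eqF.
have mh : measurable_fun [set: measurableTypeR R] (fun y => `|g y| * (1 + `|y - c|)).
  by apply: measurable_funM; [exact: measurableT_comp|msr].
have h0 y : 0 <= `|g y| * (1 + `|y - c|) by rewrite mulr_ge0// addr_ge0.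
have E : (fun y => `|g y| * (1 + `|y - c|) * expR (- (y - c) ^+ 2 / (4 * s ^+ 2))) =
   (fun y => (normal_peak (k * s))^-1 * (`|g y| * (1 + `|y - c|) * normal_pdf c (k * s) y)).
  apply/funext => y; rewrite normal_pdfE ?gt_eqF//= /normal_fun exprMn k2.
  rewrite [in RHS]mulrCA [X in _ = _ * X]mulrA mulVf ?gt_eqF// mul1r.
  by congr (_ * expR (_ / _)); ring.
rewrite E; apply: L1Zl; apply: L1_lt_pinfty => [y||].
- by rewrite mulr_ge0 ?normal_pdf_ge0.
- by apply: measurable_funM => //; exact: measurable_normal_pdf.
rewrite -(integral_normal_affine gaE c ks0 mh).
have lg : L1 ga (fun z => (1 + k * s) * (`|g (c + k * s * z)| * (1 + `|z|))).
  by apply: L1Zl; exact: L1_normal_growth2 hg.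
apply: le_lt_trans (integrable_lty _ lg) => //.
apply: ge0_le_integral => //.
- apply/measurable_EFinP; apply: (measurableT_comp mh); exact: measurable_affine.
- exact: measurable_int lg.
move=> z _; rewrite lee_fin /= mulrCA ler_wpM2l//.
have -> : c + k * s * z - c = k * s * z by ring.
by rewrite normrM (gtr0_norm ks0); have := normr_ge0 z; nra.
Qed.

Lemma L1_normal_growth (C m s : R) (g : R -> R) :
  measurable_fun [set: measurableTypeR R] g ->
  (forall y, `|g y| <= C * (1 + `|y|)) ->
  L1 ga (fun z => g (m + s * z)) /\ L1 ga (fun z => z * g (m + s * z)).
Proof.
move=> mg hg; have lg := L1_normal_growth2 m s mg hg.
have mgz : measurable_fun [set: measurableTypeR R] (fun z => g (m + s * z)).
  by apply: measurableT_comp => //; exact: measurable_affine.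
split; apply: L1_dom lg => //.
- by move=> z; rewrite ler_peMr// lerDl.
- by apply: measurable_funM => //; msr.
- by move=> z; rewrite normrM mulrC ler_wpM2l// lerDr.
Qed.

(** The integrals of [normal_pdf c 1 y] and of [y * normal_pdf c 1 y] are 1 and c + E[Z].
    Differentiated in the mean at c = 0, under the integral, they give E[Z] = 0 and E[Z^2] = 1. *)
Lemma gaussian_moments : \int[ga]_z z = 0 /\ \int[ga]_z z ^+ 2 = 1.
Proof.
have o0 : (0 : R) < 1 by [].
have m1 : measurable_fun [set: measurableTypeR R] (fun=> 1 : R) by msr.
have mid : measurable_fun [set: measurableTypeR R] (fun x : measurableTypeR R => x) by msr.
have g1 (y : R) : `|1 : R| <= 1 * (1 + `|y|) by rewrite normr1 mul1r lerDl.
have gid (y : R) : `|y| <= 1 * (1 + `|y|) by rewrite mul1r lerDr.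
have d1 c := is_derive_gaussian_convolution o0 m1 mid (smoothing_dom o0 m1 g1) c.
have d2 c := is_derive_gaussian_convolution o0 mid mid (smoothing_dom o0 mid gid) c.
have E1 : (fun c => \int[leb]_w (1 * normal_pdf c 1 w)) = cst 1.
  apply/funext => c; rewrite -(Rint_normal_affine c o0 m1).
  exact: Rint_cst.
have E2 : (fun c => \int[leb]_w (w * normal_pdf c 1 w)) = (fun c => c + \int[ga]_z z).
  apply/funext => c; rewrite -(Rint_normal_affine c o0 mid).
  under eq_Rintegral do rewrite mul1r.
  by rewrite (RintD (L1_cst ga c) (L1_gaussian_id gaE)) Rint_cst.
have e1 : \int[ga]_z z = 0.
  have := d1 0; rewrite E1 => -[_]; rewrite derive_cst => ->.
  transitivity (\int[ga]_z (0 + 1 * z)).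
    by apply: eq_Rintegral => z _; rewrite add0r mul1r.
  rewrite (Rint_normal_affine 0 o0 mid); apply: eq_Rintegral => z _.
  by rewrite expr1n divr1 subr0 mul1r.
split => //.
have := d2 0; rewrite E2 e1 => d.
have := @derive_val _ _ _ _ _ _ _ d.
rewrite (_ : (fun c : R => c + 0) = id); last by apply/funext => c; rewrite addr0.
rewrite derive_id => h.
have msq : measurable_fun [set: measurableTypeR R] (fun x : measurableTypeR R => x ^+ 2) by msr.
transitivity (\int[ga]_z ((0 + 1 * z) ^+ 2)).
  by apply: eq_Rintegral => z _; rewrite add0r mul1r.
rewrite (Rint_normal_affine 0 o0 msq) [RHS]h; apply: eq_Rintegral => z _.
by rewrite expr1n divr1 subr0 expr2 mulrA.
Qed.

Variable tau : R -> R.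
Hypothesis mtau : measurable_fun [set: measurableTypeR R] tau.
Hypothesis tau2 : L1 mu (fun x => tau x ^+ 2).
Hypothesis stein : forall g : R -> R,
  (forall x, derivable g x 1) -> continuous (derive1 g) ->
  L1 mu (fun x => x * g x) -> L1 mu (fun x => tau x * derive1 g x) ->
  \int[mu]_x (x * g x) = \int[mu]_x (tau x * derive1 g x).

Section fixed_time.
Variables (r s : R).
Hypotheses (s0 : 0 < s) (s1 : s <= 1) (r1 : r ^+ 2 <= 1).
Local Notation Y := (fun p : R * R => r * p.1 + s * p.2).

Lemma L1_tau_flow (C : R) (g : R -> R) :
  measurable_fun [set: measurableTypeR R] g ->
  (forall y, `|g y| <= C * (1 + `|y|)) ->
  L1 nu (fun p => tau p.1 * (p.2 * g (Y p))).
Proof.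
move=> mg hg; have C0 := growth_const_ge0 hg.
have l1 := L1_fst ga tau2.
have l2 := L1_sqr_flow_weight gaE mu2.
apply: L1_dom (L1D l1 (L1Zl (C ^+ 2) l2)).
  apply: measurable_funM; first by msr.
  by apply: measurable_funM; [msr|exact: measurable_flow].
move=> p; rewrite !normrM.
have e1 := flow_growth_weight s0 s1 r1 p hg.
have e2 : `|g (Y p)| ^+ 2 <= C ^+ 2 * flow_weight p.
  rewrite /flow_weight -exprMn; have := normr_ge0 (g (Y p)); nra.
have : (p.2 ^+ 2) * `|g (Y p)| ^+ 2 <= p.2 ^+ 2 * (C ^+ 2 * flow_weight p).
  by rewrite ler_wpM2l ?sqr_ge0.
have : 0 <= C ^+ 2 * flow_weight p by apply: le_trans e2; exact: sqr_ge0.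
rewrite -[in X in _ -> _ -> _ <= X](real_normK (num_real (tau p.1))).
rewrite -(real_normK (num_real p.2)).
have := sqr_ge0 (`|tau p.1| - `|p.2| * `|g (Y p)|).
have := mulr_ge0 (normr_ge0 (tau p.1)) (mulr_ge0 (normr_ge0 p.2) (normr_ge0 (g (Y p)))).
move: `|tau p.1| `|p.2| `|g (Y p)| (flow_weight p) => a b c w.
by move=> h1 h2 h3 h4; nra.
Qed.

(* [k] below is the smoothing of [g] by the Gaussian kernel; the derivative
   falls on the kernel, so no regularity of [g] is needed. *)
Lemma stein_flow (C : R) (g : R -> R) :
  measurable_fun [set: measurableTypeR R] g ->
  (forall y, `|g y| <= C * (1 + `|y|)) ->
  \int[nu]_p (p.1 * g (Y p)) = r / s * \int[nu]_p (tau p.1 * (p.2 * g (Y p))).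
Proof.
move=> mg hg.
have mid : measurable_fun [set: measurableTypeR R] (fun x : measurableTypeR R => x) by msr.
have dom := smoothing_dom s0 mg hg.
pose k c := \int[leb]_y (g y * normal_pdf c s y).
pose k' c := \int[leb]_y (g y * ((y - c) / s ^+ 2 * normal_pdf c s y)).
have dk (c : R) : is_derive c 1 k (k' c).
  exact: (is_derive_gaussian_convolution s0 mg mid dom).
have ck' : continuous k'.
  exact: (continuous_gaussian_convolution_deriv s0 mg mid dom).
have kE c : k c = \int[ga]_z g (c + s * z) by rewrite (Rint_normal_affine c s0 mg).
have k'E c : k' c = s^-1 * \int[ga]_z (z * g (c + s * z)).
  have mh : measurable_fun [set: measurableTypeR R] (fun y => g y * ((y - c) / s ^+ 2)).
    by apply: measurable_funM => //; msr.
  have [_ l] := L1_normal_growth c s mg hg.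
  rewrite -(RintZl _ l).
  transitivity (\int[leb]_y (g y * ((y - c) / s ^+ 2) * normal_pdf c s y)).
    by apply: eq_Rintegral => y _; rewrite mulrA.
  rewrite -(Rint_normal_affine c s0 mh); apply: eq_Rintegral => z _.
  by field; rewrite gt_eqF.
pose G x := k (r * x).
have dG (x : R) : is_derive x 1 G (r * k' (r * x)).
  have h := @is_derive1_comp _ k (fun x => r * x) x _ _ (dk (r * x)) _.
  have h2 : is_derive x 1 (fun x => r * x) r.
    by apply: is_derive_eq; rewrite /GRing.scale/= mulr1.
  by have := h _ h2; rewrite mulrC.
have G'E : derive1 G = (fun x => r * k' (r * x)).
  apply/funext => x; rewrite derive1E.
  exact: (@derive_val _ _ _ _ _ _ _ (dG x)).
have [l1 _] := L1_flow1 gaE mu2 s0 s1 r1 id mg hg.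
have lt := L1_tau_flow mg hg.
have lx1 x : L1 ga (fun z => x * g (r * x + s * z)).
  by apply: L1Zl; have [] := L1_normal_growth (r * x) s mg hg.
have lx2 x : L1 ga (fun z => tau x * (z * g (r * x + s * z))).
  by apply: L1Zl; have [] := L1_normal_growth (r * x) s mg hg.
have e1 x : \int[ga]_z (x * g (r * x + s * z)) = x * G x.
  rewrite RintZl; last by have [] := L1_normal_growth (r * x) s mg hg.
  by rewrite /G kE.
have e2 x : \int[ga]_z (tau x * (z * g (r * x + s * z))) * (r / s) = tau x * derive1 G x.
  rewrite RintZl; last by have [] := L1_normal_growth (r * x) s mg hg.
  by rewrite G'E k'E; ring.
have i1 := L1_iter l1 lx1; have i2 := L1_iter lt lx2.
rewrite (Rint_iter l1 lx1) (Rint_iter lt lx2) /=.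
have -> : \int[mu]_x \int[ga]_y (x * g (r * x + s * y)) = \int[mu]_x (x * G x).
  by apply: eq_Rintegral => x _; exact: e1.
rewrite mulrC -RintegralZr//.
have -> : \int[mu]_x (\int[ga]_y (tau x * (y * g (r * x + s * y))) * (r / s)) =
    \int[mu]_x (tau x * derive1 G x).
  by apply: eq_Rintegral => x _; exact: e2.
apply: stein.
- by move=> x; have [] := dG x.
- rewrite G'E => x; apply: cvgM; first exact: cvg_cst.
  apply: (@continuous_comp _ _ _ (fun x => r * x) k'); last exact: ck'.
  by apply: cvgM; [exact: cvg_cst|exact: cvg_id].
- by move: i1 => /=; under eq_fun do rewrite e1.
- move: (L1Zr (r / s) i2) => /=.
  by under eq_fun do rewrite e2.
Qed.

End fixed_time.
End stein_flow.

(** * Bounds on the energy of the score *)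

Section product_L1_swap.
Context d1 d2 (T1 : measurableType d1) (T2 : measurableType d2) (R : realType).
Variables (m1 : probability T1 R) (m2 : probability T2 R).
Local Notation nu := (m1 \x m2)%E.

(** This order of integration suits the total variation hypothesis, which concerns F at a fixed
    value of the noise. *)
Lemma Rint_iter_swap (h : T1 * T2 -> R) : L1 nu h ->
  (forall y, L1 m1 (fun x => h (x, y))) ->
  \int[nu]_p h p = \int[m2]_y \int[m1]_x h (x, y).
Proof.
move=> lh lh2; rewrite {1}/Rintegral -(integral21_prod_meas1 lh) /fubini_G/=.
by congr fine; apply: eq_integral => y _; rewrite -(fin_Rintegral (lh2 y)).
Qed.

Lemma measurable_iter_swap (h : T1 * T2 -> R) : L1 nu h ->
  (forall y, L1 m1 (fun x => h (x, y))) ->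
  measurable_fun [set: T2] (fun y => \int[m1]_x h (x, y)).
Proof.
move=> lh lh2; apply/measurable_EFinP.
apply: eq_measurable_fun (measurable_fubini_G lh) => y _.
by rewrite /fubini_G /= -(fin_Rintegral (lh2 y)).
Qed.

End product_L1_swap.

Section weighted_AMGM.
Context (R : realType).
Implicit Types (x y z : R).

(** The tangent to the exponential at the barycentre [e] lies below it, and the linear terms cancel
    in the weighted sum. *)
Lemma expR_convex3 (a b c x y z : R) : 0 <= a -> 0 <= b -> 0 <= c -> a + b + c = 1 ->
  expR (a * x + b * y + c * z) <= a * expR x + b * expR y + c * expR z.
Proof.
move=> a0 b0 c0 abc; set e := a * x + b * y + c * z.
have h t : expR e * (1 + (t - e)) <= expR t.
  have -> : expR t = expR e * expR (t - e) by rewrite -expRD; congr expR; ring.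
  by rewrite ler_wpM2l ?expR_ge0// expR_ge1Dx.
apply: (@le_trans _ _ (a * (expR e * (1 + (x - e))) +
    b * (expR e * (1 + (y - e))) + c * (expR e * (1 + (z - e))))).
  have -> : a * (expR e * (1 + (x - e))) + b * (expR e * (1 + (y - e))) +
      c * (expR e * (1 + (z - e))) =
      expR e * ((a + b + c) * (1 - e) + (a * x + b * y + c * z)) by ring.
  by rewrite abc -/e mul1r subrK mulr1.
by rewrite !lerD// ler_wpM2l.
Qed.

(** Weighted inequality of the means for W * t = W t^(eta/(2+eta)) (t^2)^(1/(2+eta)), whose Hoelder
    weights 1/(2+eta), eta/(2+eta), 1/(2+eta) add up to 1. With [lw], [lm], [lS] the logarithms of
    bounds on the three integrals, integration gives Hoelder's inequality for three functions. *)
Lemma hoelder3_pointwise (eta lw lm lS W t : R) : 0 < eta -> 0 <= W -> 0 <= t ->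
  W * t <= expR ((lw + eta * lm + lS) / (2 + eta)) *
   ((2 + eta)^-1 * (expR (- lw) * W `^ (2 + eta)) +
    eta / (2 + eta) * (expR (- lm) * t) +
    (2 + eta)^-1 * (expR (- lS) * t ^+ 2)).
Proof.
move=> eta0 W0 t0.
have p0 : 0 < 2 + eta by rewrite addr_gt0.
have pn0 : 2 + eta != 0 by rewrite gt_eqF.
have rhs0 : 0 <= expR ((lw + eta * lm + lS) / (2 + eta)) *
   ((2 + eta)^-1 * (expR (- lw) * W `^ (2 + eta)) +
    eta / (2 + eta) * (expR (- lm) * t) +
    (2 + eta)^-1 * (expR (- lS) * t ^+ 2)).
  have i0 : 0 <= (2 + eta)^-1 by rewrite invr_ge0 ltW.
  apply: mulr_ge0; first exact: expR_ge0.
  apply: addr_ge0; [apply: addr_ge0|]; apply: mulr_ge0 => //.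
  - by rewrite mulr_ge0 ?expR_ge0 ?powR_ge0.
  - by rewrite mulr_ge0// ltW.
  - by rewrite mulr_ge0 ?expR_ge0.
  - by rewrite mulr_ge0 ?expR_ge0 ?sqr_ge0.
have [WE|Wn0] := eqVneq W 0; first by rewrite [in leLHS]WE mul0r.
have [tE|tn0] := eqVneq t 0; first by rewrite [in leLHS]tE mulr0.
have W1 : 0 < W by rewrite lt_neqAle eq_sym Wn0.
have t1 : 0 < t by rewrite lt_neqAle eq_sym tn0.
have := @expR_convex3 (2 + eta)^-1 (eta / (2 + eta)) (2 + eta)^-1
  ((2 + eta) * ln W - lw) (ln t - lm) (2 * ln t - lS).
rewrite !invr_ge0 divr_ge0 ?(ltW p0) ?(ltW eta0)// => /(_ isT isT isT).
have h1 : (2 + eta)^-1 + eta / (2 + eta) + (2 + eta)^-1 = 1 by field.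
move=> /(_ h1) h.
have -> : W * t = expR ((lw + eta * lm + lS) / (2 + eta)) *
   expR ((2 + eta)^-1 * ((2 + eta) * ln W - lw) +
    eta / (2 + eta) * (ln t - lm) + (2 + eta)^-1 * (2 * ln t - lS)).
  rewrite -expRD -{1}(lnK (_ : W \is Num.pos)) ?posrE// -{1}(lnK (_ : t \is Num.pos)) ?posrE//.
  by rewrite -expRD; congr expR; field.
rewrite ler_wpM2l ?expR_ge0//.
have -> : expR (- lw) * W `^ (2 + eta) = expR ((2 + eta) * ln W - lw).
  by rewrite /powR (negbTE Wn0) -expRD addrC.
have -> : expR (- lm) * t = expR (ln t - lm).
  by rewrite expRD lnK ?posrE// mulrC.
have -> : expR (- lS) * t ^+ 2 = expR (2 * ln t - lS).
  by rewrite expRD mulrC expRM_natl lnK ?posrE.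
exact: h.
Qed.

End weighted_AMGM.

Section energy.
Context (R : realType).
Local Notation leb := (@lebesgue_measure R).
Variables (mu ga : probability (measurableTypeR R) R).
Hypothesis gaE : forall A, measurable A ->
  ga A = (\int[leb]_(x in A) (normal_pdf 0 1 x)%:E)%E.
Hypothesis mu2 : L1 mu (fun x => x ^+ 2).
Hypothesis mu2_le1 : \int[mu]_x (x ^+ 2) <= 1.
Local Notation nu := (mu \x ga)%E.
Variable tau : R -> R.
Hypothesis mtau : measurable_fun [set: measurableTypeR R] tau.
Hypothesis tau2 : L1 mu (fun x => tau x ^+ 2).
Hypothesis stein : forall g : R -> R,
  (forall x, derivable g x 1) -> continuous (derive1 g) ->
  L1 mu (fun x => x * g x) -> L1 mu (fun x => tau x * derive1 g x) ->
  \int[mu]_x (x * g x) = \int[mu]_x (tau x * derive1 g x).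
Variables (r s : R).
Hypotheses (r0 : 0 < r) (s0 : 0 < s) (rs : r ^+ 2 + s ^+ 2 = 1).
Local Notation Y := (fun p : R * R => r * p.1 + s * p.2).
Local Notation sigma := (flow_score mu r s).
Local Notation S := (\int[nu]_p (sigma (Y p) * sigma (Y p))).

Let s1 : s <= 1.
Proof.
have h : s ^+ 2 <= 1 by rewrite -rs lerDr sqr_ge0.
by rewrite leNgt; apply/negP => h1; move: h; rewrite leNgt => /negP; apply; nra.
Qed.
Let r1 : r ^+ 2 <= 1. Proof. by rewrite -rs lerDl sqr_ge0. Qed.
Let msigma : measurable_fun [set: measurableTypeR R] sigma.
Proof. exact: measurable_flow_score. Qed.
Let hsigma := flow_score_bound mu2 mu2_le1 s0 r1.
Let lA : L1 nu (fun p => p.1 * sigma (Y p)).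
Proof. by have [] := L1_flow1 gaE mu2 s0 s1 r1 id msigma hsigma. Qed.
Let lB : L1 nu (fun p => p.2 * sigma (Y p)).
Proof. by have [] := L1_flow1 gaE mu2 s0 s1 r1 id msigma hsigma. Qed.
Let lT : L1 nu (fun p => tau p.1 * (p.2 * sigma (Y p))).
Proof. exact: (L1_tau_flow gaE mu2 mtau tau2 s0 s1 r1 msigma hsigma). Qed.
Let lS : L1 nu (fun p => sigma (Y p) * sigma (Y p)).
Proof. exact: (L1_flow2 gaE mu2 s0 s1 r1 msigma msigma hsigma hsigma). Qed.
Let lW : L1 nu (fun p => (1 - tau p.1) * (p.2 * sigma (Y p))).
Proof.
apply: eq_integrable (L1B lB lT) => // p _ /=; congr EFin; ring.
Qed.

Lemma Rint_flow_score (C : R) (g : R -> R) :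
  measurable_fun [set: measurableTypeR R] g ->
  (forall y, `|g y| <= C * (1 + `|y|)) ->
  \int[nu]_p (sigma (Y p) * g (Y p)) =
  - (s^-1 * \int[nu]_p (p.2 * g (Y p))) + \int[nu]_p (Y p * g (Y p)).
Proof.
move=> mg hg.
rewrite -(Rint_score gaE mu2 mu2_le1 s0 s1 r1 mg hg).
have hid (y : R) : `|y| <= 1 * (1 + `|y|) by rewrite mul1r lerDr.
have mid : measurable_fun [set: measurableTypeR R] (fun x : measurableTypeR R => x) by msr.
have mr : measurable_fun [set: measurableTypeR R]
    (fun y => flow_density_deriv mu r s y / flow_density mu r s y).
  have -> : (fun y => flow_density_deriv mu r s y / flow_density mu r s y) =
      (fun y : measurableTypeR R => sigma y - y).
    by apply/funext => y; rewrite /flow_score addrK.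
  exact: measurable_funB.
rewrite -RintD.
- by apply: eq_Rintegral => p _; rewrite /flow_score mulrDl.
- exact: (L1_flow2 gaE mu2 s0 s1 r1 mr mg (flow_density_ratio_bound mu2 mu2_le1 s0 r1) hg).
- exact: (L1_flow2 gaE mu2 s0 s1 r1 mid mg hid hg).
Qed.

(** The score is tested against itself. Stein's identity turns the term in F into (r^2/s)
    E[tau(F) Z sigma], and the two noise terms combine with it because s - 1/s = - r^2/s. *)
Lemma energyE : S = - (r ^+ 2 / s * \int[nu]_p ((1 - tau p.1) * (p.2 * sigma (Y p)))).
Proof.
rewrite (Rint_flow_score msigma hsigma).
have -> : \int[nu]_p (Y p * sigma (Y p)) =
    r * \int[nu]_p (p.1 * sigma (Y p)) + s * \int[nu]_p (p.2 * sigma (Y p)).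
  rewrite -(RintZl _ lA) -(RintZl _ lB) -(RintD (L1Zl _ lA) (L1Zl _ lB)).
  by apply: eq_Rintegral => p _; ring.
have -> : \int[nu]_p ((1 - tau p.1) * (p.2 * sigma (Y p))) =
    \int[nu]_p (p.2 * sigma (Y p)) - \int[nu]_p (tau p.1 * (p.2 * sigma (Y p))).
  by rewrite -(RintB lB lT); apply: eq_Rintegral => p _; ring.
rewrite (stein_flow gaE mu2 mtau tau2 stein s0 s1 r1 msigma hsigma).
have r2 : r ^+ 2 = 1 - s ^+ 2 by rewrite -rs addrK.
have -> : forall a b, - (s^-1 * a) + (r * (r / s * b) + s * a) =
  - (s^-1 * a) + (r ^+ 2 / s * b + s * a) by move=> a b; ring.
by rewrite r2; field; rewrite gt_eqF.
Qed.

(** For r = sqrt t and s = sqrt (1 - t), the factor [p.1 / (2 * r) - p.2 / (2 * s)] is the time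
    derivative of the interpolation, so the left-hand side is the derivative of E[u(F_t)] for a
    frozen potential u. By Stein's identity both sides equal - E[(1 - tau(F)) Z sigma] / (2 s). *)
Lemma flow_dissipation :
  \int[nu]_p (sigma (Y p) * (p.1 / (2 * r) - p.2 / (2 * s))) = S / (2 * r ^+ 2).
Proof.
rewrite energyE.
have -> : \int[nu]_p ((1 - tau p.1) * (p.2 * sigma (Y p))) =
    \int[nu]_p (p.2 * sigma (Y p)) - \int[nu]_p (tau p.1 * (p.2 * sigma (Y p))).
  by rewrite -(RintB lB lT); apply: eq_Rintegral => p _; ring.
have -> : \int[nu]_p (sigma (Y p) * (p.1 / (2 * r) - p.2 / (2 * s))) =
    (2 * r)^-1 * \int[nu]_p (p.1 * sigma (Y p)) - (2 * s)^-1 * \int[nu]_p (p.2 * sigma (Y p)).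
  rewrite -(RintZl _ lA) -(RintZl _ lB) -(RintB (L1Zl _ lA) (L1Zl _ lB)).
  by apply: eq_Rintegral => p _; ring.
rewrite (stein_flow gaE mu2 mtau tau2 stein s0 s1 r1 msigma hsigma).
by field; rewrite !gt_eqF.
Qed.

Let l1tau : L1 mu (fun x => (1 - tau x) ^+ 2).
Proof.
have l := L1D (L1_cst mu 2) (L1Zl 2 tau2).
apply: L1_dom l; first by msr.
by move=> x; rewrite ger0_norm ?sqr_ge0//; have := sqr_ge0 (1 + tau x); nra.
Qed.

Lemma energy_le_discrepancy :
  S <= r ^+ 4 / s ^+ 2 * \int[mu]_x ((1 - tau x) ^+ 2).
Proof.
have lD := L1_prod l1tau (L1_gaussian_sqr gaE).
have [_ ga2] := gaussian_moments gaE.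
have E := Rint_prod l1tau (L1_gaussian_sqr gaE); rewrite ga2 mulr1 in E.
rewrite -E.
(* Cauchy-Schwarz in absorbed form: - c x a <= a^2/2 + c^2 x^2/2, and half of [S] returns to the
   left-hand side. *)
suff : S <= 2^-1 * S + 2^-1 * (r ^+ 2 / s) ^+ 2 *
    \int[nu]_p ((1 - tau p.1) ^+ 2 * p.2 ^+ 2).
  have -> : r ^+ 4 / s ^+ 2 = (r ^+ 2 / s) ^+ 2 by field; rewrite gt_eqF.
  by move: (\int[_]_p _) (\int[_]_p _) => a b; lra.
rewrite {1}energyE -mulNr -(RintZl _ lW) -(RintZl _ lS) -(RintZl _ lD).
rewrite -(RintD (L1Zl _ lS) (L1Zl _ lD)).
apply: le_Rint; [exact: L1Zl|by apply: L1D; exact: L1Zl|].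
move=> p; move: (sigma (Y p)) (1 - tau p.1) (r ^+ 2 / s) => a b c.
have := sqr_ge0 (a + c * (b * p.2)); nra.
Qed.

(** The integrated inequality is S <= (r^2/s) (w m^eta S)^(1/(2+eta)); taking logarithms and solving
    for [ln S] gives the exponent 1/(1+eta). Positivity of [S] is needed for this, hence the
    separate case S = 0. *)
Lemma energy_le_interpolation (eta w m : R) : 0 < eta -> 0 < w -> 0 < m ->
  L1 nu (fun p => (`|1 - tau p.1| * `|p.2|) `^ (2 + eta)) ->
  \int[nu]_p ((`|1 - tau p.1| * `|p.2|) `^ (2 + eta)) <= w ->
  \int[nu]_p `|sigma (Y p)| <= m ->
  S <= expR (((2 + eta) * ln (r ^+ 2 / s) + ln w + eta * ln m) / (1 + eta)).
Proof.
move=> eta0 w0 m0 lwp hw hm.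
have p0 : 0 < 2 + eta by rewrite addr_gt0.
have pn0 : 2 + eta != 0 by rewrite gt_eqF.
have S_ge0 : 0 <= S by apply: ge0_Rint => p; rewrite -expr2 sqr_ge0.
have [SE|Sn0] := eqVneq S 0; first by rewrite SE expR_ge0.
have S0 : 0 < S by rewrite lt_neqAle eq_sym Sn0.
have c0 : 0 < r ^+ 2 / s by rewrite divr_gt0// exprn_gt0.
have lsg := L1_flow_norm gaE mu2 s0 s1 r1 msigma hsigma.
set K := expR ((ln w + eta * ln m + ln S) / (2 + eta)).
have hK : S <= r ^+ 2 / s * K.
  have -> : r ^+ 2 / s * K = \int[nu]_p (0 : R) + r ^+ 2 / s * K.
    by rewrite Rint_cst add0r.
  rewrite Rint_cst add0r.
  have lR : L1 nu (fun p => r ^+ 2 / s * (K *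
     ((2 + eta)^-1 * (expR (- ln w) * (`|1 - tau p.1| * `|p.2|) `^ (2 + eta)) +
      eta / (2 + eta) * (expR (- ln m) * `|sigma (Y p)|) +
      (2 + eta)^-1 * (expR (- ln S) * (sigma (Y p) * sigma (Y p)))))).
    by apply: L1Zl; apply: L1Zl; apply: L1D; [apply: L1D|]; apply: L1Zl; apply: L1Zl.
  apply: (@le_trans _ _ (\int[nu]_p (r ^+ 2 / s * (K *
     ((2 + eta)^-1 * (expR (- ln w) * (`|1 - tau p.1| * `|p.2|) `^ (2 + eta)) +
      eta / (2 + eta) * (expR (- ln m) * `|sigma (Y p)|) +
      (2 + eta)^-1 * (expR (- ln S) * (sigma (Y p) * sigma (Y p)))))))).
    rewrite {1}energyE -mulNr -(RintZl _ lW).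
    apply: le_Rint => //; first exact: L1Zl.
    move=> p; rewrite mulNr -mulrN ler_wpM2l ?(ltW c0)//.
    apply: le_trans (ler_norm _) _; rewrite normrN !normrM mulrA.
    have := @hoelder3_pointwise _ eta (ln w) (ln m) (ln S)
      (`|1 - tau p.1| * `|p.2|) `|sigma (Y p)| eta0.
    rewrite mulr_ge0// => /(_ isT (normr_ge0 _)).
    by rewrite (real_normK (num_real _)) expr2.
  have l1 := L1Zl ((2 + eta)^-1) (L1Zl (expR (- ln w)) lwp).
  have l2 := L1Zl (eta / (2 + eta)) (L1Zl (expR (- ln m)) lsg).
  have l3 := L1Zl ((2 + eta)^-1) (L1Zl (expR (- ln S)) lS).
  have l12 := L1D l1 l2; have l123 := L1D l12 l3.
  rewrite (RintZl _ (L1Zl _ l123)) (RintZl _ l123) ler_wpM2l ?(ltW c0)//.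
  (* What remains is a convex combination of three normalised integrals, each at most 1. *)
  rewrite ler_piMr ?expR_ge0//.
  rewrite (RintD l12 l3) (RintD l1 l2) !(RintZl _ (L1Zl _ _))//.
  rewrite !RintZl// !expRN !lnK ?posrE// mulVf//.
  have e1 : w^-1 * \int[nu]_p ((`|1 - tau p.1| * `|p.2|) `^ (2 + eta)) <= 1.
    by rewrite ler_pdivrMl// mulr1.
  have e2 : m^-1 * \int[nu]_p `|sigma (Y p)| <= 1 by rewrite ler_pdivrMl// mulr1.
  apply: (@le_trans _ _ ((2 + eta)^-1 * 1 + eta / (2 + eta) * 1 + (2 + eta)^-1 * 1)).
    rewrite !lerD// ler_wpM2l// ?invr_ge0 ?divr_ge0 ?(ltW p0) ?(ltW eta0)//.
  by rewrite le_eqVlt; apply/orP; left; apply/eqP; field.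
have K0 : 0 < K by exact: expR_gt0.
have h : ln S <= ln (r ^+ 2 / s) + ln K.
  rewrite -lnM ?posrE// ler_ln ?posrE//; exact: mulr_gt0.
rewrite /K expRK in h.
rewrite -{1}(lnK (_ : S \is Num.pos)) ?posrE// ler_expR ler_pdivlMr ?addr_gt0//.
move: h; rewrite -(ler_pM2r p0) mulrDl divfK//.
by move: (ln S) (ln w) (ln m) (ln (r ^+ 2 / s)) => a b c d; lra.
Qed.

(** |y| <= (1 + y^2)/2, and the cross term of E[Y^2] vanishes because the noise is centred and
    independent of F. *)
Lemma Rint_norm_flow_le1 : \int[nu]_p `|Y p| <= 1.
Proof.
have [g1 g2] := gaussian_moments gaE.
have lx : L1 mu (fun x => x).
  apply: L1_dom (L1D (L1_cst mu 1) mu2); first by msr.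
  move=> x; rewrite -(real_normK (num_real x)); have := normr_ge0 x; nra.
have lz := L1_gaussian_id gaE; have lz2 := L1_gaussian_sqr gaE.
have l1 := L1_fst ga mu2; have l2 := L1_snd mu lz2; have l12 := L1_prod lx lz.
have l : L1 nu (fun p => 2^-1 * (1 + (r ^+ 2 * p.1 ^+ 2 + s ^+ 2 * p.2 ^+ 2 +
    2 * r * s * (p.1 * p.2)))).
  apply: L1Zl; apply: L1D; first exact: L1_cst.
  by apply: L1D; [apply: L1D|]; apply: L1Zl.
have hid (y : R) : `|y| <= 1 * (1 + `|y|) by rewrite mul1r lerDr.
have mid : measurable_fun [set: measurableTypeR R] (fun x : measurableTypeR R => x) by msr.
have lY := L1_flow_norm gaE mu2 s0 s1 r1 mid hid.
apply: (@le_trans _ _ (\int[nu]_p (2^-1 * (1 + (r ^+ 2 * p.1 ^+ 2 + s ^+ 2 * p.2 ^+ 2 +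
    2 * r * s * (p.1 * p.2)))))).
  apply: le_Rint => // p.
  have -> : r ^+ 2 * p.1 ^+ 2 + s ^+ 2 * p.2 ^+ 2 + 2 * r * s * (p.1 * p.2) =
    `|Y p| ^+ 2 by rewrite (real_normK (num_real _)); ring.
  by have := sqr_ge0 (`|Y p| - 1); nra.
have la := L1Zl (r ^+ 2) l1; have lb := L1Zl (s ^+ 2) l2.
have lc := L1Zl (2 * r * s) l12; have lab := L1D la lb; have labc := L1D lab lc.
rewrite (RintZl _ (L1D (L1_cst nu 1) labc)) (RintD (L1_cst nu 1) labc) Rint_cst.
rewrite (RintD lab lc) (RintD la lb) (RintZl _ l1) (RintZl _ l2) (RintZl _ l12).
rewrite (Rint_prod lx lz) g1 mulr0 mulr0 addr0 (Rint_fst ga mu2) (Rint_snd mu lz2) g2.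
have h2 := ler_wpM2l (sqr_ge0 r) mu2_le1.
rewrite mulr1 in h2; rewrite mulr1 ler_pdivrMl// mulr1.
have -> : 2 = 1 + (r ^+ 2 + s ^+ 2) :> R by rewrite rs; ring.
by rewrite lerD2l lerD2r.
Qed.

(** Duality: tested against its own sign, the score is paired with a function bounded by 1. The
    noise term is then bounded by [b], and the term from the Gaussian density by E|Y| <= 1. *)
Lemma Rint_norm_score_le (b : R) :
  (forall g : R -> R, measurable_fun [set: measurableTypeR R] g ->
    (forall y, `|g y| <= 1) -> `|\int[nu]_p (p.2 * g (Y p))| <= b) ->
  \int[nu]_p `|sigma (Y p)| <= s^-1 * b + 1.
Proof.
move=> hb.
pose g y : R := if 0 <= sigma y then 1 else - 1.
have mg : measurable_fun [set: measurableTypeR R] g.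
  apply: measurable_fun_ifT; [|exact: measurable_cst|exact: measurable_cst].
  by apply: measurable_fun_ler; [exact: measurable_cst|].
have g1 y : `|g y| <= 1 by rewrite /g; case: ifP; rewrite ?normrN normr1.
have hg (y : R) : `|g y| <= 1 * (1 + `|y|).
  by rewrite mul1r (le_trans (g1 y))// lerDl.
have -> : \int[nu]_p `|sigma (Y p)| = \int[nu]_p (sigma (Y p) * g (Y p)).
  apply: eq_Rintegral => p _; rewrite /g; case: ifPn => h.
    by rewrite mulr1 ger0_norm.
  by rewrite mulrN1 ler0_norm// ltW// ltNge.
rewrite (Rint_flow_score mg hg); apply: lerD.
  apply: le_trans (ler_norm _) _; rewrite normrN normrM gtr0_norm ?invr_gt0//.
  by rewrite ler_wpM2l ?invr_ge0 ?(ltW s0)//; exact: hb.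
apply: le_trans Rint_norm_flow_le1.
have hid (y : R) : `|y| <= 1 * (1 + `|y|) by rewrite mul1r lerDr.
have mid : measurable_fun [set: measurableTypeR R] (fun x : measurableTypeR R => x) by msr.
have lYg := L1_flow2 gaE mu2 s0 s1 r1 mid mg hid hg.
have lY := L1_flow_norm gaE mu2 s0 s1 r1 mid hid.
apply: le_Rint => // p.
by apply: le_trans (ler_norm _) _; rewrite normrM ler_piMr.
Qed.

End energy.

(** * Total variation *)

Section staircase.
Context (R : realType).

Lemma sum_le_indic_full (n : nat) (v : R) : n%:R <= v ->
  \sum_(i < n) ((i.+1)%:R <= v)%R%:R = n%:R :> R.
Proof.
move=> nv; rewrite (eq_bigr (fun=> 1)) ?sumr_const ?card_ord// => i _.
by rewrite (le_trans _ nv)// ler_nat.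
Qed.

(** The sum counts the positive integers up to [v], so it is the integer part of [v]. *)
Lemma staircase (n : nat) (v : R) : 0 <= v -> v <= n%:R ->
  \sum_(i < n) ((i.+1)%:R <= v)%R%:R <= v <= \sum_(i < n) ((i.+1)%:R <= v)%R%:R + 1.
Proof.
elim: n => [|n IH] v0 vn.
  by rewrite big_ord0 v0 add0r (le_trans vn).
rewrite big_ord_recr/=; have [vn'|nv] := leP v n%:R.
  have -> : (n.+1%:R <= v) = false.
    by apply/negbTE; rewrite -ltNge (le_lt_trans vn')// ltr_nat.
  by rewrite addr0; exact: IH.
rewrite (sum_le_indic_full (ltW nv)); have [h|h] := boolP (n.+1%:R <= v).
  by rewrite natr1 h (le_trans vn)// lerDl.
by rewrite addr0 (ltW nv) natr1.
Qed.

End staircase.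

Section total_variation.
Context d (T : measurableType d) d' (T' : measurableType d') (R : realType).
Variables (P : probability T R) (X1 X2 : T -> T') (b : R).
Hypotheses (mX1 : measurable_fun [set: T] X1) (mX2 : measurable_fun [set: T] X2).
Hypothesis tv : forall A, measurable A ->
  `|fine (P (X1 @^-1` A)) - fine (P (X2 @^-1` A))| <= b.

Let L1_bounded (X : T -> T') (k : T' -> R) (c : R) :
  measurable_fun [set: T] X -> measurable_fun [set: T'] k ->
  (forall y, `|k y| <= c) -> L1 P (fun w => k (X w)).
Proof.
move=> mX mk kc; apply: L1_dom (L1_cst P c); last by [].
exact: measurableT_comp.
Qed.

(** Within 1/N, [k] is the average of the indicators of its N level sets at heights 1/N, ..., N/N.
    An average of N differences of probabilities is still at most [b], so no constant is lost. *)
Lemma tv_unit_interval (k : T' -> R) : measurable_fun [set: T'] k ->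
  (forall y, 0 <= k y <= 1) ->
  `|\int[P]_w k (X1 w) - \int[P]_w k (X2 w)| <= b.
Proof.
move=> mk k01; apply/ler_addgt0Pr => e e0.
(* Two approximation errors 1/N occur, one for each of [X1] and [X2]. *)
have [n ne] : exists n : nat, 2 / (n.+1)%:R < e.
  have e2 : 0 < e / 2 by rewrite divr_gt0.
  have [n hn] := ltr_add_invr e2.
  exists n; move: hn; rewrite add0r ltr_pdivlMr// => hn.
  by rewrite mulrC.
pose N := n.+1; have N0 : 0 < N%:R :> R by rewrite ltr0n.
pose A (i : nat) := k @^-1` [set v | (i.+1)%:R <= N%:R * v].
have mA i : measurable (A i).
  have -> : A i = [set: T'] `&` (fun y => N%:R * k y) @^-1` `[(i.+1)%:R, +oo[%classic.
    by rewrite setTI; apply/seteqP; split => y /=; rewrite in_itv/= andbT.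
  by apply: measurable_funM => //; exact: measurable_cst.
pose st y : R := N%:R^-1 * \sum_(i < N) \1_(A i) y.
have stE y : st y = N%:R^-1 * \sum_(i < N) ((i.+1)%:R <= N%:R * k y)%R%:R.
  congr (_ * _); apply: eq_bigr => i _; rewrite indicE.
  congr (nat_of_bool _)%:R; apply/idP/idP; first by move/set_mem.
  by move=> ?; apply/mem_set.
have lind i X : measurable_fun [set: T] X -> L1 P (fun w => \1_(A i) (X w)).
  move=> mX; apply: (@L1_bounded X (\1_(A i)) 1) => //.
  by move=> y; rewrite indicE; case: (_ \in _); rewrite ?normr1 ?normr0.
have lsum (M : nat) X : measurable_fun [set: T] X ->
    L1 P (fun w => \sum_(i < M) \1_(A i) (X w)).
  move=> mX; elim: M => [|M IH].
    by under eq_fun do rewrite big_ord0; exact: L1_cst.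
  under eq_fun do rewrite big_ord_recr.
  by apply: L1D => //; exact: lind.
have isum (M : nat) X : measurable_fun [set: T] X ->
    \int[P]_w (\sum_(i < M) \1_(A i) (X w)) = \sum_(i < M) fine (P (X @^-1` A i)).
  move=> mX; elim: M => [|M IH].
    rewrite big_ord0; under eq_Rintegral do rewrite big_ord0.
    exact: Rint_cst.
  rewrite big_ord_recr/= -IH.
  under eq_Rintegral do rewrite big_ord_recr.
  rewrite (RintD (lsum M X mX) (lind M X mX)); congr (_ + _).
  rewrite /Rintegral; congr fine.
  rewrite -[in RHS](setIT (X @^-1` A M)) -integral_indic//.
  by rewrite -[X in measurable X]setTI; exact: mX.
have kst X : measurable_fun [set: T] X ->
    `|\int[P]_w k (X w) - N%:R^-1 * \sum_(i < N) fine (P (X @^-1` A i))| <= N%:R^-1.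
  move=> mX; rewrite -isum// -(RintZl _ (lsum N X mX)).
  have lk : L1 P (fun w => k (X w)).
    apply: (@L1_bounded X k 1) => // y.
    by have /andP[? ?] := k01 y; rewrite ger0_norm.
  rewrite -(RintB lk (L1Zl _ (lsum N X mX))) -[leRHS](Rint_cst P).
  apply: norm_Rint.
  - exact: (L1B lk (L1Zl _ (lsum N X mX))).
  - exact: L1_cst.
  move=> w; rewrite -/(st (X w)) stE.
  have /andP[k0 k1] := k01 (X w).
  have h0 : 0 <= N%:R * k (X w) by rewrite mulr_ge0.
  have h1 : N%:R * k (X w) <= N%:R by rewrite ler_piMr.
  have /andP[a1 a2] := staircase h0 h1.
  rewrite ler_norml; set S := \sum_(i < N) _ in a1 a2 *.
  have e1 : N%:R^-1 * S <= k (X w) by rewrite ler_pdivrMl.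
  have e2 : k (X w) <= N%:R^-1 * S + N%:R^-1.
    by rewrite -{2}(mulr1 N%:R^-1) -mulrDr ler_pdivlMl.
  have e3 : 0 <= N%:R^-1 :> R by rewrite invr_ge0 ltW.
  by apply/andP; split; lra.
have hs : `|N%:R^-1 * \sum_(i < N) fine (P (X1 @^-1` A i)) -
    N%:R^-1 * \sum_(i < N) fine (P (X2 @^-1` A i))| <= b.
  rewrite -mulrBr -sumrB normrM (gtr0_norm (_ : 0 < N%:R^-1)) ?invr_gt0//.
  rewrite ler_pdivrMl//; apply: le_trans (ler_norm_sum _ _ _) _.
  apply: (@le_trans _ _ (\sum_(i < N) b)); first by apply: ler_sum => i _; exact: tv.
  by rewrite sumr_const card_ord mulr_natl.
have := kst X1 mX1; have := kst X2 mX2; move: hs ne.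
rewrite -/N.
move: (\int[P]_w k (X1 w)) (\int[P]_w k (X2 w)) => x1 x2.
move: (N%:R^-1 * \sum_(i < N) _) (N%:R^-1 * \sum_(i < N) _) => y1 y2.
move: (N%:R^-1) => i.
rewrite !ler_norml => /andP[? ?] ? /andP[? ?] /andP[? ?].
by apply/andP; split; lra.
Qed.

(** The factor 2 is the length of the interval [-1, 1], rescaled to [0, 1]. *)
Lemma tv_bounded (h : T' -> R) : measurable_fun [set: T'] h ->
  (forall y, `|h y| <= 1) ->
  `|\int[P]_w h (X1 w) - \int[P]_w h (X2 w)| <= 2 * b.
Proof.
move=> mh h1.
pose k y := 2^-1 * (1 + h y).
have mk : measurable_fun [set: T'] k.
  by apply: measurable_funM => //; apply: measurable_funD.
have k01 y : 0 <= k y <= 1.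
  by have := h1 y; rewrite /k ler_norml => /andP[? ?]; apply/andP; split; lra.
have hk X : measurable_fun [set: T] X ->
    \int[P]_w h (X w) = 2 * \int[P]_w k (X w) - 1.
  move=> mX; have lh := L1_bounded mX mh h1.
  rewrite /k (RintZl _ (L1D (L1_cst P 1) lh)) (RintD (L1_cst P 1) lh) Rint_cst.
  by rewrite mulrA divff// mul1r addrAC subrr add0r.
rewrite !hk//.
have -> : forall x y : R, 2 * x - 1 - (2 * y - 1) = 2 * (x - y) by move=> x y; ring.
by rewrite normrM ger0_norm// ler_wpM2l// tv_unit_interval.
Qed.

End total_variation.

Section flow_total_variation.
Context (R : realType).
Local Notation leb := (@lebesgue_measure R).
Variables (mu ga : probability (measurableTypeR R) R).
Hypothesis gaE : forall A, measurable A ->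
  ga A = (\int[leb]_(x in A) (normal_pdf 0 1 x)%:E)%E.
Local Notation nu := (mu \x ga)%E.
Variables (r s theta : R).
Local Notation Y := (fun p : R * R => r * p.1 + s * p.2).
Hypothesis theta0 : 0 <= theta.
Hypothesis tv : forall (x : R) (A : set (measurableTypeR R)), measurable A ->
  `|fine (mu ((fun y : R => r * y + s * x) @^-1` A)) - fine (mu A)| <=
  theta * (1 + `|x|).

Let maff (x : R) :
  measurable_fun [set: measurableTypeR R] (fun y => r * y + s * x : measurableTypeR R).
Proof. by under eq_fun do rewrite addrC; exact: measurable_affine. Qed.

Let mY : measurable_fun [set: measurableTypeR R * measurableTypeR R]
  (fun p => Y p : measurableTypeR R).
Proof.
by apply: (@measurable_funD _ _ _ _ (fun p => r * p.1) (fun p => s * p.2)); msr.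
Qed.

Variable g : R -> R.
Hypotheses (mg : measurable_fun [set: measurableTypeR R] g) (g1 : forall y, `|g y| <= 1).

Let L1_aff (x : R) : L1 mu (fun y => g (r * y + s * x)).
Proof. by apply: L1_dom (L1_cst mu 1) => //; exact: (measurableT_comp mg (maff x)). Qed.

Let L1_gY : L1 nu (fun p => g (Y p)).
Proof. by apply: L1_dom (L1_cst nu 1) => //; exact: (measurableT_comp mg mY). Qed.

Let slice (x : R) : `|\int[mu]_y g (r * y + s * x) - \int[mu]_y g y| <=
  2 * (theta * (1 + `|x|)).
Proof.
apply: (tv_bounded (P := mu) (X1 := (fun y => r * y + s * x : measurableTypeR R))
  (X2 := fun y : measurableTypeR R => y)) => //.
by move=> A mA; exact: tv.
Qed.

Let abs_z : L1 ga (fun z => `|z|).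
Proof. exact: (L1_norm (L1_gaussian_id gaE)). Qed.

Let abs_moment : \int[ga]_z `|z| <= 1.
Proof.
have [_ e2] := gaussian_moments gaE.
have l := L1Zl 2^-1 (L1D (L1_cst ga 1) (L1_gaussian_sqr gaE)).
apply: (@le_trans _ _ (\int[ga]_z (2^-1 * (1 + z ^+ 2)))).
  apply: le_Rint => // z; rewrite -(real_normK (num_real z)).
  by have := sqr_ge0 (`|z| - 1); nra.
rewrite (RintZl _ (L1D (L1_cst ga 1) (L1_gaussian_sqr gaE))).
rewrite (RintD (L1_cst ga 1) (L1_gaussian_sqr gaE)) Rint_cst e2.
by lra.
Qed.

(** The slice bound is averaged over the noise: 2 theta (1 + E|Z|) <= 4 theta. *)
Lemma Rint_flow_close : `|\int[nu]_p g (Y p) - \int[mu]_y g y| <= 4 * theta.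
Proof.
have lm := measurable_iter_swap L1_gY L1_aff; rewrite /= in lm.
have lb : L1 ga (fun z => 2 * (theta * (1 + `|z|))).
  by apply: L1Zl; apply: L1Zl; apply: L1D => //; exact: L1_cst.
have lI : L1 ga (fun z => \int[mu]_y g (r * y + s * z)).
  apply: L1_dom (L1_cst ga 1) => // z; rewrite -(Rint_cst mu 1).
  by apply: norm_Rint => //; exact: L1_cst.
have ld : L1 ga (fun z => \int[mu]_y g (r * y + s * z) - \int[mu]_y g y).
  by apply: L1B => //; exact: L1_cst.
rewrite (Rint_iter_swap L1_gY L1_aff) /=.
have -> : \int[ga]_z \int[mu]_y g (r * y + s * z) - \int[mu]_y g y =
    \int[ga]_z (\int[mu]_y g (r * y + s * z) - \int[mu]_y g y).
  by rewrite (RintB lI (L1_cst ga _)) Rint_cst.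
apply: (@le_trans _ _ (\int[ga]_z (2 * (theta * (1 + `|z|))))).
  by apply: norm_Rint => // z; exact: slice.
have l1 := L1D (L1_cst ga 1) abs_z.
rewrite (RintZl _ (L1Zl _ l1)) (RintZl _ l1) (RintD (L1_cst ga 1) abs_z) Rint_cst.
by have := ler_wpM2l theta0 abs_moment; lra.
Qed.

Let L1_zg : L1 nu (fun p => p.2 * g (Y p)).
Proof.
apply: L1_dom (L1_snd mu abs_z).
  by apply: measurable_funM; [msr|exact: (measurableT_comp mg mY)].
by move=> p; rewrite normrM ler_piMr.
Qed.

Lemma Rint_flow_noise_le1 : `|\int[nu]_p (p.2 * g (Y p))| <= 1.
Proof.
apply: le_trans abs_moment; rewrite -(Rint_snd mu abs_z).
apply: norm_Rint => //; first exact: (L1_snd mu abs_z).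
by move=> p; rewrite normrM ler_piMr.
Qed.

(** Since E[Z] = 0, the constant [\int[mu]_y g y] may be subtracted at each value of the noise. What
    is left is a total variation difference weighted by |z|, and 2 theta E[|Z| + Z^2] <= 4 theta. *)
Lemma Rint_flow_noise : `|\int[nu]_p (p.2 * g (Y p))| <= 4 * theta.
Proof.
have [e1 e2] := gaussian_moments gaE.
have lz2 := L1_gaussian_sqr gaE.
have lza x : L1 mu (fun y => x * g (r * y + s * x)) by exact: L1Zl.
have lm := measurable_iter_swap L1_zg lza; rewrite /= in lm.
have lI : L1 ga (fun z => \int[mu]_y (z * g (r * y + s * z))).
  apply: L1_dom abs_z => // z; rewrite (RintZl _ (L1_aff z)) normrM ler_piMr//.
  by rewrite -(Rint_cst mu 1); apply: norm_Rint => //; exact: L1_cst.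
have lc : L1 ga (fun z => z * \int[mu]_y g y) by exact: (L1Zr _ (L1_gaussian_id gaE)).
rewrite (Rint_iter_swap L1_zg lza) /=.
have -> : \int[ga]_z \int[mu]_y (z * g (r * y + s * z)) =
    \int[ga]_z (\int[mu]_y (z * g (r * y + s * z)) - z * \int[mu]_y g y).
  rewrite (RintB lI lc) RintegralZr//; last exact: (L1_gaussian_id gaE).
  by rewrite e1 mul0r subr0.
have lb : L1 ga (fun z => 2 * theta * (`|z| + z ^+ 2)).
  by apply: L1Zl; exact: L1D.
apply: (@le_trans _ _ (\int[ga]_z (2 * theta * (`|z| + z ^+ 2)))).
  apply: norm_Rint => //; first exact: L1B.
  move=> z; rewrite (RintZl _ (L1_aff z)) -mulrBr normrM.
  apply: le_trans (ler_wpM2l (normr_ge0 z) (slice z)) _.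
  rewrite -(real_normK (num_real z)) le_eqVlt; apply/orP; left; apply/eqP; ring.
rewrite (RintZl _ (L1D abs_z lz2)) (RintD abs_z lz2) e2.
by have := ler_wpM2l theta0 abs_moment; lra.
Qed.

End flow_total_variation.

(** * Evolution of the entropy *)

Section dini.
Context (R : realType).
Implicit Types (G : R -> R) (a b : R).

(** Real induction downwards from [b]. For a fixed slope [e], let [m] be the infimum of the points
    [s] with G b - G s <= e (b - s). Upper semicontinuity from the right places [m] in this set, and
    the point to the left of [m] granted by the first hypothesis contradicts minimality unless m =
    a. *)
Lemma left_dini_le G a b : a <= b ->
  (forall t, a < t -> t <= b -> forall e, 0 < e ->
     exists2 s, a <= s < t & G t - G s <= e * (t - s)) ->
  (forall t, a <= t -> t < b -> forall e, 0 < e ->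
     exists2 dl, 0 < dl & forall s, t < s < t + dl -> s <= b -> G s <= G t + e) ->
  G b <= G a.
Proof.
move=> ab hl hu.
suff h e : 0 < e -> G b - G a <= e * (b - a).
  rewrite -subr_le0; apply/ler_addgt0Pr => e e0; rewrite add0r.
  have ba1 : 0 < b - a + 1 by rewrite ltr_wpDl// subr_ge0.
  apply: le_trans (h (e / (b - a + 1)) _) _; first by rewrite divr_gt0.
  rewrite mulrAC ler_pdivrMr// ler_wpM2l ?(ltW e0)//; lra.
move=> e0.
pose E := [set s | a <= s <= b /\ G b - G s <= e * (b - s)].
have Eb : E b by rewrite /E/= ab lexx !subrr mulr0.
have lbE : lbound E a by move=> s [/andP[]].
have infE : has_inf E by split; [exists b|exists a].
pose m := inf E.
have am : a <= m by apply: lb_le_inf; [exists b|].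
have mb : m <= b by apply: ge_inf => //; exists a.
have Em : E m.
  split; first by rewrite am mb.
  have [mE|mb'] := eqVneq m b; first by rewrite mE !subrr mulr0.
  have {}mb' : m < b by rewrite lt_neqAle mb'.
  apply/ler_addgt0Pr => e' e'0.
  have [dl dl0 hdl] := hu m am mb' e' e'0.
  have [s [/andP[as_ sb] hs] hsm] := inf_adherent dl0 infE.
  have ms : m <= s by apply: ge_inf; [exists a|rewrite /E/= as_ sb].
  have [sE|sm] := eqVneq s m.
    by rewrite -{1}sE (le_trans hs)// sE lerDl ltW.
  have ms' : m < s < m + dl by rewrite lt_neqAle eq_sym sm ms hsm.
  have h1 := hdl s ms' sb.
  have h2 : e * (b - s) <= e * (b - m) by rewrite (ler_wpM2l (ltW e0))// lerD2l lerN2.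
  lra.
have [mE|ma] := eqVneq m a; first by have [_] := Em; rewrite mE.
have {}ma : a < m by rewrite lt_neqAle eq_sym ma.
have [s /andP[as_ sm] hs] := hl m ma mb e e0.
have Es : E s.
  split; first by rewrite as_ (le_trans (ltW sm)).
  by have [_] := Em; move: hs; rewrite !mulrBr; lra.
have : m <= s by apply: ge_inf => //; exists a.
by rewrite leNgt sm.
Qed.

Lemma is_derive_seq (f : R -> R) (t l : R) (t_ : nat -> R) :
  is_derive t 1 f l -> (forall n, t_ n != t) -> t_ n @[n --> \oo] --> t ->
  (f t - f (t_ n)) / (t - t_ n) @[n --> \oo] --> l.
Proof.
move=> [df <-] tn tc.
have /cvg_ex[/= l' hl'] := df.
have -> : 'D_1 f t = l' by apply/cvg_lim.
have hn : forall n, t_ n - t != 0 by move=> n; rewrite subr_eq0.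
have hc : t_ n - t @[n --> \oo] --> 0 by apply/subr_cvg0.
have := (cvgr_dnbhsP _ _ _).1 hl' _ (conj hn hc).
apply: cvg_trans; apply: near_eq_cvg; apply: nearW => n /=.
rewrite /GRing.scale/= mulr1 subrK.
by rewrite -(opprB (t_ n) t) -(opprB (f (t_ n)) (f t)) invrN mulrNN mulrC.
Qed.

(** The shift to [n.+2] keeps even the first term strictly above [a]. *)
Lemma left_seq_lt a t n : a < t -> a < t - (t - a) / n.+2%:R < t.
Proof.
rewrite -subr_gt0 => ta0.
have h : 0 < (t - a) / n.+2%:R by rewrite divr_gt0.
have h' : (t - a) / n.+2%:R < t - a by rewrite ltr_pdivrMr// ltr_pMr// ltr1n.
by move: h h'; set x := _ / _ => ? ?; apply/andP; split; lra.
Qed.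

Lemma cvg_left_seq a t : t - (t - a) / n.+2%:R @[n --> \oo] --> t.
Proof.
rewrite -[X in _ --> X]subr0; apply: cvgB; first exact: cvg_cst.
rewrite -(mulr0 (t - a)); apply: cvgM; first exact: cvg_cst.
have h : [sequence (n.+1%:R^-1 : R)]_n @ \oo --> (0 : R) by exact: cvg_harmonic.
by move: h; rewrite -cvg_shiftS.
Qed.

Lemma is_derive_subl (x : R) : is_derive x 1 (fun y : R => 1 - y) (- 1).
Proof.
by have := is_deriveB (is_derive_cst (1 : R) x 1) (is_derive_id x (1 : R)); rewrite sub0r.
Qed.

Lemma is_derive_ln_subl (x : R) : x < 1 ->
  is_derive x 1 (fun y => ln (1 - y)) (- (1 - x)^-1).
Proof.
move=> x1.
have d1 : is_derive (1 - x) 1 (@ln R) ((1 - x)^-1).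
  by apply: is_derive1_ln; rewrite subr_gt0.
have := @is_derive1_comp _ (@ln R) (fun y => 1 - y) x _ _ d1 (is_derive_subl x).
by rewrite mulrN1.
Qed.

Lemma derive_growth (u v : R -> R) (C : R) :
  (forall y : R, is_derive y 1 u (v y)) -> (forall y, `|v y| <= C * (1 + `|y|)) ->
  forall a b, `|u a - u b| <= C * (1 + `|a| + `|b|) * `|a - b|.
Proof.
move=> du hv.
have C0 : 0 <= C by exact: growth_const_ge0 hv.
have h a b : a <= b -> `|u b - u a| <= C * (1 + `|a| + `|b|) * `|b - a|.
  move=> ab.
  have cu : {within `[a, b], continuous u}.
    apply: derivable_within_continuous => x _; by have [] := du x.
  have [c cab ->] := MVT_segment ab (fun x _ => du x) cu.
  rewrite normrM ler_wpM2r//; apply: le_trans (hv c) _; rewrite ler_wpM2l//.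
  rewrite -addrA lerD2l.
  move: cab; rewrite in_itv/= => /andP[ac cb].
  rewrite ler_norml; have := ler_norm b; have := ler_norm (- a); rewrite normrN.
  have := normr_ge0 a; have := normr_ge0 b.
  by move=> ? ? ? ?; apply/andP; split; lra.
move=> a b; have [ab|/ltW ba] := leP a b; last by rewrite addrAC; exact: h.
by rewrite distrC (distrC a); exact: h.
Qed.

End dini.

(** * Semicontinuity and left derivative of the entropy *)

Section time_evolution.
Context (R : realType).
Local Notation leb := (@lebesgue_measure R).
Variables (mu ga : probability (measurableTypeR R) R).
Hypothesis gaE : forall A, measurable A ->
  ga A = (\int[leb]_(x in A) (normal_pdf 0 1 x)%:E)%E.
Hypothesis mu2 : L1 mu (fun x => x ^+ 2).
Hypothesis mu2_le1 : \int[mu]_x (x ^+ 2) <= 1.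
Local Notation nu := (mu \x ga)%E.
Local Notation r := (fun t : R => Num.sqrt t).
Local Notation s := (fun t : R => Num.sqrt (1 - t)).
Local Notation Fl := (fun t (p : R * R) => Num.sqrt t * p.1 + Num.sqrt (1 - t) * p.2).
Local Notation u := (fun t => flow_log mu (Num.sqrt t) (Num.sqrt (1 - t))).
Local Notation sigma := (fun t => flow_score mu (Num.sqrt t) (Num.sqrt (1 - t))).

(** The relative entropy D(t), written over one product space so that different times share the same
    pair (F, Z). *)
Definition flow_entropy t := \int[nu]_p u t (Fl t p).

Let s_gt0 t : t < 1 -> 0 < s t.
Proof. by move=> t1; rewrite sqrtr_gt0 subr_gt0. Qed.

Let s_le1 t : 0 <= t -> s t <= 1.
Proof. by move=> t0; rewrite -[leRHS]sqrtr1 ler_wsqrtr// gerBl. Qed.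

Let r_le1 t : 0 <= t -> t < 1 -> (r t) ^+ 2 <= 1.
Proof. by move=> t0 t1; rewrite sqr_sqrtr// ltW. Qed.

Let s_sqr t : t < 1 -> (s t) ^+ 2 = 1 - t.
Proof. by move=> t1; rewrite sqr_sqrtr// subr_ge0 ltW. Qed.

Let score_bound t y : 0 <= t -> t < 1 ->
  `|sigma t y| <= (2 / (1 - t) + 1) * (1 + `|y|).
Proof.
move=> t0 t1; rewrite -(s_sqr t1).
by apply: flow_score_bound => //; [exact: s_gt0|exact: r_le1].
Qed.

Let du t (y : R) : 0 <= t -> t < 1 -> is_derive y 1 (u t) (sigma t y).
Proof.
by move=> t0 t1; apply: is_derive_flow_log => //; [exact: s_gt0|exact: r_le1].
Qed.

Let u_incr t a b : 0 <= t -> t < 1 ->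
  `|u t a - u t b| <= (2 / (1 - t) + 1) * (1 + `|a| + `|b|) * `|a - b|.
Proof.
move=> t0 t1; apply: (@derive_growth _ _ (sigma t)).
  by move=> y; exact: du.
by move=> y; exact: score_bound.
Qed.

Let mu_ t : 0 <= t -> t < 1 -> measurable_fun [set: measurableTypeR R] (u t).
Proof.
by move=> t0 t1; apply: measurable_flow_log => //; [exact: s_gt0|exact: r_le1].
Qed.

Let Fl_growth t p : 0 <= t -> t < 1 -> 1 + `|Fl t p| <= 1 + `|p.1| + `|p.2|.
Proof.
by move=> t0 t1; apply: flow_growth; [exact: s_gt0|exact: s_le1|exact: r_le1].
Qed.

Let C_ge0 (t : R) : t < 1 -> 0 <= 2 / (1 - t) + 1.
Proof. by move=> t1; rewrite addr_ge0// divr_ge0// subr_ge0 ltW. Qed.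

Lemma measurable_interpolation t (g : R -> R) : measurable_fun [set: measurableTypeR R] g ->
  measurable_fun [set: measurableTypeR R * measurableTypeR R] (fun p => g (Fl t p)).
Proof.
move=> mg; apply: (measurableT_comp (f := g)) => //.
by apply: (@measurable_funD _ _ _ _ (fun p => r t * p.1) (fun p => s t * p.2)); msr.
Qed.

Lemma L1_flow_log t t' : 0 <= t -> t < 1 -> 0 <= t' -> t' < 1 ->
  L1 nu (fun p => u t (Fl t' p)).
Proof.
move=> t0 t1 t0' t1'.
have l := L1Zl (`|u t 0| + (2 / (1 - t) + 1)) (L1_flow_weight gaE mu2).
apply: L1_dom l; first by apply: measurable_interpolation; exact: mu_.
move=> p; have h := u_incr (Fl t' p) 0 t0 t1.
rewrite normr0 addr0 subr0 in h.
have g := Fl_growth p t0' t1'.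
have w1 := flow_weight_ge1 p.
have h2 : (1 + `|Fl t' p|) * `|Fl t' p| <= flow_weight p.
  rewrite /flow_weight; have := normr_ge0 (Fl t' p); nra.
rewrite mulrDl.
have -> : u t (Fl t' p) = u t 0 + (u t (Fl t' p) - u t 0) by ring.
apply: le_trans (ler_normD _ _) _; apply: lerD; first by rewrite ler_peMr.
by apply: le_trans h _; rewrite -mulrA ler_wpM2l// C_ge0.
Qed.

Lemma integral_flow_density t : 0 <= t -> t < 1 ->
  (\int[leb]_y (flow_density mu (r t) (s t) y)%:E = 1%:E)%E.
Proof.
move=> t0 t1.
have m1 : measurable_fun [set: measurableTypeR R] (fun=> 1 : R) by msr.
have := ge0_integral_flow mu gaE (r t) (s_gt0 t1) m1 (fun=> ler01).
under [X in _ = X]eq_integral do rewrite mul1r.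
by move=> <-; rewrite integral_cst//= mul1e; exact: probability_setT.
Qed.

(* Gibbs' inequality: [u t] is the optimal potential at time [t] only. *)
Lemma Rint_flow_log_le t t' : 0 <= t -> t < 1 -> 0 <= t' -> t' < 1 ->
  \int[nu]_p u t (Fl t' p) <= flow_entropy t'.
Proof.
move=> t0 t1 t0' t1'.
have q0 y := flow_density_gt0 mu2 mu2_le1 (s_gt0 t1) (r_le1 t0 t1) y.
have q0' y := flow_density_gt0 mu2 mu2_le1 (s_gt0 t1') (r_le1 t0' t1') y.
have mq := measurable_flow_density mu2 (r t) (s_gt0 t1).
have E y : ln (flow_density mu (r t) (s t) y / flow_density mu (r t') (s t') y) =
    u t y - u t' y.
  rewrite !flow_logE//; try exact: s_gt0; try exact: r_le1.
  have h (x1 x2 x3 x4 : R) : x1 - x2 = x1 + x3 - x4 - (x2 + x3 - x4) by ring.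
  by rewrite ln_div ?posrE; [exact: h|exact: q0|exact: q0'].
have l1 := L1_flow_log t0 t1 t0' t1'.
have l2 := L1_flow_log t0' t1' t0' t1'.
have := @Rint_ln_ratio_le _ mu ga gaE mu2 mu2_le1 (r t') (s t') (s_gt0 t1')
  (r_le1 t0' t1') _ 1 mq q0 (integral_flow_density t0 t1).
rewrite subrr.
have -> : (fun p => ln (flow_density mu (r t) (s t) (Fl t' p) /
    flow_density mu (r t') (s t') (Fl t' p))) = (fun p => u t (Fl t' p) - u t' (Fl t' p)).
  by apply/funext => p; rewrite E.
by move=> /(_ (L1B l1 l2)); rewrite (RintB l1 l2) subr_le0.
Qed.

Lemma flow_entropy0 : flow_entropy 0 = 0.
Proof.
rewrite /flow_entropy -[RHS](Rint_cst nu); apply: eq_Rintegral => p _.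
rewrite /flow_log subr0 sqrtr1 sqrtr0.
have -> : flow_density mu 0 1 = normal_pdf 0 1.
  apply/funext => y; rewrite /flow_density.
  by under eq_Rintegral do rewrite mul0r; exact: Rint_cst.
by rewrite divff ?ln1// gt_eqF// normal_pdf01_gt0.
Qed.

(** When the past time varies and [t] is fixed, [t] is the larger end for sqrt t, while 1 - t is the
    smaller end for sqrt (1 - t). The two versions of this bound divide by the root at the fixed
    end. *)
Let sqrt_incr (a b : R) : 0 <= a -> a <= b -> 0 < b ->
  0 <= Num.sqrt b - Num.sqrt a <= (b - a) / Num.sqrt b.
Proof.
move=> a0 ab b0; rewrite subr_ge0 ler_wsqrtr//=.
rewrite ler_pdivlMr ?sqrtr_gt0//.
rewrite [leRHS](_ : b - a = Num.sqrt b ^+ 2 - Num.sqrt a ^+ 2); last first.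
  by rewrite !sqr_sqrtr// ltW.
have := ler_wsqrtr ab; have := sqrtr_ge0 a; have := sqrtr_ge0 b; nra.
Qed.

Let sqrt_incr' (a b : R) : 0 < a -> a <= b ->
  0 <= Num.sqrt b - Num.sqrt a <= (b - a) / Num.sqrt a.
Proof.
move=> a0 ab; rewrite subr_ge0 ler_wsqrtr//=.
rewrite ler_pdivlMr ?sqrtr_gt0//.
have b0 := le_trans (ltW a0) ab.
rewrite [leRHS](_ : b - a = Num.sqrt b ^+ 2 - Num.sqrt a ^+ 2); last first.
  by rewrite !sqr_sqrtr// ltW.
have := ler_wsqrtr ab; have := sqrtr_ge0 a; have := sqrtr_ge0 b; nra.
Qed.

Let Fl_incr t t' p : `|Fl t p - Fl t' p| <=
  (`|r t - r t'| + `|s t - s t'|) * (1 + `|p.1| + `|p.2|).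
Proof.
have -> : Fl t p - Fl t' p = (r t - r t') * p.1 + (s t - s t') * p.2 by ring.
apply: le_trans (ler_normD _ _) _; rewrite !normrM mulrDl.
apply: lerD; rewrite ler_wpM2l//.
  by have := normr_ge0 p.2; lra.
by have := normr_ge0 p.1; lra.
Qed.

Let u_Fl_incr t t1 t2 p : 0 <= t -> t < 1 -> 0 <= t1 -> t1 < 1 -> 0 <= t2 -> t2 < 1 ->
  `|u t (Fl t1 p) - u t (Fl t2 p)| <=
  2 * (2 / (1 - t) + 1) * (`|r t1 - r t2| + `|s t1 - s t2|) * flow_weight p.
Proof.
move=> a0 a1 b0 b1 c0 c1.
apply: le_trans (u_incr _ _ a0 a1) _.
have g1 := Fl_growth p b0 b1; have g2 := Fl_growth p c0 c1.
have h := Fl_incr t1 t2 p.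
set V := 1 + `|p.1| + `|p.2| in g1 g2 h *.
have V1 : 1 <= V by rewrite /V; have := normr_ge0 p.1; have := normr_ge0 p.2; lra.
have C0 := C_ge0 a1; set C := 2 / (1 - t) + 1 in C0 *.
have h1 : 1 + `|Fl t1 p| + `|Fl t2 p| <= 2 * V by lra.
have dl0 : 0 <= `|r t1 - r t2| + `|s t1 - s t2| by rewrite addr_ge0.
set dl := _ + _ in h dl0 *.
have h2 : C * (1 + `|Fl t1 p| + `|Fl t2 p|) <= C * (2 * V) by rewrite ler_wpM2l.
apply: le_trans (ler_wpM2r (normr_ge0 _) h2) _.
have CV : 0 <= C * (2 * V) by rewrite !mulr_ge0// (le_trans ler01).
apply: le_trans (ler_wpM2l CV h) _.
by rewrite /flow_weight -/V le_eqVlt; apply/orP; left; apply/eqP; ring.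
Qed.

(** Here Gibbs' inequality uses the potential at the later time t', which varies. Its growth
    constant 2/(1 - t') + 1 is controlled by keeping t' below the midpoint [b] of t and 1. *)
Lemma flow_entropy_right t : 0 <= t -> t < 1 -> forall e, 0 < e ->
  exists2 dl, 0 < dl & forall t', t < t' < t + dl ->
    flow_entropy t' <= flow_entropy t + e.
Proof.
move=> t0 t1 e e0.
pose b := (t + 1) / 2.
have tb : t < b by rewrite /b; lra.
have b1 : b < 1 by rewrite /b; lra.
pose M := \int[nu]_p flow_weight p.
have lW := L1_flow_weight gaE mu2.
have M0 : 0 <= M.
  by apply: ge0_Rint => p; apply: le_trans (flow_weight_ge1 p).
pose K := 2 * (2 / (1 - b) + 1) * M + 1.
have K0 : 0 < K by rewrite ltr_wpDl// mulr_ge0// mulr_ge0// C_ge0.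
have : (fun t' => `|r t' - r t| + `|s t' - s t|) t' @[t' --> t] --> (0 : R).
  have c1 : r t' @[t' --> t] --> r t by exact: sqrt_continuous.
  have c2 : s t' @[t' --> t] --> s t.
    have h : 1 - t' @[t' --> t] --> 1 - t by apply: cvgB; [exact: cvg_cst|exact: cvg_id].
    exact: cvg_comp h (@sqrt_continuous _ _).
  have n1 : `|r t' - r t| @[t' --> t] --> (0 : R).
    by have := cvg_norm (cvgB c1 (cvg_cst (r t))); rewrite subrr normr0; apply.
  have n2 : `|s t' - s t| @[t' --> t] --> (0 : R).
    by have := cvg_norm (cvgB c2 (cvg_cst (s t))); rewrite subrr normr0; apply.
  by have := cvgD n1 n2; rewrite addr0; apply.
move=> /cvgrPdist_lt /(_ (e / K)) []; first by rewrite divr_gt0.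
move=> dl /= dl0 hdl.
exists (Num.min dl (b - t)); first by rewrite lt_min dl0 subr_gt0.
move=> t' /andP[tt' ht'].
have t'dl : t' < t + dl.
  by apply: lt_le_trans ht' _; rewrite lerD2l ge_min lexx.
have t'b : t' < b.
  by apply: lt_le_trans ht' _; rewrite -lerBrDl ge_min lexx orbT.
have t'0 : 0 <= t' by lra.
have t'1 : t' < 1 by lra.
have hd : `|r t' - r t| + `|s t' - s t| < e / K.
  have : ball_ Num.norm t dl t' by rewrite /ball_/= ltr_norml; apply/andP; split; lra.
  by move=> /hdl; rewrite sub0r normrN ger0_norm// addr_ge0.
have l1 := L1_flow_log t'0 t'1 t'0 t'1.
have l2 := L1_flow_log t'0 t'1 t0 t1.
have h1 := Rint_flow_log_le t'0 t'1 t0 t1.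
suff h2 : \int[nu]_p u t' (Fl t' p) - \int[nu]_p u t' (Fl t p) <= e.
  move: h2; rewrite lerBlDr => h2; apply: le_trans h2 _.
  by rewrite [leRHS]addrC lerD2l.
rewrite -(RintB l1 l2).
apply: (@le_trans _ _ (\int[nu]_p (2 * (2 / (1 - b) + 1) * (e / K) * flow_weight p))).
  apply: le_Rint; [exact: L1B|exact: L1Zl|] => p.
  apply: le_trans (ler_norm _) _.
  apply: le_trans (u_Fl_incr p t'0 t'1 t'0 t'1 t0 t1) _.
  rewrite ler_wpM2r//; first by apply: le_trans (flow_weight_ge1 p).
  apply: ler_pM => //.
  - by rewrite mulr_ge0// C_ge0.
  - rewrite ler_wpM2l// lerD2r ler_wpM2l// lef_pV2 ?posrE ?subr_gt0//.
    by rewrite lerD2l lerN2 ltW.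
  - exact: ltW.
rewrite (RintZl _ lW) -/M.
have -> : 2 * (2 / (1 - b) + 1) * (e / K) * M = (K - 1) / K * e.
  by rewrite /K addrK; ring.
rewrite ler_piMl ?(ltW e0)// ler_pdivrMr// mul1r; lra.
Qed.

(** Here the potential is frozen at the fixed time t. The difference quotients of x -> u_t(F_x)
    converge pointwise and are dominated by a multiple of [flow_weight], so only the space
    derivative of u_t is involved. *)
Lemma flow_entropy_left a t : 0 <= a -> a < t -> t < 1 -> forall e, 0 < e ->
  exists N : nat, forall n, (N <= n)%N ->
    let t' := t - (t - a) / n.+2%:R in
    flow_entropy t - flow_entropy t' <=
    (\int[nu]_p (sigma t (Fl t p) * (p.1 / (2 * r t) - p.2 / (2 * s t))) + e) * (t - t').
Proof.
move=> a0 at_ t1 e e0.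
have t0 : 0 < t by apply: le_lt_trans at_.
have rt0 : 0 < r t by rewrite sqrtr_gt0.
have st0 : 0 < s t by exact: s_gt0.
pose t_ (n : nat) := t - (t - a) / n.+2%:R.
have tn n : [/\ a < t_ n, t_ n < t & 0 < t - t_ n].
  by have /andP[h1 h2] := left_seq_lt n at_; split; rewrite ?subr_gt0.
have tc : t_ n @[n --> \oo] --> t by exact: cvg_left_seq.
pose f p x := u t (Fl x p).
pose df (p : R * R) := sigma t (Fl t p) * (p.1 / (2 * r t) - p.2 / (2 * s t)).
have dfE p : is_derive t 1 (f p) (df p).
  have d1 : is_derive t 1 (fun x => r x) ((2 * r t)^-1) by exact: is_derive1_sqrt.
  have d2 : is_derive t 1 (fun x => s x) (- (2 * s t)^-1).
    have h' : is_derive (1 - t) 1 (@Num.sqrt R) ((2 * s t)^-1).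
      by apply: is_derive1_sqrt; rewrite subr_gt0.
    have := @is_derive1_comp _ (@Num.sqrt R) (fun x => 1 - x) t _ _ h' (is_derive_subl t).
    by rewrite mulrN1.
  have d3 : is_derive t 1 (fun x => Fl x p) (p.1 / (2 * r t) - p.2 / (2 * s t)).
    by apply: is_derive_eq; rewrite /GRing.scale/=; ring.
  exact: (@is_derive1_comp _ (u t) (fun x => Fl x p) t _ _ (du _ (ltW t0) t1) d3).
pose Q n p := (f p t - f p (t_ n)) / (t - t_ n).
have cQ p : Q n p @[n --> \oo] --> df p.
  apply: (@is_derive_seq _ (f p) t (df p) t_ (dfE p)) => //.
  by move=> n; have [_ h _] := tn n; rewrite lt_eqF.
pose C := 2 * (2 / (1 - t) + 1) * ((r t)^-1 + (s t)^-1).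
have QC n p : `|Q n p| <= C * flow_weight p.
  have [h1 h2 h3] := tn n.
  have tn0 : 0 <= t_ n by lra.
  rewrite /Q normrM normfV (gtr0_norm h3) ler_pdivrMr//.
  apply: le_trans (u_Fl_incr p (ltW t0) t1 (ltW t0) t1 tn0 (lt_trans h2 t1)) _.
  have W0 : 0 <= flow_weight p by apply: le_trans (flow_weight_ge1 p).
  rewrite (mulrAC C) ler_wpM2r// /C -[leRHS]mulrA ler_wpM2l//.
    by rewrite mulr_ge0// C_ge0.
  have /andP[e1 e2] := sqrt_incr tn0 (ltW h2) t0.
  have st1 : 0 < 1 - t by rewrite subr_gt0.
  have st2 : 1 - t <= 1 - t_ n by rewrite lerD2l lerN2 ltW.
  have /andP[e3 e4] := sqrt_incr' st1 st2.
  rewrite (ger0_norm e1) distrC (ger0_norm e3).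
  have -> : ((r t)^-1 + (s t)^-1) * (t - t_ n) =
    (t - t_ n) / r t + (1 - t_ n - (1 - t)) / s t by ring.
  exact: lerD.
have mQ n : measurable_fun [set: measurableTypeR R * measurableTypeR R] (Q n).
  have m1 := mu_ (ltW t0) t1.
  apply: measurable_funM; last exact: measurable_cst.
  by apply: measurable_funB; exact: (measurable_interpolation _ m1).
have mdf : measurable_fun [set: measurableTypeR R * measurableTypeR R] df.
  have ms := measurable_flow_score mu2 mu2_le1 st0 (r_le1 (ltW t0) t1).
  by apply: measurable_funM; [exact: (measurable_interpolation _ ms)|msr].
have lW := L1_flow_weight gaE mu2.
have cI := Rint_dominated_cvg mQ mdf cQ (L1Zl C lW) QC.
move/cvgrPdist_lt : cI => /(_ _ e0)[N _ hN].
exists N => n Nn /=; rewrite -/(t_ n).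
have [h1 h2 h3] := tn n.
have tn0 : 0 <= t_ n by lra.
have tn1 : t_ n < 1 by lra.
have l1 := L1_flow_log (ltW t0) t1 (ltW t0) t1.
have l2 := L1_flow_log (ltW t0) t1 tn0 tn1.
have g := Rint_flow_log_le (ltW t0) t1 tn0 tn1.
have := hN n Nn; rewrite /= -/df => hh.
have {}hh : \int[nu]_p Q n p <= \int[nu]_p df p + e.
  by move: hh; rewrite ltr_norml => /andP[? ?]; lra.
apply: (@le_trans _ _ (\int[nu]_p Q n p * (t - t_ n))); last first.
  by rewrite ler_wpM2r// ltW.
have -> : \int[nu]_p Q n p * (t - t_ n) = \int[nu]_p u t (Fl t p) - \int[nu]_p u t (Fl (t_ n) p).
  rewrite -(RintB l1 l2) -RintegralZr//.
    by apply: eq_Rintegral => p _; rewrite /Q divfK// gt_eqF.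
  by apply: (L1_dom (mQ n) _ (L1Zl C lW)) => p; exact: QC.
by rewrite {1}/flow_entropy lerD2l lerN2.
Qed.

End time_evolution.

Section power_bounds.
Context (R : realType).
Implicit Types (p y : R).

(** Convexity at 1 + |y|, the midpoint of 2 and 2 |y|. For p = 2 + eta the factor is 2^(1+eta),
    whose power 1/(1+eta) is the leading 2 of C_eta. *)
Lemma powR_norm1B_le p y : 1 <= p ->
  `|1 - y| `^ p <= 2 `^ (p - 1) * (1 + `|y| `^ p).
Proof.
move=> p1; have p0 : 0 <= p by apply: le_trans p1.
have h0 : 0 <= 2^-1 :> R by rewrite invr_ge0.
have h1 : 2^-1 <= 1 :> R by rewrite invf_le1// ler1n.
have y0 : 0 <= 2 * `|y| by rewrite mulr_ge0.
apply: (@le_trans _ _ ((1 + `|y|) `^ p)).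
  apply: ge0_ler_powR => //; first by rewrite nnegrE addr_ge0.
  by apply: le_trans (ler_normB _ _) _; rewrite normr1.
have := convex_powR p1 (Itv01 h0 h1) (x := 2) (y := 2 * `|y|).
rewrite !inE/= !in_itv/= !andbT => /(_ (ler0n _ _) y0).
rewrite [X in X `^ _ <= _ -> _]convRE convRE/= /unstable.onem.
have -> : 2^-1 * 2 + (1 - 2^-1) * (2 * `|y|) = 1 + `|y| by field.
move=> h; apply: le_trans h _.
rewrite powRM// (_ : 1 - 2^-1 = 2^-1); last by field.
rewrite powRD ?pnatr_eq0 ?implybT// powR_inv1//.
by rewrite le_eqVlt; apply/orP; left; apply/eqP; field.
Qed.

Lemma powR_expR_ln (a x : R) : 0 < a -> a `^ x = expR (x * ln a).
Proof. by move=> a0; rewrite /powR gt_eqF. Qed.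

End power_bounds.

(** * Integration of the two energy bounds *)

Section entropy_increments.
Context (R : realType).
Local Notation leb := (@lebesgue_measure R).
Variables (mu ga : probability (measurableTypeR R) R).
Hypothesis gaE : forall A, measurable A ->
  ga A = (\int[leb]_(x in A) (normal_pdf 0 1 x)%:E)%E.
Hypothesis mu2 : L1 mu (fun x => x ^+ 2).
Hypothesis mu2_le1 : \int[mu]_x (x ^+ 2) <= 1.
Variable tau : R -> R.
Hypothesis mtau : measurable_fun [set: measurableTypeR R] tau.
Hypothesis tau2 : L1 mu (fun x => tau x ^+ 2).
Hypothesis stein : forall g : R -> R, (forall x, derivable g x 1) ->
  continuous (derive1 g) -> L1 mu (fun x => x * g x) ->
  L1 mu (fun x => tau x * derive1 g x) ->
  \int[mu]_x (x * g x) = \int[mu]_x (tau x * derive1 g x).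
Local Notation nu := (mu \x ga)%E.
Local Notation r := (fun t : R => Num.sqrt t).
Local Notation s := (fun t : R => Num.sqrt (1 - t)).
Local Notation Fl := (fun t (p : R * R) => Num.sqrt t * p.1 + Num.sqrt (1 - t) * p.2).
Local Notation sigma := (fun t => flow_score mu (Num.sqrt t) (Num.sqrt (1 - t))).
Local Notation D := (flow_entropy mu ga).

Definition flow_energy t := \int[nu]_p (sigma t (Fl t p) * sigma t (Fl t p)).

Let rs t : 0 <= t -> t < 1 -> (r t) ^+ 2 + (s t) ^+ 2 = 1.
Proof. by move=> t0 t1; rewrite /= !sqr_sqrtr ?subr_ge0 ?(ltW t1)// addrC subrK. Qed.

(** Comparison principle: [left_dini_le] is applied to D - H, where H is a primitive of a bound on
    the dissipation. *)
Lemma flow_entropy_incr (H h : R -> R) a b : 0 <= a -> a <= b -> b < 1 ->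
  (forall t : R, t < 1 -> is_derive t 1 H (h t)) ->
  (forall t, 0 < t -> t < 1 -> flow_energy t / (2 * t) <= h t) ->
  D b - D a <= H b - H a.
Proof.
have sub4 (x1 x2 y1 y2 x y : R) : x1 - x2 <= x -> y <= y1 - y2 ->
    x1 - y1 - (x2 - y2) <= x - y by lra.
have add4 (x1 x2 y1 y2 e : R) : x1 <= x2 + e / 2 -> y2 <= y1 + e / 2 ->
    x1 - y1 <= x2 - y2 + e by lra.
move=> a0 ab b1 dH hh.
suff : D b - H b <= D a - H a.
  by move: (D b) (D a) (H b) (H a) => ? ? ? ? ?; lra.
apply: (@left_dini_le _ (fun t => D t - H t) a b ab).
  move=> t at_ tb e e0.
  have t0 : 0 < t by apply: le_lt_trans at_.
  have t1 : t < 1 by apply: le_lt_trans b1.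
  have e2 : 0 < e / 2 by rewrite divr_gt0.
  have [N1 hN1] := flow_entropy_left gaE mu2 mu2_le1 a0 at_ t1 e2.
  pose t_ n := t - (t - a) / n.+2%:R.
  have tn n : t_ n != t by have /andP[_ h2] := left_seq_lt n at_; rewrite lt_eqF.
  have := is_derive_seq (dH t t1) tn (@cvg_left_seq _ a t).
  move=> /cvgrPdist_lt /(_ _ e2)[N2 _ hN2].
  (* One index serves both limits, so that the increments of D and H are compared at the same point
     [t_ n]. *)
  pose n := maxn N1 N2.
  have {}hN1 := hN1 n (leq_maxl _ _).
  have {}hN2 := hN2 n (leq_maxr _ _).
  have /andP[h1 h2] := left_seq_lt n at_.
  exists (t_ n); first by rewrite (ltW h1) h2.
  move: hN1 hN2; rewrite /= -/(t_ n).
  rewrite (flow_dissipation gaE mu2 mu2_le1 mtau tau2 stein _ _ (rs (ltW t0) t1))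
    ?sqrtr_gt0 ?subr_gt0//.
  rewrite (sqr_sqrtr (ltW t0)) -/(flow_energy t) => hN1 hN2.
  have d0 : 0 < t - t_ n by rewrite subr_gt0.
  have hd : (h t - e / 2) * (t - t_ n) <= H t - H (t_ n).
    by rewrite -ler_pdivlMr//; move: hN2; rewrite ltr_distlC => /andP[/ltW].
  have he : (flow_energy t / (2 * t) + e / 2) * (t - t_ n) <= (h t + e / 2) * (t - t_ n).
    by rewrite ler_wpM2r ?(ltW d0)// lerD2r hh.
  have -> : e * (t - t_ n) = (h t + e / 2) * (t - t_ n) - (h t - e / 2) * (t - t_ n).
    by field.
  exact: sub4 (le_trans hN1 he) hd.
move=> t at_ tb e e0.
have t0 : 0 <= t by apply: le_trans at_.
have t1 : t < 1 by apply: lt_trans b1.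
have e2 : 0 < e / 2 by rewrite divr_gt0.
have [dl1 dl10 hdl1] := flow_entropy_right gaE mu2 mu2_le1 t0 t1 e2.
have cH : H x @[x --> t] --> H t.
  by apply: differentiable_continuous; apply/derivable1_diffP; have [] := dH t t1.
move: cH => /cvgrPdist_lt /(_ _ e2)[dl2 /= dl20 hdl2].
exists (Num.min dl1 dl2); first by rewrite lt_min dl10.
move=> x /andP[tx xdl] xb.
have x1 : x < t + dl1 by apply: lt_le_trans xdl _; rewrite lerD2l ge_min lexx.
have x2 : x < t + dl2 by apply: lt_le_trans xdl _; rewrite lerD2l ge_min lexx orbT.
have : ball_ Num.norm t dl2 x by rewrite /ball_/= ltr_norml; apply/andP; split; lra.
move=> /hdl2; rewrite ltr_distl => /andP[_ /ltW h2].
by apply: add4 h2; apply: hdl1; rewrite tx.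
Qed.

(** The energy bound gives the dissipation rate t Delta / (2 (1 - t)), integrated after replacing
    the numerator factor t by 1. *)
Lemma flow_entropy_le_ln t : 0 <= t -> t < 1 ->
  D t <= - (\int[mu]_x ((1 - tau x) ^+ 2) / 2 * ln (1 - t)).
Proof.
move=> t0 t1; set Delta := \int[mu]_x _.
have D0 : 0 <= Delta by apply: ge0_Rint => x; exact: sqr_ge0.
pose H x := - (Delta / 2 * ln (1 - x)).
pose h x := Delta / 2 * (1 - x)^-1.
have dH (x : R) : x < 1 -> is_derive x 1 H (h x).
  move=> x1.
  have d3 := is_derive_ln_subl x1.
  apply: is_derive_eq; rewrite /h /GRing.scale/=; ring.
have := @flow_entropy_incr H h 0 t (lexx _) t0 t1 dH.
rewrite (flow_entropy0 mu ga) subr0 {2}/H subr0 ln1 mulr0 oppr0 subr0; apply.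
move=> x x0 x1.
have sx0 : 0 < s x by rewrite sqrtr_gt0 subr_gt0.
have := energy_le_discrepancy gaE mu2 mu2_le1 mtau tau2 stein sx0 (rs (ltW x0) x1).
rewrite -/(flow_energy x) -/Delta (exprM _ 2 2) !sqr_sqrtr ?(ltW x0) ?subr_ge0 ?(ltW x1)// => hE.
have x1' : 0 < 1 - x by rewrite subr_gt0.
rewrite ler_pdivrMr ?mulr_gt0//; apply: le_trans hE _.
rewrite /h.
have -> : Delta / 2 * (1 - x)^-1 * (2 * x) = x * (1 - x)^-1 * Delta.
  by field; rewrite gt_eqF.
rewrite ler_wpM2r// ler_wpM2r ?invr_ge0 ?(ltW x1')// expr2 ler_piMr ?(ltW x0)// (ltW x1)//.
Qed.

Section interpolated_growth.
Variables (alpha kappa eta : R).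
Hypotheses (alpha0 : 0 < alpha) (kappa0 : 0 < kappa) (eta0 : 0 < eta).
Hypothesis tauM : L1 mu (fun x => `|tau x| `^ (2 + eta)).
Hypothesis tv : forall (t x : R) A, 0 < t -> t <= 1 -> measurable A ->
  `|fine (mu ((fun y => Num.sqrt t * y + Num.sqrt (1 - t) * x) @^-1` A)) - fine (mu A)|
  <= kappa * t^-1 * (1 - t) `^ alpha * (1 + `|x|).

(** The score has L^1 norm of order (1 - t)^(a - 1/2). Its bounded part E|Y| forces a <= 1/2, and 2
    a = 1 /\ 2 alpha. *)
Let a := Num.min 2^-1 alpha.
(** The power of 1 - t in the energy bound is (- (2 + eta)/2 + eta (a - 1/2)) / (1 + eta) = beta -
    1. *)
Let beta := a * eta / (1 + eta).
Let w := (\int[ga]_z (`|z| `^ (2 + eta))) *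
  (2 `^ (1 + eta) * (1 + \int[mu]_x (`|tau x| `^ (2 + eta)))).
(** This is C_eta, expressed through the laws of F and Z. *)
Let K := 2 * (4 * kappa + 4) `^ (eta / (eta + 1)) *
  (\int[ga]_z (`|z| `^ (2 + eta))) `^ (1 / (eta + 1)) *
  (1 + \int[mu]_x (`|tau x| `^ (2 + eta))) `^ (1 / (eta + 1)).

Let a_gt0 : 0 < a. Proof. by rewrite lt_min alpha0 invr_gt0 ltr0n. Qed.
Let beta_gt0 : 0 < beta. Proof. by rewrite divr_gt0 ?mulr_gt0// addr_gt0. Qed.

(** Needed to take logarithms. Either |z| <= 1/2 or z^2 <= (2 |z|)^eta z^2, so 1 = E[Z^2] <= 1/4 +
    2^eta E[|Z|^(2+eta)]. *)
Lemma gaussian_powR_gt0 : 0 < \int[ga]_z (`|z| `^ (2 + eta)).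
Proof.
have l : L1 ga (fun z => `|z| `^ (2 + eta)) by apply: L1_gaussian_powR => //; rewrite addr_gt0.
have [_ g2] := gaussian_moments gaE.
have : \int[ga]_z (z ^+ 2) <= \int[ga]_z (4^-1 + 2 `^ eta * `|z| `^ (2 + eta)).
  apply: le_Rint; [exact: L1_gaussian_sqr|exact: L1D (L1_cst ga 4^-1) (L1Zl _ l)|] => z.
  have P0 : 0 <= 2 `^ eta * `|z| `^ (2 + eta) by rewrite mulr_ge0 ?powR_ge0.
  rewrite -(real_normK (num_real z)).
  have [z2|z2] := leP `|z| 2^-1.
    by have := normr_ge0 z; nra.
  have z0 : 0 < `|z| by apply: lt_trans z2.
  have -> : 2 `^ eta * `|z| `^ (2 + eta) = (2 * `|z|) `^ eta * `|z| ^+ 2.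
    rewrite powRM// powRD ?(gt_eqF z0) ?implybT// -powR_mulrn; last exact: ltW.
    by rewrite -[2%:R]/2; ring.
  have h : 1 <= (2 * `|z|) `^ eta.
    have h2 : 1 <= 2 * `|z| by lra.
    by rewrite -[leLHS](powRr0 (2 * `|z|)); apply: ler_powR => //; exact: ltW.
  have := sqr_ge0 `|z|; nra.
rewrite g2 (RintD (L1_cst ga 4^-1) (L1Zl _ l)) Rint_cst (RintZl _ l).
have : 0 < 2 `^ eta :> R by rewrite powR_gt0.
nra.
Qed.


(** The total variation rate blows up as t -> 0, so it is combined with the trivial bound 1 on the
    noise term: b = min(1, 4 th) satisfies b = t b + (1 - t) b <= 4 kappa (1 - t)^alpha + (1 - t).
    Then b + s <= (4 kappa + 2) (1 - t)^a, within the stated constant. *)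
Lemma Rint_norm_score_tv t : 0 < t -> t < 1 ->
  \int[nu]_p `|sigma t (Fl t p)| <= (4 * kappa + 4) * (1 - t) `^ (a - 2^-1).
Proof.
move=> t0 t1.
have c0 : 0 < 1 - t by rewrite subr_gt0.
have c01 : 0 < 1 - t <= 1 by rewrite c0 gerBl ltW.
have s0 : 0 < s t by rewrite sqrtr_gt0.
pose v := (1 - t) `^ a.
have v0 : 0 < v by rewrite powR_gt0.
have sv : s t <= v by rewrite -powR12_sqrt ?(ltW c0)// ger_powR// ge_min lexx.
have tv1 : 1 - t <= v.
  rewrite -[leLHS](powRr1 (ltW c0)) ger_powR// ge_min; apply/orP; left.
  by rewrite invf_le1// ler1n.
have av : (1 - t) `^ alpha <= v by rewrite ger_powR// ge_min lexx orbT.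
pose th := kappa * t^-1 * (1 - t) `^ alpha.
have th0 : 0 <= th by rewrite !mulr_ge0 ?invr_ge0 ?powR_ge0// ltW.
have tth : t * (4 * th) <= 4 * kappa * v.
  have -> : t * (4 * th) = 4 * kappa * (1 - t) `^ alpha.
    by rewrite /th; field; rewrite gt_eqF.
  by rewrite ler_wpM2l// mulr_ge0// ltW.
pose b := Num.min 1 (4 * th).
have bv : b <= (4 * kappa + 1) * v.
  rewrite mulrDl mul1r /b; have [x1|x1] := leP 1 (4 * th).
    have : t * 1 <= t * (4 * th) by rewrite ler_wpM2l// ltW.
    by move: tth tv1; rewrite mulr1; lra.
  have : (1 - t) * (4 * th) <= (1 - t) * 1 by rewrite ler_wpM2l ?(ltW c0)// ltW.
  by move: tth tv1; lra.
have hb (g : R -> R) : measurable_fun [set: measurableTypeR R] g ->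
    (forall y, `|g y| <= 1) -> `|\int[nu]_p (p.2 * g (Fl t p))| <= b.
  move=> mg hg; rewrite le_min (Rint_flow_noise_le1 mu gaE _ _ mg hg)/=.
  apply: (Rint_flow_noise gaE th0 _ mg hg) => x A mA.
  exact: tv t0 (ltW t1) mA.
have := Rint_norm_score_le gaE mu2 mu2_le1 s0 (rs (ltW t0) t1) hb.
move=> /le_trans; apply.
have -> : (1 - t) `^ (a - 2^-1) = (s t)^-1 * v.
  rewrite powRD ?(gt_eqF c0) ?implybT// powRN (powR12_sqrt (ltW c0)) mulrC//.
rewrite mulrCA (_ : _ + 1 = (s t)^-1 * (b + s t)); last by rewrite mulrDr mulVf ?gt_eqF.
rewrite ler_wpM2l ?invr_ge0 ?(ltW s0)//.
have kv : 0 <= kappa * v by rewrite mulr_ge0// ltW.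
by move: bv sv kv (ltW v0); rewrite !mulrDl; lra.
Qed.

Lemma flow_energy_le_expR t : 0 < t -> t < 1 ->
  flow_energy t / (2 * t) <= K / 2 * (expR (beta * ln (1 - t)) / (1 - t)).
Proof.
move=> t0 t1.
have c0 : 0 < 1 - t by rewrite subr_gt0.
have s0 : 0 < s t by rewrite sqrtr_gt0.
have r0 : 0 < r t by rewrite sqrtr_gt0.
have p0 : 0 < 2 + eta by rewrite addr_gt0.
have p1 : 1 <= 2 + eta by move: eta0; lra.
have Z0 := gaussian_powR_gt0.
have lZ : L1 ga (fun z => `|z| `^ (2 + eta)) by exact: L1_gaussian_powR.
set EZ := \int[ga]_z _ in Z0 *.
set ET := \int[mu]_x (`|tau x| `^ (2 + eta)).
have ET0 : 0 <= ET by apply: ge0_Rint => x; exact: powR_ge0.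
have M0 : 0 < 1 + ET by rewrite ltr_pwDl.
have w0 : 0 < w by rewrite mulr_gt0// mulr_gt0// powR_gt0.
have hM x : `|1 - tau x| `^ (2 + eta) <= 2 `^ (1 + eta) * (1 + `|tau x| `^ (2 + eta)).
  by have := powR_norm1B_le (tau x) p1; rewrite (_ : 2 + eta - 1 = 1 + eta); last by lra.
have l1 := L1Zl (2 `^ (1 + eta)) (L1D (L1_cst mu 1) tauM).
have lM : L1 mu (fun x => `|1 - tau x| `^ (2 + eta)).
  apply: L1_dom l1; first by msr.
  by move=> x; rewrite ger0_norm ?powR_ge0//; exact: hM.
have iM : \int[mu]_x `|1 - tau x| `^ (2 + eta) <= 2 `^ (1 + eta) * (1 + ET).
  rewrite (_ : 1 + ET = \int[mu]_x (1 + `|tau x| `^ (2 + eta))); last first.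
    by rewrite (RintD (L1_cst mu 1) tauM) Rint_cst.
  rewrite -(RintZl _ (L1D (L1_cst mu 1) tauM)).
  by apply: le_Rint => // x; exact: hM.
have fE : (fun p : R * R => (`|1 - tau p.1| * `|p.2|) `^ (2 + eta)) =
    (fun p => `|1 - tau p.1| `^ (2 + eta) * `|p.2| `^ (2 + eta)).
  by apply/funext => p; rewrite powRM.
have lp : L1 nu (fun p => (`|1 - tau p.1| * `|p.2|) `^ (2 + eta)).
  by rewrite fE; exact: (L1_prod lM lZ).
have ip : \int[nu]_p ((`|1 - tau p.1| * `|p.2|) `^ (2 + eta)) <= w.
  rewrite fE (Rint_prod lM lZ) mulrC; apply: ler_wpM2l iM; exact: ltW.
pose m := (4 * kappa + 4) * (1 - t) `^ (a - 2^-1).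
have k0 : 0 < 4 * kappa + 4 by move: kappa0; lra.
have m0 : 0 < m by rewrite mulr_gt0// powR_gt0.
have := energy_le_interpolation gaE mu2 mu2_le1 mtau tau2 stein r0 s0
  (rs (ltW t0) t1) eta0 w0 m0 lp ip (Rint_norm_score_tv t0 t1).
rewrite -/(flow_energy t) (sqr_sqrtr (ltW t0)) => hS.
rewrite ler_pdivrMr ?mulr_gt0//; apply: le_trans hS _.
rewrite -(powR12_sqrt (ltW c0)) ln_div ?posrE ?powR_gt0// ln_powR.
rewrite /w lnM ?posrE ?mulr_gt0 ?powR_gt0// lnM ?posrE ?powR_gt0// ln_powR.
rewrite /m lnM ?posrE ?powR_gt0// ln_powR.
have -> : K / 2 * (expR (beta * ln (1 - t)) / (1 - t)) * (2 * t) =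
    expR (ln 2 + eta / (eta + 1) * ln (4 * kappa + 4) + 1 / (eta + 1) * ln EZ +
      1 / (eta + 1) * ln (1 + ET) + beta * ln (1 - t) - ln (1 - t) + ln t).
  rewrite !expRD expRN !lnK ?posrE//.
  rewrite /K -/EZ -/ET !powR_expR_ln//.
  by field; rewrite gt_eqF.
rewrite ler_expR.
have lnt : ln t <= 0 by apply: ln_le0; exact: ltW.
have e1 : 0 < 1 + eta by rewrite addr_gt0.
rewrite -subr_ge0.
set L := ln (1 - t); set L2 := ln 2; set Lk := ln _; set LZ := ln EZ; set LE := ln (1 + _).
(* The two exponents differ only in the power of t: (2 + eta)/(1 + eta) for the energy, 1 on the
   right, and t < 1. *)
rewrite (_ : _ - _ = - (ln t / (1 + eta))); last first.
  by rewrite /beta (addrC eta 1); field; rewrite gt_eqF.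
by rewrite oppr_ge0 pmulr_lle0// invr_gt0.
Qed.

Lemma flow_entropy_tail t0 t : 0 <= t0 -> t0 <= t -> t < 1 ->
  D t - D t0 <= K / (2 * beta) * expR (beta * ln (1 - t0)).
Proof.
move=> t00 t0t t1.
pose H x := - (K / (2 * beta) * expR (beta * ln (1 - x))).
pose h x := K / 2 * (expR (beta * ln (1 - x)) / (1 - x)).
have dH (x : R) : x < 1 -> is_derive x 1 H (h x).
  move=> x1.
  have d3 := is_derive_ln_subl x1.
  have d4 : is_derive x 1 (fun y => beta * ln (1 - y)) (beta * - (1 - x)^-1).
    by apply: is_derive_eq; rewrite /GRing.scale/=; ring.
  have d5 := @is_derive1_comp _ (@expR R) (fun y => beta * ln (1 - y)) x _ _ (is_derive_expR _) d4.
  apply: is_derive_eq; rewrite /h /GRing.scale/=; field.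
  by rewrite !gt_eqF ?subr_gt0.
have hh x : 0 < x -> x < 1 -> flow_energy x / (2 * x) <= h x by exact: flow_energy_le_expR.
apply: le_trans (flow_entropy_incr t00 t0t t1 dH hh) _.
rewrite /H opprK addrC gerBl mulr_ge0 ?expR_ge0//.
by apply: divr_ge0; [rewrite !mulr_ge0 ?powR_ge0|rewrite mulr_ge0// (ltW beta_gt0)].
Qed.

(* The two bounds on the growth of the entropy are switched at
   [1 - t = Delta ^ (1 / beta)]. *)
Lemma flow_entropy_le t : \int[mu]_x ((1 - tau x) ^+ 2) <= 1 -> 0 <= t -> t < 1 ->
  D t <= (eta + 1) / (Num.min 1 (2 * alpha) * eta) * \int[mu]_x ((1 - tau x) ^+ 2) *
    `|ln (\int[mu]_x ((1 - tau x) ^+ 2))| +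
   K * (eta + 1) / (Num.min 1 (2 * alpha) * eta) * \int[mu]_x ((1 - tau x) ^+ 2).
Proof.
have D0 : 0 <= \int[mu]_x ((1 - tau x) ^+ 2) by apply: ge0_Rint => x; exact: sqr_ge0.
have := flow_entropy_le_ln.
set Delta := \int[mu]_x _ in D0 * => hln D1 t0 t1.
have K0 : 0 <= K by rewrite !mulr_ge0 ?powR_ge0.
have -> : Num.min 1 (2 * alpha) = 2 * a by rewrite minr_pMr// mulfV.
have e1 : 0 < eta + 1 by rewrite addr_gt0.
have bE : (eta + 1) / (2 * a * eta) = (2 * beta)^-1.
  by rewrite /beta; field; rewrite (addrC 1) !gt_eqF.
rewrite -(mulrA K) bE.
(* Without a positive Delta there is no switching time, but the logarithmic bound alone then gives
   D(t) <= 0. *)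
have [DE|Dn0] := eqVneq Delta 0.
  by have := hln t t0 t1; rewrite DE !(mul0r, mulr0) oppr0 addr0.
have Dp : 0 < Delta by rewrite lt_neqAle eq_sym Dn0.
have lD : ln Delta <= 0 by exact: ln_le0.
rewrite (ler0_norm lD).
pose eps := expR (ln Delta / beta).
have eps0 : 0 < eps by exact: expR_gt0.
have eps1 : eps <= 1 by rewrite -[leRHS]expR0 ler_expR pmulr_lle0// invr_gt0.
have hE : - (Delta / 2 * ln eps) = (2 * beta)^-1 * Delta * - ln Delta.
  by rewrite /eps expRK; field; rewrite gt_eqF.
have T0 : 0 <= K / (2 * beta) * Delta.
  by rewrite mulr_ge0// divr_ge0// mulr_ge0// ltW.
have [tE|tE] := leP t (1 - eps).
  apply: le_trans (hln t t0 t1) _; rewrite -hE.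
  apply: (@le_trans _ _ (- (Delta / 2 * ln eps))); last by rewrite lerDl.
  rewrite lerN2 ler_wpM2l ?divr_ge0// ler_ln ?posrE// ?subr_gt0//; lra.
have t00 : 0 <= 1 - eps by rewrite subr_ge0.
have t01 : 1 - eps < 1 by rewrite gtrBl.
have h1 := hln _ t00 t01; have h2 := flow_entropy_tail t00 (ltW tE) t1.
have E1 : 1 - (1 - eps) = eps by ring.
have E2 : expR (beta * ln eps) = Delta.
  by rewrite /eps expRK mulrC divfK ?gt_eqF// lnK.
rewrite E1 hE in h1; rewrite E1 E2 in h2.
by rewrite lerBlDr in h2; apply: le_trans h2 _; rewrite [leRHS]addrC lerD2l.
Qed.

End interpolated_growth.
End entropy_increments.

(** * The limit t -> 1 *)

Section entropy_limit.
Context (R : realType).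
Local Notation leb := (@lebesgue_measure R).
Variables (mu ga : probability (measurableTypeR R) R).
Hypothesis gaE : forall A, measurable A ->
  ga A = (\int[leb]_(x in A) (normal_pdf 0 1 x)%:E)%E.
Hypothesis mu2 : L1 mu (fun x => x ^+ 2).
Hypothesis mu2_le1 : \int[mu]_x (x ^+ 2) <= 1.
Local Notation nu := (mu \x ga)%E.
Local Notation Fl := (fun t (p : R * R) => Num.sqrt t * p.1 + Num.sqrt (1 - t) * p.2).
Variables (alpha kappa : R).
Hypotheses (alpha0 : 0 < alpha) (kappa0 : 0 < kappa).
Hypothesis tv : forall (t x : R) A, 0 < t -> t <= 1 -> measurable A ->
  `|fine (mu ((fun y => Num.sqrt t * y + Num.sqrt (1 - t) * x) @^-1` A)) - fine (mu A)|
  <= kappa * t^-1 * (1 - t) `^ alpha * (1 + `|x|).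
Variable B : R.
Hypothesis entropy_le : forall t, 0 <= t -> t < 1 -> flow_entropy mu ga t <= B.

(** Gibbs' inequality against the unnormalised density exp(g) phi, of total mass E[exp g(Z)]. *)
Lemma Rint_flow_gibbs (g : R -> R) (M t : R) :
  measurable_fun [set: measurableTypeR R] g -> (forall y, `|g y| <= M) ->
  0 <= t -> t < 1 ->
  \int[nu]_p g (Fl t p) <= flow_entropy mu ga t + \int[ga]_y expR (g y) - 1.
Proof.
move=> mg hg t0 t1.
have s0 : 0 < Num.sqrt (1 - t) by rewrite sqrtr_gt0 subr_gt0.
have s1 : Num.sqrt (1 - t) <= 1 by rewrite -[leRHS]sqrtr1 ler_wsqrtr// gerBl.
have r1 : (Num.sqrt t) ^+ 2 <= 1 by rewrite sqr_sqrtr// ltW.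
have q0 y := flow_density_gt0 mu2 mu2_le1 s0 r1 y.
have me : measurable_fun [set: measurableTypeR R] (fun y => expR (g y)).
  exact: measurableT_comp.
have le : L1 ga (fun y => expR (g y)).
  apply: L1_dom (L1_cst ga (expR M)) => // y.
  by rewrite ger0_norm ?expR_ge0// ler_expR; have := hg y; rewrite ler_norml => /andP[].
have mw : measurable_fun [set: measurableTypeR R] (fun y => expR (g y) * normal_pdf 0 1 y).
  by apply: measurable_funM => //; exact: measurable_normal_pdf.
have w0 y : 0 < expR (g y) * normal_pdf 0 1 y.
  by rewrite mulr_gt0 ?expR_gt0// normal_pdf01_gt0.
have wE : (\int[leb]_y (expR (g y) * normal_pdf 0 1 y)%:E = (\int[ga]_y expR (g y))%:E)%E.
  rewrite -(fin_Rintegral le).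
  rewrite (@ge0_integral_density _ (measurableTypeR R) _ _ _ _ (measurable_normal_pdf 0 1)
    gaE (EFin \o (fun y => expR (g y))))//; first exact/measurable_EFinP.
  by move=> y; rewrite lee_fin expR_ge0.
have E y : ln (expR (g y) * normal_pdf 0 1 y / flow_density mu (Num.sqrt t) (Num.sqrt (1 - t)) y) =
    g y - flow_log mu (Num.sqrt t) (Num.sqrt (1 - t)) y.
  rewrite /flow_log !ln_div ?lnM ?posrE ?mulr_gt0 ?expR_gt0 ?normal_pdf01_gt0//; try exact: q0.
  by rewrite expRK opprB addrA.
have lg : L1 nu (fun p => g (Fl t p)).
  by apply: L1_dom (L1_cst nu M) => //; exact: measurable_interpolation.
have lu := L1_flow_log gaE mu2 mu2_le1 t0 t1 t0 t1.
have := @Rint_ln_ratio_le _ mu ga gaE mu2 mu2_le1 (Num.sqrt t) (Num.sqrt (1 - t)) s0 r1 _ _ mw w0 wE.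
have -> : (fun p : R * R => ln (expR (g (Fl t p)) * normal_pdf 0 1 (Fl t p) /
    flow_density mu (Num.sqrt t) (Num.sqrt (1 - t)) (Fl t p))) =
    (fun p => g (Fl t p) - flow_log mu (Num.sqrt t) (Num.sqrt (1 - t)) (Fl t p)).
  by apply/funext => p; rewrite E.
move=> /(_ (L1B lg lu)); rewrite (RintB lg lu) lerBlDr => h.
by apply: le_trans h _; rewrite -[leRHS]addrA [leRHS]addrC.
Qed.

Lemma tv_rate_small (e : R) : 0 < e ->
  exists t, [/\ 0 < t, t < 1 & kappa * t^-1 * (1 - t) `^ alpha <= e].
Proof.
move=> e0.
pose c := e / (2 * kappa).
have c0 : 0 < c by rewrite divr_gt0// mulr_gt0.
(* The first entry bounds t^-1 by 2, the factor anticipated in [c]; the second is c^(1/alpha). *)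
pose d := Num.min 2^-1 (expR (ln c / alpha)).
have d0 : 0 < d by rewrite lt_min expR_gt0 invr_gt0 ltr0n.
have d2 : d <= 2^-1 by rewrite ge_min lexx.
exists (1 - d); split; [lra|by rewrite gtrBl|].
have -> : 1 - (1 - d) = d by ring.
have h1 : d `^ alpha <= c.
  rewrite powR_expR_ln// -[leRHS](lnK (c0 : c \is Num.pos)) ler_expR.
  rewrite mulrC -ler_pdivlMr// -ler_expR lnK//.
  by rewrite ge_min lexx orbT.
have h2 : (1 - d)^-1 <= 2.
  rewrite -[leRHS]invrK lef_pV2 ?posrE ?invr_gt0//; lra.
apply: (@le_trans _ _ (kappa * 2 * c)).
  apply: ler_pM => //; first by rewrite mulr_ge0 ?invr_ge0 ?(ltW kappa0)//; lra.
    exact: powR_ge0.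
  by rewrite ler_wpM2l ?(ltW kappa0).
rewrite le_eqVlt; apply/orP; left; apply/eqP; rewrite /c; field.
by rewrite gt_eqF.
Qed.

Lemma Rint_gibbs (g : R -> R) (M : R) : 0 < M ->
  measurable_fun [set: measurableTypeR R] g -> (forall y, `|g y| <= M) ->
  \int[mu]_y g y <= B + \int[ga]_y expR (g y) - 1.
Proof.
move=> M0 mg hg; apply/ler_addgt0Pr => e e0.
(* The factor [M] undoes the rescaling of [g] to sup norm 1, and 4 is the constant of
   [Rint_flow_close]. *)
have e1 : 0 < e / (4 * M) by rewrite divr_gt0// mulr_gt0.
have [t [t0 t1 ht]] := tv_rate_small e1.
have h1 := Rint_flow_gibbs mg hg (ltW t0) t1.
have h2 := entropy_le (ltW t0) t1.
pose k y := M^-1 * g y.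
have mk : measurable_fun [set: measurableTypeR R] k by exact: measurable_funM.
have hk y : `|k y| <= 1.
  by rewrite /k normrM gtr0_norm ?invr_gt0// ler_pdivrMl// mulr1.
have th0 : 0 <= kappa * t^-1 * (1 - t) `^ alpha.
  by rewrite !mulr_ge0 ?invr_ge0 ?powR_ge0// ltW.
have h3 := Rint_flow_close gaE th0 (fun x A mA => tv x t0 (ltW t1) mA) mk hk.
have lg : L1 nu (fun p => g (Fl t p)).
  by apply: L1_dom (L1_cst nu M) => //; exact: measurable_interpolation.
have lg' : L1 mu g by apply: L1_dom (L1_cst mu M).
rewrite (RintZl _ lg) (RintZl _ lg') -mulrBr normrM gtr0_norm ?invr_gt0// in h3.
rewrite ler_pdivrMl// in h3.
have {}h3 : \int[mu]_y g y <= \int[nu]_p g (Fl t p) + e.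
  rewrite -lerBlDl; apply: le_trans (ler_norm _) _; rewrite distrC; apply: le_trans h3 _.
  apply: (@le_trans _ _ (M * (4 * (e / (4 * M))))); first by rewrite !ler_wpM2l ?(ltW M0).
  by rewrite le_eqVlt; apply/orP; left; apply/eqP; field; rewrite gt_eqF.
apply: le_trans h3 _; rewrite lerD2r; apply: le_trans h1 _.
by rewrite !lerD2r.
Qed.

Variable f : R -> R.
Hypothesis mf : measurable_fun [set: measurableTypeR R] f.
Hypothesis f0 : forall x, 0 <= f x.
Hypothesis fE : forall A, measurable A -> mu A = (\int[leb]_(x in A) (f x)%:E)%E.

Lemma ge0_Rint_density (g : R -> R) : measurable_fun [set: measurableTypeR R] g ->
  (forall x, 0 <= g x) -> L1 mu g ->
  L1 leb (fun x : measurableTypeR R => g x * f x) /\ \int[leb]_x (g x * f x) = \int[mu]_x g x.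
Proof.
move=> mg g0 lg.
have E : (\int[leb]_x (g x * f x)%:E = (\int[mu]_x g x)%:E)%E.
  rewrite -(fin_Rintegral lg).
  by rewrite (ge0_integral_density mf fE (g := EFin \o g)); [|exact/measurable_EFinP|].
split; last by rewrite {1}/Rintegral E.
apply: L1_lt_pinfty; [by move=> x; rewrite mulr_ge0|exact: measurable_funM|].
by rewrite E ltry.
Qed.

Lemma Rint_density (g : R -> R) (M : R) : measurable_fun [set: measurableTypeR R] g ->
  (forall y, `|g y| <= M) ->
  L1 leb (fun x : measurableTypeR R => g x * f x) /\ \int[leb]_x (g x * f x) = \int[mu]_x g x.
Proof.
move=> mg hg.
have lg : L1 mu g by apply: L1_dom (L1_cst mu M).
have [|x||l1 e1] := @ge0_Rint_density (fun x => g x + M).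
- by apply: measurable_funD => //; exact: measurable_cst.
- by have := hg x; rewrite ler_norml => /andP[h _]; rewrite -lerBlDr sub0r.
- exact: L1D (L1_cst mu M).
have M0 : 0 <= M by apply: le_trans (hg 0).
have [|x||l2 e2] := @ge0_Rint_density (fun=> M).
- exact: measurable_cst.
- by [].
- exact: L1_cst.
have E : (fun x => g x * f x) = (fun x => (g x + M) * f x - M * f x).
  by apply/funext => x; ring.
rewrite E; split; first exact: L1B.
by rewrite (RintB l1 l2) e1 e2 (RintD lg (L1_cst mu M)) Rint_cst addrK.
Qed.

Let phi := normal_pdf (0 : R) 1.

Let phi0 x : 0 < phi x. Proof. exact: normal_pdf01_gt0. Qed.

Let Lphi : L1 leb phi /\ \int[leb]_x phi x = 1.
Proof.
have m1 : measurable_fun [set: measurableTypeR R] (fun=> 1 : R) by exact: measurable_cst.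
have E : (\int[leb]_x (phi x)%:E = 1)%E by rewrite -gaE// probability_setT.
split; last by rewrite /Rintegral E.
apply: L1_lt_pinfty; [by move=> x; exact: ltW|exact: measurable_normal_pdf|].
by rewrite E ltry.
Qed.

(* The truncation takes the value [- n], not [ln 0 = 0], where [f] vanishes. *)
Definition clamped_log_ratio (n : nat) (x : R) : R :=
  if f x == 0 then - n%:R else Num.max (- n%:R) (Num.min n%:R (ln (f x / phi x))).
Local Notation g_ := clamped_log_ratio.

(** ln x <= x - 1 at phi/f gives f ln(f/phi) >= f - phi. Adding phi therefore makes the integrand
    nonnegative, as Fatou's lemma requires. *)
Let log_ratio_lower x : - phi x <= f x * ln (f x / phi x).
Proof.
have [->|fn0] := eqVneq (f x) 0; first by rewrite mul0r oppr_le0 ltW.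
have fx0 : 0 < f x by rewrite lt_neqAle eq_sym fn0 f0.
rewrite -[f x / phi x]invrK invf_div lnV ?posrE ?divr_gt0// mulrN lerN2.
have h : ln (phi x / f x) <= phi x / f x - 1.
  have -> : phi x / f x = 1 + (phi x / f x - 1) by ring.
  rewrite {2}(addrC 1) addrK; apply: le_ln1Dx; rewrite ltrBrDl subrr divr_gt0//.
apply: le_trans (ler_wpM2l (ltW fx0) h) _.
by rewrite mulrBr mulrCA divff// !mulr1 gerBl.
Qed.

Let mlr : measurable_fun [set: measurableTypeR R] (fun x => ln (f x / phi x)).
Proof.
apply: measurableT_comp; first exact: measurable_ln.
apply: measurable_funM => //.
apply: continuous_measurable_fun => y.
by apply: cvgV; [rewrite gt_eqF|exact: continuous_normal_pdf].
Qed.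

Let mg n : measurable_fun [set: measurableTypeR R] (g_ n).
Proof.
apply: measurable_fun_ifT.
- by apply: measurable_fun_eqr => //; exact: measurable_cst.
- exact: measurable_cst.
- apply: measurable_maxr; first exact: measurable_cst.
  by apply: measurable_minr => //; exact: measurable_cst.
Qed.

(** The bound [n.+1] instead of [n] is positive at n = 0 too, as [Rint_gibbs] requires of its bound
    [M]. *)
Let hg n x : `|g_ n x| <= n.+1%:R.
Proof.
have n0 : (0 : R) <= n%:R by [].
have n1 : n.+1%:R = n%:R + 1 :> R by rewrite natr1.
rewrite /g_ n1; case: ifP => _.
  by rewrite normrN ger0_norm//; lra.
rewrite ler_norml; apply/andP; split.
  by rewrite le_max; apply/orP; left; lra.
by rewrite ge_max ge_min; apply/andP; split; [lra|apply/orP; left; lra].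
Qed.

Let g_lower n x : - phi x <= g_ n x * f x.
Proof.
have n0 : (0 : R) <= n%:R by [].
rewrite /g_; have [->|fn0] := eqVneq (f x) 0; first by rewrite mulr0 oppr_le0 ltW.
have := log_ratio_lower x; have := phi0 x; have := f0 x.
rewrite mulrC; set l := ln _ => h1 h2 h3.
have [h|h] := leP (Num.min n%:R l) (- n%:R).
  move: h; rewrite ge_min => /orP[h|h]; last by apply: le_trans h3 _; rewrite ler_wpM2r.
  apply: (@le_trans _ _ 0); first by rewrite oppr_le0 ltW.
  by rewrite mulr_ge0// (le_trans n0).
have [h'|h'] := leP n%:R l; last by [].
apply: (@le_trans _ _ 0); first by rewrite oppr_le0 ltW.
exact: mulr_ge0.
Qed.

(** Pointwise exp(g_n) <= exp(-n) + f/phi, and f/phi has Gaussian integral 1. Where f vanishes only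
    exp(-n) remains; a truncation equal to 0 there would contribute the whole Gaussian mass of that
    set. *)
Let g_exp n : \int[ga]_y expR (g_ n y) <= expR (- n%:R) + 1.
Proof.
have mexp : measurable_fun [set: measurableTypeR R] (fun y => expR (g_ n y)).
  exact: measurableT_comp.
have mfp : measurable_fun [set: measurableTypeR R] (fun y => f y / phi y).
  apply: measurable_funM => //.
  apply: continuous_measurable_fun => y.
  by apply: cvgV; [rewrite gt_eqF|exact: continuous_normal_pdf].
have fp0 y : 0 <= f y / phi y by rewrite divr_ge0// ltW.
have E : (\int[ga]_y (f y / phi y)%:E = 1)%E.
  rewrite (@ge0_integral_density _ (measurableTypeR R) _ _ _ _ (measurable_normal_pdf 0 1)
    gaE (EFin \o (fun y => f y / phi y))).
  - have := fE measurableT; rewrite probability_setT => ->.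
    by apply: eq_integral => y _; rewrite /= -EFinM divfK// gt_eqF.
  - exact/measurable_EFinP.
  - by move=> y; rewrite lee_fin.
have lfp : L1 ga (fun y => f y / phi y) by apply: L1_lt_pinfty => //; rewrite E ltry.
have e1 : \int[ga]_y (f y / phi y) = 1 by rewrite /Rintegral E.
have lexp : L1 ga (fun y => expR (g_ n y)).
  apply: L1_dom (L1_cst ga (expR n.+1%:R)) => // y.
  by rewrite ger0_norm ?expR_ge0// ler_expR; have := hg n y; rewrite ler_norml => /andP[].
rewrite -[leRHS](_ : \int[ga]_y (expR (- n%:R) + f y / phi y) = _); last first.
  by rewrite (RintD (L1_cst ga _) lfp) Rint_cst e1.
apply: le_Rint => //; first exact: L1D (L1_cst ga _) lfp.
move=> y; rewrite /g_; have [fy|fn0] := eqVneq (f y) 0; first by rewrite fy mul0r addr0.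
have fy0 : 0 < f y by rewrite lt_neqAle eq_sym fn0 f0.
rewrite /Num.max; case: ifP => _; last by rewrite lerDl.
apply: ler_wpDl; first exact: expR_ge0.
rewrite -[leRHS]lnK ?posrE ?divr_gt0// ler_expR.
by rewrite ge_min lexx orbT.
Qed.

Lemma Rint_clamped_le n :
  (\int[leb]_x (g_ n x * f x + phi x)%:E <= (B + 1 + expR (- n%:R))%:E)%E.
Proof.
have [l1 e1] := Rint_density (mg n) (hg n).
have [l2 e2] := Lphi.
rewrite (fin_Rintegral (L1D l1 l2)) (RintD l1 l2) e1 e2 lee_fin.
have := Rint_gibbs (ltr0Sn _ n) (mg n) (hg n); have := g_exp n.
set X := \int[mu]_x _; set Y := \int[ga]_y _; set e := expR _.
by move=> h1 h2; lra.
Qed.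

Lemma cvg_clamped x : g_ n x * f x @[n --> \oo] --> f x * ln (f x / phi x).
Proof.
have [fx|fn0] := eqVneq (f x) 0.
  by rewrite fx mul0r; under eq_cvg do rewrite mulr0; exact: cvg_cst.
rewrite mulrC; apply: cvgM; last exact: cvg_cst.
apply: cvg_near_cst; set l := ln _.
have [N hN] : exists N : nat, `|l| <= N%:R.
  by exists (Num.truncn `|l|).+1; rewrite ltW// truncnS_gt.
exists N => // n /= Nn.
have {}hN : `|l| <= n%:R by apply: le_trans hN _; rewrite ler_nat.
rewrite /g_ (negbTE fn0) -/l; move: hN; rewrite ler_norml => /andP[h1 h2].
by rewrite (min_idPr h2) (max_idPr h1).
Qed.

(** Fatou's lemma for g_n f + phi bounds the integral of f ln(f/phi) + phi by B + 1. This bound also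
    provides the integrability that allows the unit mass of phi to be subtracted. *)
Lemma relative_entropy_le : (relative_entropy f <= B%:E)%E.
Proof.
have [l2 e2] := Lphi.
have ml : measurable_fun [set: measurableTypeR R] (fun x => f x * ln (f x / phi x)).
  exact: measurable_funM.
have mp : measurable_fun [set: measurableTypeR R] phi by exact: measurable_normal_pdf.
have p0 x : 0 <= f x * ln (f x / phi x) + phi x.
  by rewrite -lerBlDr sub0r; exact: log_ratio_lower.
have I : (\int[leb]_x (f x * ln (f x / phi x) + phi x)%:E <= (B + 1)%:E)%E.
  pose G n x := (g_ n x * f x + phi x)%:E.
  have mG n : measurable_fun [set: measurableTypeR R] (G n).
    by apply/measurable_EFinP; apply: measurable_funD => //; exact: measurable_funM.
  have G0 n x : [set: measurableTypeR R] x -> (0 <= G n x)%E.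
    by move=> _; rewrite lee_fin -lerBlDr sub0r; exact: g_lower.
  have := fatou leb measurableT mG G0.
  have -> : (\int[leb]_x limn_einf (G^~ x) =
      \int[leb]_x (f x * ln (f x / phi x) + phi x)%:E)%E.
    apply: eq_integral => x _.
    have c : (G n x @[n --> \oo] --> (f x * ln (f x / phi x) + phi x)%:E)%E.
      apply: cvg_EFin; first exact: nearW.
      by apply: cvgD; [exact: cvg_clamped|exact: cvg_cst].
    by have [-> _] := cvg_limn_einf_sup c.
  move=> h; apply: le_trans h _; rewrite limn_einf_lim.
  have c : ((B + 1 + expR (- n%:R))%:E @[n --> \oo] --> (B + 1)%:E)%E.
    apply: cvg_EFin; first exact: nearW.
    rewrite -[X in _ --> X]addr0; apply: cvgD; first exact: cvg_cst.
    rewrite (_ : (fun n => _) = (fun n => (expR (-1)) ^+ n)).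
      by apply: cvg_expr; rewrite ger0_norm ?expR_ge0// expR_lt1.
    by apply/funext => n; rewrite -expRM_natr mulN1r.
  rewrite -(cvg_lim _ c)//; apply: lee_lim; first exact: is_cvg_einfs.
    by apply/cvg_ex; eexists; exact: c.
  apply: nearW => n; apply: le_trans (Rint_clamped_le n).
  by apply: ereal_inf_lbound; exists n => /=.
have lS : L1 leb (fun x : measurableTypeR R => f x * ln (f x / phi x) + phi x).
  apply: L1_lt_pinfty => //; first exact: measurable_funD.
  by apply: le_lt_trans I _; rewrite ltry.
rewrite (fin_Rintegral lS) lee_fin in I.
have E : (fun x => f x * ln (f x / phi x)) =
  (fun x => f x * ln (f x / phi x) + phi x - phi x) by apply/funext => x; rewrite addrK.
have ll : L1 leb (fun x : measurableTypeR R => f x * ln (f x / phi x)).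
  by rewrite E; exact: (L1B lS l2).
rewrite /relative_entropy (fin_Rintegral ll) lee_fin E (RintB lS l2) e2.
by rewrite lerBlDr.
Qed.

End entropy_limit.

(** * Transfer to the laws of F and Z, and conclusion *)

Lemma exists_law (R : realType) d (T : measurableType d) (P : probability T R)
    (X : {RV P >-> R}) :
  exists mu : probability (measurableTypeR R) R,
  [/\ forall A : set R, measurable A -> mu A = distribution P X A,
      forall g : R -> R, measurable_fun [set: measurableTypeR R] g ->
        L1 P (fun w => g (X w)) -> L1 mu g,
      forall g : R -> R, measurable_fun [set: measurableTypeR R] g ->
        L1 mu g -> L1 P (fun w => g (X w))
    & forall g : R -> R, L1 mu g -> \int[mu]_x g x = \int[P]_w g (X w)].
Proof.
pose X' : T -> measurableTypeR R := X.
have mX' : measurable_fun [set: T] X' by exact: (measurable_funPT X).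
pose Y : {mfun T >-> measurableTypeR R} :=
  HB.pack_for {mfun T >-> measurableTypeR R} X' (isMeasurableFun.Build _ _ _ _ X' mX').
pose mu : probability (measurableTypeR R) R := distribution P Y.
have back (g : R -> R) : measurable_fun [set: measurableTypeR R] g ->
    L1 mu g -> L1 P (fun w => g (X w)).
  move=> mg /integrableP[_ h]; apply/integrableP; split.
    by apply/measurable_EFinP; exact: (measurableT_comp mg mX').
  apply: le_lt_trans h; rewrite (ge0_integral_distribution (P := P) Y)//.
  by apply/measurable_EFinP; exact: measurableT_comp.
exists mu; split => //.
  move=> g mg /integrableP[_ h]; apply/integrableP; split; first exact/measurable_EFinP.
  apply: le_lt_trans h; rewrite (ge0_integral_distribution (P := P) Y)//.
  by apply/measurable_EFinP; exact: measurableT_comp.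
move=> g lg; have mg := L1_measurable lg.
rewrite /Rintegral (integral_distribution (P := P) (X := Y))//; first exact/measurable_EFinP.
exact: back.
Qed.

Theorem theorem1p7 (R : realType) (d : measure_display) (T : measurableType d)
  (P : probability T R) (F Z : {RV P >-> R}) (f tau : R -> R)
  (alpha kappa eta : R)
  (hf : has_density F f)
  (hF1 : ('E_P[F] = 0)%E)
  (hF2 : ('E_P[fun w => ((F w) ^+ 2)%R] = 1)%E)
  (htau : stein_factor F tau)
  (hZ : standard_gaussian Z)
  (hFZ : independent_rvs F Z)
  (halpha : 0 < alpha) (hkappa : 0 < kappa) (heta : 0 < eta)
  (hmoment : ('E_P[fun w => (`|tau (F w)| `^ (2 + eta))%R] < +oo)%E)
  (hTV : forall x t : R, 0 < t -> t <= 1 ->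
     (tv_dist P (fun w => (Num.sqrt t * F w + Num.sqrt (1 - t) * x)%R) F
      <= (kappa * (1 + `|x|) * t^-1 * (1 - t) `^ alpha)%:E)%E)
  (hDelta : ('E_P[fun w => ((1 - tau (F w)) ^+ 2)%R] <= 1)%E) :
  let Delta := fine ('E_P[fun w => ((1 - tau (F w)) ^+ 2)%R])%E in
  let C_eta := 2 * (4 * kappa + 4) `^ (eta / (eta + 1))
    * fine ('E_P[fun w => (`|Z w| `^ (eta + 2))%R])%E `^ (1 / (eta + 1))
    * (1 + fine ('E_P[fun w => (`|tau (F w)| `^ (eta + 2))%R])%E)
        `^ (1 / (eta + 1)) in
  (relative_entropy f
   <= ((eta + 1) / (Num.min 1 (2 * alpha) * eta) * Delta * `|ln Delta|
       + C_eta * (eta + 1) / (Num.min 1 (2 * alpha) * eta) * Delta)%:E)%E.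
Proof.
cbv zeta.
have [mf f0 fE] := hf.
have [mtau ltau steinP] := htau.
have [mu [muE L1mu L1P RmuE]] := exists_law F.
have [ga [gaZ _ _ RgaE]] := exists_law Z.
have gaE A : measurable A -> ga A = (\int[lebesgue_measure]_(x in A) (normal_pdf 0 1 x)%:E)%E.
  by move=> mA; rewrite gaZ// hZ.
have mFc (g : R -> R) : measurable_fun [set: measurableTypeR R] g ->
    measurable_fun [set: T] (fun w => g (F w)).
  by move=> mg; exact: (measurableT_comp mg (measurable_funPT F)).
have fin (g : R -> R) : measurable_fun [set: measurableTypeR R] g -> (forall x, 0 <= g x) ->
    ('E_P[fun w => (g (F w))%R] < +oo)%E -> L1 mu g.
  move=> mg g0; rewrite unlock => h; apply: L1mu => //.
  by apply: L1_lt_pinfty => //; exact: mFc.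
have EE (X : T -> R) : fine ('E_P[X])%E = \int[P]_w X w by rewrite unlock.
have m2 : measurable_fun [set: measurableTypeR R] (fun x : R => x ^+ 2) by msr.
have mu2 : L1 mu (fun x => x ^+ 2).
  by apply: (fin (fun x => x ^+ 2)) => // [x|]; [exact: sqr_ge0|rewrite hF2 ltry].
have mu2_le1 : \int[mu]_x (x ^+ 2) <= 1.
  by rewrite (RmuE _ mu2) -EE hF2.
have mp : measurable_fun [set: measurableTypeR R] (fun x => `|tau x| `^ (2 + eta)) by msr.
have tauM : L1 mu (fun x => `|tau x| `^ (2 + eta)).
  by apply: (fin (fun x => `|tau x| `^ (2 + eta))) => // x; exact: powR_ge0.
have tau2 : L1 mu (fun x => tau x ^+ 2).
  apply: L1_dom (L1D (L1_cst mu 1) tauM); first by msr.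
  move=> x; rewrite normrX; have [x1|x1] := leP `|tau x| 1.
    by have := powR_ge0 `|tau x| (2 + eta); have := normr_ge0 (tau x); nra.
  have : `|tau x| `^ 2 <= `|tau x| `^ (2 + eta) by rewrite ler_powR ?(ltW x1)// lerDl ltW.
  by rewrite powR_mulrn//; lra.
have stein (g : R -> R) : (forall x, derivable g x 1) -> continuous (derive1 g) ->
    L1 mu (fun x => x * g x) -> L1 mu (fun x => tau x * derive1 g x) ->
    \int[mu]_x (x * g x) = \int[mu]_x (tau x * derive1 g x).
  move=> dg cg l1 l2; rewrite (RmuE _ l1) (RmuE _ l2) -!EE.
  congr fine; apply: steinP => //.
    exact: (L1P _ (L1_measurable l1) l1).
  exact: (L1P _ (L1_measurable l2) l2).
have tv (t x : R) A : 0 < t -> t <= 1 -> measurable A ->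
  `|fine (mu ((fun y => Num.sqrt t * y + Num.sqrt (1 - t) * x) @^-1` A)) - fine (mu A)|
  <= kappa * t^-1 * (1 - t) `^ alpha * (1 + `|x|).
  move=> t0 t1 mA.
  have mh : measurable_fun [set: measurableTypeR R]
    (fun y : R => Num.sqrt t * y + Num.sqrt (1 - t) * x) by msr.
  have mA' : measurable ((fun y : R => Num.sqrt t * y + Num.sqrt (1 - t) * x) @^-1` A).
    by rewrite -[X in measurable X]setTI; exact: mh.
  rewrite (muE _ mA') (muE _ mA).
  have mX : measurable (F @^-1` A).
    by rewrite -[X in measurable X]setTI; exact: (measurable_funPT F).
  have mX' : measurable ((fun w => Num.sqrt t * F w + Num.sqrt (1 - t) * x) @^-1` A).
    by rewrite -[X in measurable X]setTI; exact: (mFc _ mh).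
  have -> : kappa * t^-1 * (1 - t) `^ alpha * (1 + `|x|) =
    kappa * (1 + `|x|) * t^-1 * (1 - t) `^ alpha by ring.
  rewrite -lee_fin; apply: le_trans (hTV x t t0 t1).
  apply: ereal_sup_ubound; exists A => //.
  rewrite -[in LHS](fineK (fin_num_measure P _ mX)) -[in LHS](fineK (fin_num_measure P _ mX')).
  by rewrite -EFinB abse_EFin.
have lD : L1 mu (fun x => (1 - tau x) ^+ 2).
  apply: L1_dom (L1D (L1_cst mu 2) (L1Zl 2 tau2)); first by msr.
  by move=> x; rewrite ger0_norm ?sqr_ge0//; have := sqr_ge0 (1 + tau x); nra.
have DE : fine ('E_P[fun w => ((1 - tau (F w)) ^+ 2)%R])%E = \int[mu]_x ((1 - tau x) ^+ 2).
  by rewrite EE (RmuE _ lD).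
have D1 : \int[mu]_x ((1 - tau x) ^+ 2) <= 1.
  rewrite -lee_fin (RmuE _ lD) -(fin_Rintegral (L1P _ (L1_measurable lD) lD)).
  by move: hDelta; rewrite unlock.
have lZ : L1 ga (fun z => `|z| `^ (2 + eta)).
  by apply: L1_gaussian_powR => //; rewrite addr_gt0.
have ZE : fine ('E_P[fun w => (`|Z w| `^ (eta + 2))%R])%E = \int[ga]_z (`|z| `^ (2 + eta)).
  by rewrite EE (RgaE _ lZ) (addrC eta).
have TE : fine ('E_P[fun w => (`|tau (F w)| `^ (eta + 2))%R])%E =
    \int[mu]_x (`|tau x| `^ (2 + eta)).
  by rewrite EE (RmuE _ tauM) (addrC eta).
rewrite DE ZE TE.
apply: (relative_entropy_le gaE mu2 mu2_le1 halpha hkappa tv _ mf f0) => [t t0 t1|A mA].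
  exact: (flow_entropy_le gaE mu2 mu2_le1 mtau tau2 stein halpha hkappa heta tauM tv D1 t0 t1).
by rewrite (muE _ mA) fE.
Qed.
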